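(* Let $N\ge 2$ be an integer, let $R>0$, and let $B\subset\mathbb{R}^N$ be the ball of radius $R$ centered at the origin. Let $p,q>1$ and let $\delta>0$, $\mu>0$ satisfy $\delta\mu-(p-1)(q-1)>0$. Consider the Dirichlet problem $$(S_R)\qquad -\Delta_p u=v^\delta,\ v>0\ \text{in } B,\qquad -\Delta_q v=u^\mu,\ u>0\ \text{in } B,\qquad u=v=0\ \text{on }\partial B .$$ (1) Suppose that $$\frac{2N}{N+1}<p\le 2\quad\text{and}\quad \frac{2N}{N+1}<q\le 2 ,$$ and set $\underline{m}=\min\{p,q\}$. Then problem $(S_R)$ possesses a (regular radially symmetric) solution $(u,v)$ provided that $$\frac{1}{\delta+1}+\frac{1}{\mu+1}>\frac{N-\underline{m}}{N(\underline{m}-1)} .$$ (2) Suppose that $$2\le p<N\quad\text{and}\quad 2\le q<N ,$$ and set $\overline{m}=\max\{p,q\}$. Then problem $(S_R)$ possesses a (regular radially symmetric) solution $(u,v)$ provided that $$\frac{1}{\delta+1}+\frac{1}{\mu+1}>\frac{N(\overline{m}-1)-\overline{m}}{N(\overline{m}-1)} .$$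
   Context: For $m>1$, $\Delta_m u=\operatorname{div}(|\nabla u|^{m-2}\nabla u)$ is the $m$-Laplacian. Solutions are sought among radially symmetric functions; writing again $u,v$ for the solutions as functions of $r=|x|$, the system becomes $$-(r^{N-1}|u'(r)|^{p-2}u'(r))'=r^{N-1}|v(r)|^\delta,\qquad -(r^{N-1}|v'(r)|^{q-2}v'(r))'=r^{N-1}|u(r)|^\mu,\qquad 0<r<R .$$ A (regular) solution of $(S_R)$ is a pair $(u,v)\in (C^1[0,R]\cap C^2(0,R])^2$ satisfying this system with $u'(0)=v'(0)=0$, $u(R)=v(R)=0$, and $u>0$, $v>0$ on $[0,R)$. *)

(* Defs.v *)
From Stdlib Require Export Reals.
Open Scope R_scope.

Definition Icc (a b x : R) : Prop := a <= x <= b.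
Definition Ioc (a b x : R) : Prop := a < x <= b.

(* D_in and continue_in take limits inside D, so derivatives and continuity
   are one-sided at the endpoints of an interval D. *)
Definition C1_on (D : R -> Prop) (f f' : R -> R) : Prop :=
  forall x, D x -> D_in f f' D x /\ continue_in f' D x.

(* |x|^a. Stdlib's Rpower 0 a equals 1, so the base 0 is treated apart.
   The value 0 is the right one for a > 0; a nonpositive exponent only occurs
   in [mflux], where this factor is multiplied by x = 0. *)
Definition abs_pow (x a : R) : R :=
  if Req_dec_T x 0 then 0 else Rpower (Rabs x) a.

(* |t|^(m-2) t, continuously extended by 0 at t = 0 (for m > 1). *)
Definition mflux (m t : R) : R := abs_pow t (m - 2) * t.

(* -(r^(N-1) |w'|^(m-2) w')' = r^(N-1) g(r) for 0 < r < Rad: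
   the equation -Delta_m w = g in the ball of radius Rad of R^N, for radial
   w and g. Here dw is the derivative w'. *)
Definition radial_eq (N : nat) (Rad m : R) (dw g : R -> R) : Prop :=
  forall r, 0 < r < Rad ->
    derivable_pt_lim (fun s => - (s ^ (N - 1) * mflux m (dw s))) r
      (r ^ (N - 1) * g r).

(* u and v are functions of r = |x|; only their values on [0,Rad] matter. *)
Definition regular_solution (N : nat) (Rad p q delta mu : R)
    (u v : R -> R) : Prop :=
  exists u' u'' v' v'' : R -> R,
    C1_on (Icc 0 Rad) u u' /\ C1_on (Ioc 0 Rad) u' u'' /\
    C1_on (Icc 0 Rad) v v' /\ C1_on (Ioc 0 Rad) v' v'' /\
    radial_eq N Rad p u' (fun r => abs_pow (v r) delta) /\
    radial_eq N Rad q v' (fun r => abs_pow (u r) mu) /\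
    u' 0 = 0 /\ v' 0 = 0 /\
    u Rad = 0 /\ v Rad = 0 /\
    (forall r, 0 <= r < Rad -> 0 < u r /\ 0 < v r).

(* Main.v *)
Require Import Defs.
From Stdlib Require Import Reals Lra Lia Psatz ClassicalEpsilon.
From Coquelicot Require Import Coquelicot.
Open Scope R_scope.

(** Shooting from the origin with u(0) = 1, v(0) = eta. If the nonlinearities are truncated
    below a level eps > 0, the initial value problem is Lipschitz and, for a suitable eta in a
    compact set independent of eps, u and v reach eps at the same radius. As eps -> 0 these
    radii either stay bounded, and the limit solves the problem on a ball (of any radius, by
    scaling), or tend to infinity, and the limit is a positive solution on all of R^N.

    The latter is excluded by a Pohozaev argument. With A = |u'|^(p-1), B = |v'|^(q-1) and
    N = n + 1, the function
      Phi = r^k [ A B + |v'|^(q-2) v (v^delta - N A / r) / (delta + 1)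
                      + |u'|^(p-2) u (u^mu - N B / r) / (mu + 1) ]
    vanishes at 0, is increasing for the right k, and is at most r^k A B, which tends to 0 at
    infinity because u = O(r^(-alpha)), v = O(r^(-beta)) with alpha, beta the exponents of the
    scaling invariance. The right k is N - (m - 2)/(m - 1) with m = max p q if p, q >= 2, and
    N + n (m - 2)/(m - 1) with m = min p q if p, q <= 2; the condition
    2 n - k < N (1/(delta + 1) + 1/(mu + 1)) is then the hypothesis of the theorem. *)

(** * Powers *)

(** The obstacle is that the initial value problem is not Lipschitz where a base vanishes: s^delta
    fails if delta < 1, and the power 1/(m-1) that recovers |w'| from |w'|^(m-1) fails if m > 2,
    already at the origin. A positive lower bound for the sources cures both, since |w'|^(m-1) / r
    is then bounded away from 0. The truncation provides it, and continuous dependence on eta lets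
    the intermediate value theorem find the right shot. The form of Phi is dictated by (A B)' = A
    u^mu + B v^delta - 2 n A B / r: the corrections cancel the first two terms, and they are
    nonpositive because the decreasing v^delta is at most N A / r (likewise u^mu). What remains in
    Phi' is a multiple of A B and two products of such a gap with an expression affine in r u^mu / B
    or r v^delta / A, both in [0, N]. Nonnegativity at the two ends bounds k above: by N -
    (p-2)/(p-1), binding if p >= 2, and by N + n (p-2)/(p-1), binding if p <= 2; likewise for q. The
    chosen k is the largest admissible one. The decay needed at infinity is then a consequence of
    the same subcriticality inequality. *)

Lemma abs_pow_pos x a : 0 < x -> abs_pow x a = Rpower x a.
Proof.
  intros Hx; unfold abs_pow.
  destruct (Req_dec_T x 0); [lra|]. now rewrite Rabs_pos_eq by lra.
Qed.

Lemma abs_pow_0 a : abs_pow 0 a = 0.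
Proof. unfold abs_pow; destruct (Req_dec_T 0 0); [reflexivity|lra]. Qed.

Lemma Rpower_gt0 x a : 0 < Rpower x a.
Proof. apply exp_pos. Qed.

Lemma abs_pow_ge0 x a : 0 <= abs_pow x a.
Proof.
  unfold abs_pow; destruct (Req_dec_T x 0); [lra|].
  apply Rlt_le, Rpower_gt0.
Qed.

Lemma abs_pow_gt0 x a : 0 < x -> 0 < abs_pow x a.
Proof. intros Hx; rewrite abs_pow_pos by easy; apply Rpower_gt0. Qed.

Lemma abs_pow_le x y a : 0 <= a -> 0 <= x <= y -> abs_pow x a <= abs_pow y a.
Proof.
  intros Ha [Hx Hxy]; destruct (Req_dec x 0) as [->|Hx0].
  - rewrite abs_pow_0; apply abs_pow_ge0.
  - rewrite !abs_pow_pos by lra; apply Rle_Rpower_l; lra.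
Qed.

Lemma abs_pow_lt x y a : 0 < a -> 0 <= x < y -> abs_pow x a < abs_pow y a.
Proof.
  intros Ha [Hx Hxy]; destruct (Req_dec x 0) as [->|Hx0].
  - rewrite abs_pow_0; apply abs_pow_gt0; lra.
  - rewrite !abs_pow_pos by lra; apply Rlt_Rpower_l; lra.
Qed.

Lemma abs_pow_mult x y a :
  0 <= x -> 0 <= y -> abs_pow (x * y) a = abs_pow x a * abs_pow y a.
Proof.
  intros Hx Hy.
  destruct (Req_dec x 0) as [->|Hx0]; [rewrite Rmult_0_l, abs_pow_0; ring|].
  destruct (Req_dec y 0) as [->|Hy0]; [rewrite Rmult_0_r, abs_pow_0; ring|].
  rewrite !abs_pow_pos; try nra. now rewrite Rpower_mult_distr by lra.
Qed.

Lemma abs_pow_abs_pow x a b : abs_pow (abs_pow x a) b = abs_pow x (a * b).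
Proof.
  destruct (Req_dec x 0) as [->|Hx0]; [now rewrite !abs_pow_0|].
  assert (H : abs_pow x a = Rpower (Rabs x) a)
    by (unfold abs_pow; destruct (Req_dec_T x 0); easy).
  rewrite H, abs_pow_pos by apply Rpower_gt0.
  unfold abs_pow; destruct (Req_dec_T x 0); [easy|].
  apply Rpower_mult.
Qed.

Lemma abs_pow_1 x : 0 <= x -> abs_pow x 1 = x.
Proof.
  intros Hx; destruct (Req_dec x 0) as [->|Hx0]; [apply abs_pow_0|].
  rewrite abs_pow_pos by lra; apply Rpower_1; lra.
Qed.

Lemma is_derive_Rpower x a :
  0 < x -> is_derive (fun t => Rpower t a) x (Rpower x a * (a / x)).
Proof.
  intros Hx; unfold Rpower; auto_derive; [easy|].
  field; lra.
Qed.

Lemma is_derive_Rpower_comp f x df a :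
  0 < f x -> is_derive f x df ->
  is_derive (fun t => Rpower (f t) a) x (Rpower (f x) a * (a * df / f x)).
Proof.
  intros Hx Hf.
  replace (Rpower (f x) a * (a * df / f x))
    with (scal df (Rpower (f x) a * (a / f x)))
    by (unfold scal; simpl; unfold mult; simpl; field; lra).
  apply (is_derive_comp (fun t => Rpower t a) f); [|exact Hf].
  now apply is_derive_Rpower.
Qed.

Lemma abs_pow_continuous_pos x a : 0 < x -> continuous (fun t => abs_pow t a) x.
Proof.
  intros Hx.
  apply (continuous_ext_loc _ (fun t => Rpower t a)).
  - exists (mkposreal x Hx); intros y Hy.
    symmetry; apply abs_pow_pos.
    unfold ball in Hy; simpl in Hy; unfold AbsRing_ball, abs, minus, plus, opp in Hy.
    simpl in Hy. apply Rabs_def2 in Hy; lra.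
  - apply (ex_derive_continuous (fun t => Rpower t a)); eexists; now apply is_derive_Rpower.
Qed.

Lemma abs_pow_even x a : abs_pow (- x) a = abs_pow x a.
Proof.
  unfold abs_pow; rewrite Rabs_Ropp.
  destruct (Req_dec_T (- x) 0), (Req_dec_T x 0); lra.
Qed.

Lemma abs_pow_continuous a x : 0 < a -> continuous (fun t => abs_pow t a) x.
Proof.
  intros Ha. destruct (Rtotal_order x 0) as [Hx|[->|Hx]].
  - apply (continuous_ext (fun t => abs_pow (- t) a)).
    { intros t; apply abs_pow_even. }
    apply (continuous_comp (fun t : R => - t) (fun t => abs_pow t a)).
    + apply (continuous_opp (fun t : R => t)), continuous_id.
    + apply abs_pow_continuous_pos; lra.
  - intros P [e He]; simpl in He.
    exists (mkposreal (Rpower e (1 / a)) (Rpower_gt0 _ _)); intros y Hy.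
    apply He. rewrite abs_pow_0 in *.
    unfold ball in *; simpl in *; unfold AbsRing_ball, abs, minus, plus, opp in *; simpl in *.
    rewrite Ropp_0, Rplus_0_r in *.
    rewrite Rabs_pos_eq by apply abs_pow_ge0.
    assert (Hee := cond_pos e).
    apply Rle_lt_trans with (abs_pow (Rabs y) a).
    { unfold Rabs; destruct (Rcase_abs y); [rewrite abs_pow_even|]; lra. }
    apply Rlt_le_trans with (abs_pow (Rpower e (1 / a)) a).
    { apply abs_pow_lt; [easy|split; [apply Rabs_pos|easy]]. }
    rewrite abs_pow_pos by apply Rpower_gt0.
    rewrite Rpower_mult. replace (1 / a * a) with 1 by (field; lra).
    rewrite Rpower_1; lra.
  - now apply abs_pow_continuous_pos.
Qed.

Lemma abs_pow_lipschitz a c C : 0 < c -> c <= C ->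
  exists L, 0 <= L /\ forall x y, c <= x <= C -> c <= y <= C ->
    Rabs (abs_pow x a - abs_pow y a) <= L * Rabs (x - y).
Proof.
  intros Hc HcC.
  (* The derivative t^a (a / t) is at most |a| / c times the larger endpoint value of t^a; the sum
     of both endpoint values covers either sign of a. *)
  exists (Rabs a / c * (Rpower c a + Rpower C a)); split.
  { apply Rmult_le_pos; [apply Rmult_le_pos; [apply Rabs_pos|]|].
    - apply Rlt_le, Rinv_0_lt_compat; lra.
    - assert (H1 := Rpower_gt0 c a); assert (H2 := Rpower_gt0 C a); lra. }
  intros x y Hx Hy; rewrite !abs_pow_pos by lra.
  destruct (MVT_gen (fun t => Rpower t a) y x (fun t => Rpower t a * (a / t)))
    as [z [Hz ->]].
  - intros t Ht; apply is_derive_Rpower.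
    unfold Rmin in Ht; destruct (Rle_dec y x); lra.
  - intros t Ht; apply continuity_pt_filterlim, (ex_derive_continuous (fun t => Rpower t a)).
    eexists; apply is_derive_Rpower.
    unfold Rmin in Ht; destruct (Rle_dec y x); lra.
  - rewrite Rabs_mult; apply Rmult_le_compat_r; [apply Rabs_pos|].
    assert (Hz' : c <= z <= C).
    { unfold Rmin, Rmax in Hz; destruct (Rle_dec y x); lra. }
    unfold Rdiv; rewrite !Rabs_mult, Rabs_inv, (Rabs_pos_eq z) by lra.
    rewrite (Rabs_pos_eq (Rpower z a)) by apply Rlt_le, Rpower_gt0.
    rewrite (Rmult_comm (Rpower z a)).
    assert (H1 := Rpower_gt0 c a); assert (H2 := Rpower_gt0 C a).
    assert (H3 := Rpower_gt0 z a).
    assert (H4 : / z <= / c) by (apply Rinv_le_contravar; lra).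
    assert (H5 : 0 < / z) by (apply Rinv_0_lt_compat; lra).
    apply Rmult_le_compat; try lra.
    + apply Rmult_le_pos; [apply Rabs_pos|lra].
    + apply Rmult_le_compat_l; [apply Rabs_pos|lra].
    + destruct (Rle_dec 0 a) as [Ha|Ha].
      * assert (Rpower z a <= Rpower C a) by (apply Rle_Rpower_l; lra); lra.
      * assert (Rpower z a <= Rpower c a); [|lra].
        replace a with (- (- a)) by ring. rewrite !(Rpower_Ropp _ (- a)).
        apply Rinv_le_contravar; [apply Rpower_gt0|].
        apply Rle_Rpower_l; lra.
Qed.

(** * The radial m-Laplacian *)

Lemma derive_nonneg_le (f df : R -> R) a b : a <= b ->
  (forall x, a <= x <= b -> is_derive f x (df x)) ->
  (forall x, a <= x <= b -> 0 <= df x) -> f a <= f b.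
Proof.
  intros Hab Hd Hpos.
  destruct (MVT_gen f a b df) as [z [Hz Heq]].
  - intros x; rewrite Rmin_left, Rmax_right by lra; intros; apply Hd; lra.
  - intros x; rewrite Rmin_left, Rmax_right by lra; intros Hx.
    apply continuity_pt_filterlim, (ex_derive_continuous f); eexists; apply Hd; lra.
  - rewrite Rmin_left, Rmax_right in Hz by lra.
    assert (H := Hpos z Hz); nra.
Qed.

Lemma derive_pos_lt (f df : R -> R) a b : a < b ->
  (forall x, a <= x <= b -> is_derive f x (df x)) ->
  (forall x, a <= x <= b -> 0 < df x) -> f a < f b.
Proof.
  intros Hab Hd Hpos.
  destruct (MVT_gen f a b df) as [z [Hz Heq]].
  - intros x; rewrite Rmin_left, Rmax_right by lra; intros; apply Hd; lra.
  - intros x; rewrite Rmin_left, Rmax_right by lra; intros Hx.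
    apply continuity_pt_filterlim, (ex_derive_continuous f); eexists; apply Hd; lra.
  - rewrite Rmin_left, Rmax_right in Hz by lra.
    assert (H := Hpos z Hz); nra.
Qed.

Lemma derive_le_compare (f g df dg : R -> R) a b : a <= b ->
  (forall x, a <= x <= b -> is_derive f x (df x)) ->
  (forall x, a <= x <= b -> is_derive g x (dg x)) ->
  (forall x, a <= x <= b -> df x <= dg x) -> f b - f a <= g b - g a.
Proof.
  intros Hab Hf Hg Hle.
  assert (H : (fun x => g x - f x) a <= (fun x => g x - f x) b).
  { apply (derive_nonneg_le (fun x => g x - f x) (fun x => dg x - df x)); [easy| |].
    - intros x Hx; apply (is_derive_minus g f); auto.
    - intros x Hx; specialize (Hle x Hx); lra. }
  simpl in H; lra.
Qed.

Definition cont (f : R -> R) : Prop := forall x, continuous f x.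

Definition mass (n : nat) (h : R -> R) (s : R) : R :=
  RInt (fun t => t ^ n * h t) 0 s.

(* |w'|^(m-1) for the radial solution of -Delta_m w = h in dimension n + 1. *)
Definition flux (n : nat) (h : R -> R) (s : R) : R :=
  if Rle_dec s 0 then 0 else mass n h s / s ^ n.

(** This is -w'. As [flux] is 0 at nonpositive radii, [slope] is continuous and [drop]
    differentiable on the whole line, so no one-sided notions are needed at the origin. *)
Definition slope (n : nat) (m : R) (h : R -> R) (s : R) : R :=
  abs_pow (flux n h s) (1 / (m - 1)).

Definition drop (n : nat) (m : R) (h : R -> R) (r : R) : R :=
  RInt (slope n m h) 0 r.

Section Potential.

Variables (n : nat).

Lemma INR_S_gt0 : 0 < INR (S n).
Proof. apply lt_0_INR; lia. Qed.

Lemma continuous_weight (h : R -> R) : cont h ->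
  forall x, continuous (fun t => t ^ n * h t) x.
Proof.
  intros Hh x; apply (continuous_mult (fun t : R => t ^ n) h); [|apply Hh].
  apply (ex_derive_continuous (fun t : R => t ^ n)); auto_derive; easy.
Qed.

Lemma is_derive_mass (h : R -> R) (s : R) : cont h ->
  is_derive (mass n h) s (s ^ n * h s).
Proof.
  intros Hh; unfold mass.
  apply (is_derive_RInt (fun t => t ^ n * h t) (mass n h) 0 s).
  - apply filter_forall; intros y; apply (RInt_correct (V := R_CompleteNormedModule)).
    apply (ex_RInt_continuous (V := R_CompleteNormedModule)).
    intros z _; now apply continuous_weight.
  - now apply continuous_weight.
Qed.

Lemma mass_0 (h : R -> R) : mass n h 0 = 0.
Proof. apply (RInt_point (V := R_CompleteNormedModule)). Qed.

Lemma flux_mass (h : R -> R) (s : R) : 0 < s -> flux n h s = mass n h s / s ^ n.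
Proof. intros Hs; unfold flux; destruct (Rle_dec s 0); [lra|easy]. Qed.

Lemma flux_nonpos (h : R -> R) (s : R) : s <= 0 -> flux n h s = 0.
Proof. intros Hs; unfold flux; destruct (Rle_dec s 0); [easy|lra]. Qed.

(** The shift D makes this the common source of the explicit value for constants, the upper and
    lower bounds, and the distance estimate. *)
Lemma flux_le (h1 h2 : R -> R) (D : R) (s : R) : cont h1 -> cont h2 ->
  0 <= s -> (forall t, 0 <= t <= s -> h1 t <= h2 t + D) ->
  flux n h1 s <= flux n h2 s + D * s / INR (S n).
Proof.
  intros H1 H2 Hs Hle; destruct (Req_dec s 0) as [->|Hs0].
  { rewrite !flux_nonpos by lra; unfold Rdiv; lra. }
  assert (HN := INR_S_gt0).
  assert (Hp : 0 < s ^ n) by (apply pow_lt; lra).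
  rewrite !flux_mass by lra.
  assert (H : mass n h1 s <= mass n h2 s + D * s ^ (S n) / INR (S n)).
  { assert (G : mass n h1 s - mass n h1 0
      <= (fun t => mass n h2 t + D * t ^ (S n) / INR (S n)) s
         - (fun t => mass n h2 t + D * t ^ (S n) / INR (S n)) 0).
    { apply (derive_le_compare (mass n h1) (fun t => mass n h2 t + D * t ^ (S n) / INR (S n))
        (fun t => t ^ n * h1 t)
        (fun t => t ^ n * h2 t + t ^ n * D)); [easy| | |].
      - intros; now apply is_derive_mass.
      - intros x Hx.
        apply (is_derive_plus (mass n h2) (fun t => D * t ^ (S n) / INR (S n))).
        + now apply is_derive_mass.
        + auto_derive; [easy|]. 
          change (match n with 0%nat => 1 | S _ => INR n + 1 end) with (INR (S n)).
          field; lra.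
      - intros x Hx; assert (0 <= x ^ n) by (apply pow_le; lra).
        specialize (Hle x Hx); nra. }
    cbv beta in G. rewrite !mass_0 in G. rewrite pow_i in G by lia.
    unfold Rdiv in G; lra. }
  replace (mass n h2 s / s ^ n + D * s / INR (S n))
    with ((mass n h2 s + D * s ^ S n / INR (S n)) / s ^ n) by (simpl pow; field; lra).
  apply Rmult_le_compat_r; [|easy].
  apply Rlt_le, Rinv_0_lt_compat; lra.
Qed.

Lemma flux_const (c : R) (s : R) : 0 <= s -> flux n (fun _ => c) s = c * s / INR (S n).
Proof.
  intros Hs; destruct (Req_dec s 0) as [->|Hs0].
  { rewrite flux_nonpos by lra; unfold Rdiv; lra. }
  assert (HN := INR_S_gt0).
  assert (Hp : 0 < s ^ n) by (apply pow_lt; lra).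
  assert (Hz : flux n (fun _ => 0) s = 0).
  { rewrite flux_mass by lra; unfold mass.
    rewrite (RInt_ext _ (fun _ => 0)) by (intros; apply Rmult_0_r).
    rewrite RInt_const; unfold scal; simpl; unfold mult; simpl; field; lra. }
  assert (H1 := flux_le (fun _ => c) (fun _ => 0) c s
    (continuous_const c) (continuous_const 0) Hs).
  assert (H2 := flux_le (fun _ => 0) (fun _ => c) (-c) s
    (continuous_const 0) (continuous_const c) Hs).
  rewrite Hz in *.
  assert (- c * s / INR (S n) = - (c * s / INR (S n))) by (unfold Rdiv; ring).
  apply Rle_antisym.
  - specialize (H1 ltac:(intros; lra)); lra.
  - specialize (H2 ltac:(intros; lra)); lra.
Qed.

Lemma flux_upper (h : R -> R) (C : R) (s : R) : cont h -> 0 <= s ->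
  (forall t, 0 <= t <= s -> h t <= C) -> flux n h s <= C * s / INR (S n).
Proof.
  intros Hh Hs Hle; rewrite <- flux_const by easy.
  assert (H := flux_le h (fun _ => C) 0 s Hh (continuous_const C) Hs).
  assert (flux n h s <= flux n (fun _ => C) s + 0 * s / INR (S n)).
  { apply H; intros t Ht; specialize (Hle t Ht); lra. }
  unfold Rdiv in *; lra.
Qed.

Lemma flux_lower (h : R -> R) (c : R) (s : R) : cont h -> 0 <= s ->
  (forall t, 0 <= t <= s -> c <= h t) -> c * s / INR (S n) <= flux n h s.
Proof.
  intros Hh Hs Hle; rewrite <- flux_const by easy.
  assert (H := flux_le (fun _ => c) h 0 s (continuous_const c) Hh Hs).
  assert (flux n (fun _ => c) s <= flux n h s + 0 * s / INR (S n)).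
  { apply H; intros t Ht; specialize (Hle t Ht); lra. }
  unfold Rdiv in *; lra.
Qed.

Lemma flux_dist (h1 h2 : R -> R) (D : R) (s : R) : cont h1 -> cont h2 ->
  0 <= s -> (forall t, 0 <= t <= s -> Rabs (h1 t - h2 t) <= D) ->
  Rabs (flux n h1 s - flux n h2 s) <= D * s / INR (S n).
Proof.
  intros H1 H2 Hs Hle.
  assert (G1 := flux_le h1 h2 D s H1 H2 Hs); assert (G2 := flux_le h2 h1 D s H2 H1 Hs).
  apply Rabs_le; split.
  - apply Ropp_le_cancel; rewrite Ropp_involutive.
    assert (flux n h2 s <= flux n h1 s + D * s / INR (S n)); [apply G2|lra].
    intros t Ht; specialize (Hle t Ht); apply Rabs_le_between in Hle; lra.
  - assert (flux n h1 s <= flux n h2 s + D * s / INR (S n)); [apply G1|lra].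
    intros t Ht; specialize (Hle t Ht); apply Rabs_le_between in Hle; lra.
Qed.

Lemma flux_ext (h1 h2 : R -> R) (s : R) : (forall t, 0 <= t <= s -> h1 t = h2 t) ->
  flux n h1 s = flux n h2 s.
Proof.
  intros H; unfold flux; destruct (Rle_dec s 0); [easy|].
  f_equal; unfold mass; apply RInt_ext; intros x Hx.
  rewrite Rmin_left, Rmax_right in Hx by lra. rewrite H by lra; easy.
Qed.

Lemma slope_ext (m : R) (h1 h2 : R -> R) (s : R) : (forall t, 0 <= t <= s -> h1 t = h2 t) ->
  slope n m h1 s = slope n m h2 s.
Proof. intros H; unfold slope; now rewrite (flux_ext h1 h2). Qed.

Lemma drop_ext (m : R) (h1 h2 : R -> R) (r : R) :
  0 <= r -> (forall t, 0 <= t <= r -> h1 t = h2 t) ->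
  drop n m h1 r = drop n m h2 r.
Proof.
  intros Hr H; apply RInt_ext; intros s Hs.
  rewrite Rmin_left, Rmax_right in Hs by lra.
  apply slope_ext; intros t Ht; apply H; lra.
Qed.

(** The radial equation (r^n A)' = r^n h solved for A', the form in which it enters
    [pohozaev_derive]. *)
Lemma is_derive_flux (h : R -> R) (s : R) : cont h -> 0 < s ->
  is_derive (flux n h) s (h s - INR n * flux n h s / s).
Proof.
  intros Hh Hs.
  assert (Hp : 0 < s ^ n) by (apply pow_lt; lra).
  apply (is_derive_ext_loc (fun t => mass n h t / t ^ n)).
  - exists (mkposreal s Hs); intros y Hy.
    unfold ball in Hy; simpl in Hy; unfold AbsRing_ball, abs, minus, plus, opp in Hy.
    simpl in Hy. apply Rabs_def2 in Hy. rewrite flux_mass; [easy|lra].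
  - assert (Hd : is_derive (fun t : R => t ^ n) s (INR n * s ^ pred n))
      by (auto_derive; [easy|ring]).
    assert (H := is_derive_div (mass n h) (fun t => t ^ n) s _ _
      (is_derive_mass h s Hh) Hd ltac:(lra)).
    rewrite flux_mass by easy.
    match goal with |- is_derive _ _ ?b => match type of H with is_derive _ _ ?a =>
      replace b with a; [exact H|] end end.
    destruct n as [|n']; [simpl; field; lra|].
    rewrite Nat.pred_succ. cbn [pow] in *.
    assert (0 < s ^ n') by (apply pow_lt; lra).
    field; lra.
Qed.

Lemma flux_continuous (h : R -> R) (s : R) : cont h -> continuous (flux n h) s.
Proof.
  intros Hh. destruct (Rtotal_order s 0) as [Hs|[->|Hs]].
  - apply (continuous_ext_loc _ (fun _ => 0)); [|apply continuous_const].
    assert (Hs' : 0 < - s) by lra.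
    exists (mkposreal _ Hs'); intros y Hy.
    unfold ball in Hy; simpl in Hy; unfold AbsRing_ball, abs, minus, plus, opp in Hy.
    simpl in Hy. apply Rabs_def2 in Hy. rewrite flux_nonpos; [easy|lra].
  (* Near the origin h is bounded by some M, which makes the flux at most M times the radius. *)
  - destruct (Hh 0 (ball (h 0) (mkposreal 1 Rlt_0_1))) as [d Hd].
    { now exists (mkposreal 1 Rlt_0_1). }
    set (M := Rabs (h 0) + 1).
    assert (HM : 0 < M) by (assert (H := Rabs_pos (h 0)); unfold M; lra).
    assert (Hb : forall t, Rabs t < d -> Rabs (h t) <= M).
    { intros t Ht. assert (H : ball 0 d t).
      { unfold ball; simpl; unfold AbsRing_ball, abs, minus, plus, opp; simpl.
        now rewrite Ropp_0, Rplus_0_r. }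
      apply Hd in H. unfold ball in H; simpl in H.
      unfold AbsRing_ball, abs, minus, plus, opp in H; simpl in H.
      assert (Rabs (h t) <= Rabs (h 0) + Rabs (h t + - h 0)); [|unfold M; lra].
      replace (h t) with (h 0 + (h t + - h 0)) at 1 by ring. apply Rabs_triang. }
    assert (Hbd : forall y, Rabs y < d -> Rabs (flux n h y) <= M * Rabs y).
    { intros y Hy. destruct (Rle_dec y 0) as [Hy0|Hy0].
      - rewrite flux_nonpos by lra. rewrite Rabs_R0.
        apply Rmult_le_pos; [lra|apply Rabs_pos].
      - rewrite (Rabs_pos_eq y) in * by lra.
        assert (Hh' : forall t, 0 <= t <= y -> - M <= h t <= M).
        { intros t Ht; apply Rabs_le_between, Hb. rewrite Rabs_pos_eq; lra. }
        assert (H1 : flux n h y <= M * y / INR (S n)).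
        { apply flux_upper; [easy|lra|]. intros t Ht; apply Hh'; lra. }
        assert (H2 : - M * y / INR (S n) <= flux n h y).
        { apply flux_lower; [easy|lra|]. intros t Ht; apply Hh'; lra. }
        assert (H3 : M * y / INR (S n) <= M * y).
        { assert (0 < M * y) by nra.
          apply (Rle_div_l (M * y)); [apply INR_S_gt0|].
          assert (1 <= INR (S n)) by (rewrite S_INR; assert (H' := pos_INR n); lra).
          nra. }
        assert (- M * y / INR (S n) = - (M * y / INR (S n))) by (unfold Rdiv; ring).
        apply Rabs_le; lra. }
    intros P [e He].
    assert (Hm : 0 < Rmin d (e / M)).
    { apply Rmin_pos; [apply cond_pos|]. apply Rdiv_lt_0_compat; [apply cond_pos|easy]. }
    exists (mkposreal _ Hm); intros y Hy; apply He.
    rewrite flux_nonpos by lra.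
    unfold ball in *; simpl in *; unfold AbsRing_ball, abs, minus, plus, opp in *; simpl in *.
    rewrite Ropp_0, Rplus_0_r in *.
    assert (H1 : Rabs y < d) by (eapply Rlt_le_trans; [apply Hy|apply Rmin_l]).
    assert (H2 : Rabs y < e / M) by (eapply Rlt_le_trans; [apply Hy|apply Rmin_r]).
    apply Rle_lt_trans with (M * Rabs y); [now apply Hbd|].
    apply (Rlt_div_r _ _ _ HM) in H2; lra.
  - apply (ex_derive_continuous (flux n h)); eexists; now apply is_derive_flux.
Qed.

Lemma slope_ge0 (m : R) (h : R -> R) (s : R) : 0 <= slope n m h s.
Proof. apply abs_pow_ge0. Qed.

Lemma slope_nonpos (m : R) (h : R -> R) (s : R) : s <= 0 -> slope n m h s = 0.
Proof. intros Hs; unfold slope; rewrite flux_nonpos by easy; apply abs_pow_0. Qed.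

Lemma slope_continuous (m : R) (h : R -> R) (s : R) : 1 < m -> cont h ->
  continuous (slope n m h) s.
Proof.
  intros Hm Hh; unfold slope.
  apply (continuous_comp (flux n h) (fun t => abs_pow t (1 / (m - 1)))).
  - now apply flux_continuous.
  - apply abs_pow_continuous. apply Rdiv_lt_0_compat; lra.
Qed.

Lemma is_derive_drop (m : R) (h : R -> R) (r : R) : 1 < m -> cont h ->
  is_derive (drop n m h) r (slope n m h r).
Proof.
  intros Hm Hh; unfold drop.
  apply (is_derive_RInt (slope n m h) (drop n m h) 0 r).
  - apply filter_forall; intros y; apply (RInt_correct (V := R_CompleteNormedModule)).
    apply (ex_RInt_continuous (V := R_CompleteNormedModule)).
    intros z _; now apply slope_continuous.
  - now apply slope_continuous.
Qed.

Lemma drop_continuous (m : R) (h : R -> R) (r : R) : 1 < m -> cont h ->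
  continuous (drop n m h) r.
Proof.
  intros Hm Hh; apply (ex_derive_continuous (drop n m h)).
  eexists; now apply is_derive_drop.
Qed.

Lemma drop_0 (m : R) (h : R -> R) : drop n m h 0 = 0.
Proof. apply (RInt_point (V := R_CompleteNormedModule)). Qed.

Lemma drop_nondecr (m : R) (h : R -> R) (a : R) (b : R) : 1 < m -> cont h -> a <= b ->
  drop n m h a <= drop n m h b.
Proof.
  intros Hm Hh Hab; apply (derive_nonneg_le _ (slope n m h)); [easy| |].
  - intros; now apply is_derive_drop.
  - intros; apply slope_ge0.
Qed.

Lemma slope_upper (m : R) (h : R -> R) (C : R) (s : R) : 1 < m -> cont h -> 0 <= s ->
  (forall t, 0 <= t <= s -> 0 <= h t <= C) ->
  slope n m h s <= abs_pow (C * s / INR (S n)) (1 / (m - 1)).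
Proof.
  intros Hm Hh Hs Hle; apply abs_pow_le.
  - apply Rlt_le, Rdiv_lt_0_compat; lra.
  - split.
    + replace 0 with (0 * s / INR (S n)) by (unfold Rdiv; ring).
      apply flux_lower; [easy|easy|]; intros; now apply Hle.
    + apply flux_upper; [easy|easy|]; intros; now apply Hle.
Qed.

Lemma slope_lower (m : R) (h : R -> R) (c : R) (s : R) : 1 < m -> cont h -> 0 <= s -> 0 <= c ->
  (forall t, 0 <= t <= s -> c <= h t) ->
  abs_pow (c * s / INR (S n)) (1 / (m - 1)) <= slope n m h s.
Proof.
  intros Hm Hh Hs Hc Hle; apply abs_pow_le.
  - apply Rlt_le, Rdiv_lt_0_compat; lra.
  - split.
    + apply Rmult_le_pos; [nra|]. apply Rlt_le, Rinv_0_lt_compat, INR_S_gt0.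
    + now apply flux_lower.
Qed.

Lemma drop_dist_le (m : R) (h1 h2 : R -> R) (g : R -> R) (G : R -> R) (r : R) : 1 < m ->
  cont h1 -> cont h2 -> 0 <= r ->
  (forall x, 0 <= x <= r -> is_derive G x (g x)) ->
  (forall x, 0 <= x <= r -> Rabs (slope n m h1 x - slope n m h2 x) <= g x) ->
  Rabs (drop n m h1 r - drop n m h2 r) <= G r - G 0.
Proof.
  intros Hm H1 H2 Hr HG Hle.
  assert (Hd : forall x, is_derive (fun t => drop n m h1 t - drop n m h2 t) x
    (slope n m h1 x - slope n m h2 x)).
  { intros x; apply (is_derive_minus (drop n m h1) (drop n m h2)); now apply is_derive_drop. }
  assert (G1 : (fun t => drop n m h1 t - drop n m h2 t) r
    - (fun t => drop n m h1 t - drop n m h2 t) 0 <= G r - G 0).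
  { apply (derive_le_compare (fun t => drop n m h1 t - drop n m h2 t) G
      (fun x => slope n m h1 x - slope n m h2 x) g); auto.
    intros x Hx; specialize (Hle x Hx); apply Rabs_le_between in Hle; lra. }
  assert (G2 : (fun t => - G t) r - (fun t => - G t) 0
    <= (fun t => drop n m h1 t - drop n m h2 t) r
    - (fun t => drop n m h1 t - drop n m h2 t) 0).
  { apply (derive_le_compare (fun t => - G t) (fun t => drop n m h1 t - drop n m h2 t)
      (fun t => - g t) (fun x => slope n m h1 x - slope n m h2 x)); auto.
    - intros x Hx; apply (is_derive_opp G); auto.
    - intros x Hx; specialize (Hle x Hx); apply Rabs_le_between in Hle; lra. }
  cbv beta in G1, G2; rewrite !drop_0 in *; apply Rabs_le; lra.
Qed.

(* Each flux is s times an average lying in [c/(n+1), C/(n+1)], where the power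
   1/(m-1) is Lipschitz even if m > 2. *)
Lemma slope_lipschitz (m : R) (c : R) (C : R) (T : R) : 1 < m -> 0 < c <= C -> 0 <= T ->
  exists L, 0 <= L /\ forall h1 h2 D s,
    cont h1 -> cont h2 -> 0 <= s <= T ->
    (forall t, 0 <= t <= s ->
       c <= h1 t <= C /\ c <= h2 t <= C /\ Rabs (h1 t - h2 t) <= D) ->
    Rabs (slope n m h1 s - slope n m h2 s) <= L * D.
Proof.
  intros Hm [Hc HcC] HT. assert (HN := INR_S_gt0).
  set (e := 1 / (m - 1)).
  assert (He : 0 < e) by (apply Rdiv_lt_0_compat; lra).
  destruct (abs_pow_lipschitz e (c / INR (S n)) (C / INR (S n))) as [L [HL HLip]].
  { apply Rdiv_lt_0_compat; lra. }
  { apply Rmult_le_compat_r; [apply Rlt_le, Rinv_0_lt_compat; lra|lra]. }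
  exists (abs_pow T e * (L / INR (S n))); split.
  { apply Rmult_le_pos; [apply abs_pow_ge0|].
    apply Rmult_le_pos; [easy|apply Rlt_le, Rinv_0_lt_compat; lra]. }
  intros h1 h2 D s H1 H2 [Hs HsT] Hb.
  assert (HD : 0 <= D).
  { destruct (Hb 0) as [_ [_ H]]; [lra|]. eapply Rle_trans; [apply Rabs_pos|apply H]. }
  destruct (Req_dec s 0) as [->|Hs0].
  { rewrite !slope_nonpos by lra. rewrite Rminus_diag, Rabs_R0.
    repeat apply Rmult_le_pos; try easy; [apply abs_pow_ge0|].
    apply Rlt_le, Rinv_0_lt_compat; lra. }
  assert (Hav : forall h, cont h ->
    (forall t, 0 <= t <= s -> c <= h t <= C) ->
    c / INR (S n) <= flux n h s / s <= C / INR (S n)).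
  { intros h Hh Hbh; split.
    - apply (Rle_div_r (c / INR (S n))); [lra|].
      replace (c / INR (S n) * s) with (c * s / INR (S n)) by (field; lra).
      apply flux_lower; [easy|easy|]; intros; now apply Hbh.
    - apply (Rle_div_l); [lra|].
      replace (C / INR (S n) * s) with (C * s / INR (S n)) by (field; lra).
      apply flux_upper; [easy|easy|]; intros; now apply Hbh. }
  assert (A1 := Hav h1 H1 ltac:(intros; now apply Hb)).
  assert (A2 := Hav h2 H2 ltac:(intros; now apply Hb)).
  assert (Hcn : 0 < c / INR (S n)) by (apply Rdiv_lt_0_compat; lra).
  assert (Hfac : forall h, c / INR (S n) <= flux n h s / s ->
    slope n m h s = abs_pow s e * abs_pow (flux n h s / s) e).
  { intros h Hh; unfold slope; fold e. rewrite <- abs_pow_mult by lra.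
    f_equal; field; lra. }
  rewrite !Hfac by easy. rewrite <- Rmult_minus_distr_l, Rabs_mult.
  rewrite (Rabs_pos_eq (abs_pow s e)) by apply abs_pow_ge0.
  rewrite Rmult_assoc. apply Rmult_le_compat; [apply abs_pow_ge0|apply Rabs_pos| |].
  { apply abs_pow_le; lra. }
  eapply Rle_trans; [now apply HLip|].
  unfold Rdiv at 3; rewrite Rmult_assoc. apply Rmult_le_compat_l; [easy|].
  replace (flux n h1 s / s - flux n h2 s / s) with ((flux n h1 s - flux n h2 s) / s)
    by (field; lra).
  unfold Rdiv; rewrite Rabs_mult, (Rabs_pos_eq (/ s))
    by (apply Rlt_le, Rinv_0_lt_compat; lra).
  apply (Rle_div_l (Rabs (flux n h1 s - flux n h2 s))); [lra|].
  replace (/ INR (S n) * D * s) with (D * s / INR (S n)) by (field; lra).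
  apply flux_dist; [easy|easy|easy|]. intros; now apply Hb.
Qed.

(** Integrating exp(lam t) gains a factor 1 / lam. In the correspondingly weighted sup norm the
    solution operator is thus a contraction on all of [0, T] for large lam, without shortening the
    interval; L does not depend on lam. *)
Lemma drop_contraction (m : R) (c : R) (C : R) (T : R) : 1 < m -> 0 < c <= C -> 0 <= T ->
  exists L, 0 <= L /\ forall lam h1 h2 D r,
    cont h1 -> cont h2 ->
    0 < lam -> 0 <= D -> 0 <= r <= T ->
    (forall t, 0 <= t <= r ->
       c <= h1 t <= C /\ c <= h2 t <= C /\ Rabs (h1 t - h2 t) <= D * exp (lam * t)) ->
    Rabs (drop n m h1 r - drop n m h2 r) <= L / lam * (D * exp (lam * r)).
Proof.
  intros Hm Hc HT. destruct (slope_lipschitz m c C T Hm Hc HT) as [L [HL HLip]].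
  exists L; split; [easy|].
  intros lam h1 h2 D r H1 H2 Hlam HD [Hr HrT] Hb.
  assert (H : Rabs (drop n m h1 r - drop n m h2 r)
    <= (fun x => L / lam * (D * exp (lam * x))) r - (fun x => L / lam * (D * exp (lam * x))) 0).
  { apply (drop_dist_le m h1 h2 (fun x => L * (D * exp (lam * x)))
      (fun x => L / lam * (D * exp (lam * x)))); try easy.
    - intros x Hx; auto_derive; [easy|field; lra].
    - intros x Hx; apply HLip; try easy; [lra|].
      intros t Ht; destruct (Hb t ltac:(lra)) as [Ha [Hb' Hd]].
      repeat split; try easy. eapply Rle_trans; [apply Hd|].
      apply Rmult_le_compat_l; [easy|]. destruct Ht as [_ [Ht|Ht]].
      + apply Rlt_le, exp_increasing, Rmult_lt_compat_l; easy.
      + rewrite Ht; lra. }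
  cbv beta in H. rewrite Rmult_0_r, exp_0 in H.
  assert (0 <= L / lam * (D * 1)); [|lra].
  apply Rmult_le_pos; [|lra]. apply Rmult_le_pos; [easy|].
  apply Rlt_le, Rinv_0_lt_compat; easy.
Qed.

End Potential.

(** * The initial value problem *)

Lemma cont_comp (f g : R -> R) : cont f -> cont g -> cont (fun t => f (g t)).
Proof. intros Hf Hg x; apply (continuous_comp g f); [apply Hg|apply Hf]. Qed.

Lemma cont_minus_drop n m (h : R -> R) a : 1 < m -> cont h ->
  cont (fun t => a - drop n m h t).
Proof.
  intros Hm Hh x; apply (continuous_minus (fun _ : R => a) (drop n m h)).
  - apply continuous_const.
  - now apply drop_continuous.
Qed.

Lemma cont_lipschitz (f : R -> R) :
  (forall T, 0 <= T -> exists K, forall x y, x <= T -> y <= T ->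
     Rabs (f x - f y) <= K * Rabs (x - y)) -> cont f.
Proof.
  intros Hf x. destruct (Hf (Rabs x + 1)) as [K HK].
  { assert (H := Rabs_pos x); lra. }
  intros P [e He].
  set (K' := Rabs K + 1).
  assert (HK' : 0 < K') by (assert (H := Rabs_pos K); unfold K'; lra).
  assert (Hd : 0 < Rmin 1 (e / K')).
  { apply Rmin_pos; [lra|apply Rdiv_lt_0_compat; [apply cond_pos|easy]]. }
  exists (mkposreal _ Hd); intros y Hy; apply He.
  unfold ball in *; simpl in *; unfold AbsRing_ball, abs, minus, plus, opp in *; simpl in *.
  change (Rabs (f y - f x) < e). change (Rabs (y - x) < Rmin 1 (e / K')) in Hy.
  assert (H1 := Rmin_l 1 (e / K')). assert (H2 := Rmin_r 1 (e / K')).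
  assert (H3 := Rle_abs x). assert (H4 := Rle_abs (y - x)).
  apply Rle_lt_trans with (K' * Rabs (y - x)).
  - eapply Rle_trans; [apply HK; lra|].
    apply Rmult_le_compat_r; [apply Rabs_pos|]. unfold K'; assert (H := Rle_abs K); lra.
  - rewrite Rmult_comm; apply Rlt_div_r; [easy|lra].
Qed.

Lemma drop_lipschitz n m (h : R -> R) C T x y : 1 < m -> cont h -> 0 <= T -> 0 <= C ->
  (forall t, 0 <= t <= T -> 0 <= h t <= C) -> x <= T -> y <= T ->
  Rabs (drop n m h x - drop n m h y)
    <= abs_pow (C * T / INR (S n)) (1 / (m - 1)) * Rabs (x - y).
Proof.
  intros Hm Hh HT HC Hb Hx Hy.
  set (K := abs_pow _ _).
  assert (HK : forall t, t <= T -> slope n m h t <= K).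
  { intros t Ht. destruct (Rle_dec t 0) as [Ht0|Ht0].
    - rewrite slope_nonpos by easy; apply abs_pow_ge0.
    - eapply Rle_trans; [apply (slope_upper n m h C); try easy; try lra|].
      + intros s Hs; apply Hb; lra.
      + assert (HN := INR_S_gt0 n). apply abs_pow_le.
        * apply Rlt_le, Rdiv_lt_0_compat; lra.
        * split.
          -- apply Rmult_le_pos; [nra|apply Rlt_le, Rinv_0_lt_compat; lra].
          -- apply Rmult_le_compat_r; [apply Rlt_le, Rinv_0_lt_compat; lra|nra]. }
  assert (Hle : forall a b, a <= b <= T ->
    0 <= drop n m h b - drop n m h a <= K * (b - a)).
  { intros a b [Hab HbT]; split.
    - assert (H := drop_nondecr n m h a b Hm Hh Hab); lra.
    - replace (K * (b - a)) with ((fun t => K * t) b - (fun t => K * t) a) by ring.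
      apply (derive_le_compare (drop n m h) (fun t => K * t) (slope n m h) (fun _ => K));
        [easy| | |].
      + intros; now apply is_derive_drop.
      + intros; auto_derive; [easy|ring].
      + intros t Ht; apply HK; lra. }
  destruct (Rle_dec x y) as [Hxy|Hxy].
  - assert (H := Hle x y ltac:(lra)).
    rewrite Rabs_minus_sym, (Rabs_minus_sym x), !Rabs_pos_eq; lra.
  - assert (H := Hle y x ltac:(lra)). rewrite !Rabs_pos_eq; lra.
Qed.

Lemma drop_nonpos n m (h : R -> R) r : r <= 0 -> drop n m h r = 0.
Proof.
  intros Hr; unfold drop.
  rewrite (RInt_ext _ (fun _ => 0)).
  - rewrite RInt_const; unfold scal; simpl; unfold mult; simpl; ring.
  - intros x; rewrite Rmin_right, Rmax_left by lra; intros Hx.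
    apply slope_nonpos; lra.
Qed.

(** Every lam above the threshold is allowed so that a single weight, the sum of the thresholds for
    p and q, serves both equations. *)
Lemma coupled_contraction n m c C L T : 1 < m -> 0 < c <= C -> 0 <= L -> 0 <= T ->
  exists lam0, 0 < lam0 /\ forall lam (h1 h2 w1 w2 : R -> R) D r, lam0 <= lam ->
    cont h1 -> cont h2 -> 0 <= D -> 0 <= r <= T ->
    (forall t, 0 <= t <= r -> c <= h1 t <= C /\ c <= h2 t <= C /\
       Rabs (h1 t - h2 t) <= L * Rabs (w1 t - w2 t) /\
       Rabs (w1 t - w2 t) <= D * exp (lam * t)) ->
    Rabs (drop n m h1 r - drop n m h2 r) <= D / 2 * exp (lam * r).
Proof.
  intros Hm Hc HL HT. destruct (drop_contraction n m c C T Hm Hc HT) as [K [HK HC]].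
  exists (1 + 2 * (K * L)); split; [nra|].
  intros lam h1 h2 w1 w2 D r Hlam H1 H2 HD Hr Hb.
  assert (HKL : 0 <= K * L) by nra.
  eapply Rle_trans.
  { apply (HC lam h1 h2 (L * D) r); try easy; [lra|nra|].
    intros t Ht; destruct (Hb t Ht) as [A1 [A2 [A3 A4]]]; repeat split; try easy.
    eapply Rle_trans; [apply A3|]. rewrite Rmult_assoc; now apply Rmult_le_compat_l. }
  assert (He := exp_pos (lam * r)).
  replace (K / lam * (L * D * exp (lam * r)))
    with (K * L / lam * (D * exp (lam * r))) by (field; lra).
  replace (D / 2 * exp (lam * r)) with (/ 2 * (D * exp (lam * r))) by field.
  apply Rmult_le_compat_r; [nra|].
  apply (Rle_div_l (K * L)); lra.
Qed.

Lemma exp_ge_1 x : 0 <= x -> 1 <= exp x.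
Proof. intros [H|<-]; [rewrite <- exp_0; now apply Rlt_le, exp_increasing|rewrite exp_0; lra]. Qed.

Lemma is_lim_seq_Rabs_le (u : nat -> R) (l a M : R) : is_lim_seq u l ->
  (exists k0, forall k, (k0 <= k)%nat -> Rabs (u k - a) <= M) -> Rabs (l - a) <= M.
Proof.
  intros Hu [k0 Hle].
  assert (H : is_lim_seq (fun k => Rabs (u k - a)) (Rabs (l - a))).
  { apply (is_lim_seq_abs (fun k => u k - a) (l - a)).
    apply is_lim_seq_minus'; [easy|apply is_lim_seq_const]. }
  apply (is_lim_seq_le_loc _ (fun _ => M) (Rabs (l - a)) M) in H.
  - exact H.
  - exists k0; intros k Hk; now apply Hle.
  - apply is_lim_seq_const.
Qed.

Lemma half_pow_small e D : 0 < e -> 0 <= D -> exists k, D * (/ 2) ^ k < e.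
Proof.
  intros He HD. destruct (pow_lt_1_zero (/ 2)) with (y := e / (D + 1)) as [k Hk].
  - rewrite Rabs_pos_eq; lra.
  - apply Rdiv_lt_0_compat; lra.
  - exists k; specialize (Hk k (le_n k)).
    assert (Hpos : 0 < (/ 2) ^ k) by (apply pow_lt; lra).
    rewrite Rabs_pos_eq in Hk by lra. apply Rlt_div_r in Hk; lra.
Qed.

(** * Continuous dependence on the initial value *)

Section Stability.

Variables (n : nat) (p q c C L T : R).
Hypotheses (Hp : 1 < p) (Hq : 1 < q) (Hc : 0 < c <= C) (HL : 0 <= L) (HT : 0 <= T).

(** If D is the weighted maximum of |v1 - v2|, one pass through each equation gives D <= |eta1 -
    eta2| + D / 4. The sources are only required to be Lipschitz functions of v and u along the two
    solutions, so that the lemma applies both to the truncated system and to the true powers at a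
    distance from 0. *)
Lemma stability :
  exists K, 0 <= K /\ forall (F1 F2 G1 G2 u1 u2 v1 v2 : R -> R) xi eta1 eta2 r,
    cont F1 -> cont F2 -> cont G1 -> cont G2 -> cont v1 -> cont v2 -> 0 <= r <= T ->
    (forall t, 0 <= t <= r -> u1 t = xi - drop n p F1 t /\ u2 t = xi - drop n p F2 t) ->
    (forall t, 0 <= t <= r -> v1 t = eta1 - drop n q G1 t /\ v2 t = eta2 - drop n q G2 t) ->
    (forall t, 0 <= t <= r -> c <= F1 t <= C /\ c <= F2 t <= C /\
       Rabs (F1 t - F2 t) <= L * Rabs (v1 t - v2 t)) ->
    (forall t, 0 <= t <= r -> c <= G1 t <= C /\ c <= G2 t <= C /\
       Rabs (G1 t - G2 t) <= L * Rabs (u1 t - u2 t)) ->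
    Rabs (u1 r - u2 r) <= K * Rabs (eta1 - eta2) /\
    Rabs (v1 r - v2 r) <= K * Rabs (eta1 - eta2).
Proof.
  destruct (coupled_contraction n p c C L T) as [l1 [Hl1 HC1]]; try easy.
  destruct (coupled_contraction n q c C L T) as [l2 [Hl2 HC2]]; try easy.
  set (lam := l1 + l2).
  exists (2 * exp (lam * T)); split; [assert (H := exp_pos (lam * T)); lra|].
  intros F1 F2 G1 G2 u1 u2 v1 v2 xi eta1 eta2 r cF1 cF2 cG1 cG2 cv1 cv2 Hr Hu Hv HF HG.
  set (W := fun t => exp (- (lam * t)) * Rabs (v1 t - v2 t)).
  destruct (continuity_ab_maj W 0 r) as [t0 [Hmax Ht0]]; [easy| |].
  { intros t _; apply continuity_pt_filterlim.
    apply (continuous_mult (fun t => exp (- (lam * t))) (fun t => Rabs (v1 t - v2 t))).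
    - apply (ex_derive_continuous (fun t : R => exp (- (lam * t)))); auto_derive; easy.
    - apply (continuous_comp (fun t => v1 t - v2 t) Rabs).
      + apply (continuous_minus v1 v2); [apply cv1|apply cv2].
      + apply continuous_Rabs. }
  set (D := W t0).
  assert (HD : 0 <= D).
  { apply Rmult_le_pos; [apply Rlt_le, exp_pos|apply Rabs_pos]. }
  assert (Hvb : forall t, 0 <= t <= r -> Rabs (v1 t - v2 t) <= D * exp (lam * t)).
  { intros t Ht; specialize (Hmax t Ht); fold D in Hmax. unfold W in Hmax at 1.
    assert (He := exp_pos (lam * t)). rewrite exp_Ropp in Hmax.
    apply (Rmult_le_compat_r (exp (lam * t))) in Hmax; [|lra].
    replace (/ exp (lam * t) * Rabs (v1 t - v2 t) * exp (lam * t))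
      with (Rabs (v1 t - v2 t)) in Hmax by (field; lra). easy. }
  assert (Hub : forall t, 0 <= t <= r -> Rabs (u1 t - u2 t) <= D / 2 * exp (lam * t)).
  { intros t Ht; destruct (Hu t Ht) as [-> ->].
    replace (xi - drop n p F1 t - (xi - drop n p F2 t))
      with (- (drop n p F1 t - drop n p F2 t)) by ring. rewrite Rabs_Ropp.
    apply (HC1 lam F1 F2 v1 v2); try easy; [unfold lam; lra|lra|].
    intros s Hs. destruct (HF s) as [A1 [A2 A3]]; [lra|].
    repeat split; try easy. apply Hvb; lra. }
  assert (Hvb' : forall t, 0 <= t <= r ->
    Rabs (v1 t - v2 t) <= Rabs (eta1 - eta2) + D / 2 / 2 * exp (lam * t)).
  { intros t Ht; destruct (Hv t Ht) as [-> ->].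
    replace (eta1 - drop n q G1 t - (eta2 - drop n q G2 t))
      with ((eta1 - eta2) + - (drop n q G1 t - drop n q G2 t)) by ring.
    eapply Rle_trans; [apply Rabs_triang|]. rewrite Rabs_Ropp.
    apply Rplus_le_compat_l.
    apply (HC2 lam G1 G2 u1 u2); try easy; [unfold lam; lra|lra|lra|].
    intros s Hs. destruct (HG s) as [A1 [A2 A3]]; [lra|].
    repeat split; try easy. apply Hub; lra. }
  assert (HD' : D <= 2 * Rabs (eta1 - eta2)).
  { assert (He : 1 <= exp (lam * t0)) by (apply exp_ge_1; unfold lam; nra).
    assert (H := Hvb' t0 Ht0).
    assert (Heq : Rabs (v1 t0 - v2 t0) = D * exp (lam * t0)).
    { unfold D, W; rewrite exp_Ropp; field; lra. }
    rewrite Heq in H. assert (Ha := Rabs_pos (eta1 - eta2)). nra. }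
  assert (He : exp (lam * r) <= exp (lam * T)).
  { destruct (proj2 Hr) as [Hlt| ->]; [|lra].
    apply Rlt_le, exp_increasing, Rmult_lt_compat_l; [unfold lam; lra|easy]. }
  assert (He0 := exp_pos (lam * r)).
  assert (HDe : D * exp (lam * r) <= 2 * exp (lam * T) * Rabs (eta1 - eta2)).
  { replace (2 * exp (lam * T) * Rabs (eta1 - eta2))
      with (2 * Rabs (eta1 - eta2) * exp (lam * T)) by ring.
    apply Rmult_le_compat; lra. }
  assert (B1 := Hub r ltac:(lra)); assert (B2 := Hvb r ltac:(lra)).
  split; nra.
Qed.

End Stability.

(** * Existence by Picard iteration *)

Section Picard.

Variables (n : nat) (p q c C L xi eta : R) (f g : R -> R).
Hypotheses (Hp : 1 < p) (Hq : 1 < q) (Hc : 0 < c <= C) (HL : 0 <= L).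
Hypotheses (cf : cont f) (cg : cont g).
Hypothesis Hf : forall x, c <= f x <= C.
Hypothesis Hg : forall x, c <= g x <= C.
Hypothesis Lf : forall x y, Rabs (f x - f y) <= L * Rabs (x - y).
Hypothesis Lg : forall x y, Rabs (g x - g y) <= L * Rabs (x - y).

Definition picard_u (v : R -> R) (r : R) : R := xi - drop n p (fun t => f (v t)) r.
Definition picard_v (u : R -> R) (r : R) : R := eta - drop n q (fun t => g (u t)) r.

(** Only v is iterated: u is a function of v through [picard_u], which turns the system into a fixed
    point problem for one function. *)
Fixpoint picard_iter (k : nat) : R -> R :=
  match k with
  | O => fun _ => eta
  | S k' => picard_v (picard_u (picard_iter k'))
  end.

Lemma picard_u_cont v : cont v -> cont (picard_u v).
Proof. intros Hv; apply cont_minus_drop; [easy|now apply cont_comp]. Qed.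

Lemma picard_v_cont u : cont u -> cont (picard_v u).
Proof. intros Hu; apply cont_minus_drop; [easy|now apply cont_comp]. Qed.

Lemma picard_iter_cont k : cont (picard_iter k).
Proof.
  induction k; simpl; [intros x; apply continuous_const|].
  now apply picard_v_cont, picard_u_cont.
Qed.

Lemma picard_step T : 0 <= T -> exists lam, 0 < lam /\ forall v1 v2 D,
  cont v1 -> cont v2 -> 0 <= D ->
  (forall t, 0 <= t <= T -> Rabs (v1 t - v2 t) <= D * exp (lam * t)) ->
  forall t, 0 <= t <= T ->
    Rabs (picard_v (picard_u v1) t - picard_v (picard_u v2) t) <= D / 2 * exp (lam * t).
Proof.
  intros HT.
  destruct (coupled_contraction n p c C L T) as [l1 [Hl1 HC1]]; try easy.
  destruct (coupled_contraction n q c C L T) as [l2 [Hl2 HC2]]; try easy.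
  exists (l1 + l2); split; [lra|].
  intros v1 v2 D cv1 cv2 HD Hv.
  assert (Hu : forall t, 0 <= t <= T ->
    Rabs (picard_u v1 t - picard_u v2 t) <= D / 2 * exp ((l1 + l2) * t)).
  { intros t Ht; unfold picard_u.
    match goal with |- Rabs (_ - ?a - (_ - ?b)) <= _ =>
      replace (xi - a - (xi - b)) with (- (a - b)) by ring end.
    rewrite Rabs_Ropp.
    apply (HC1 (l1 + l2) (fun t => f (v1 t)) (fun t => f (v2 t)) v1 v2); try easy.
    - lra.
    - now apply cont_comp.
    - now apply cont_comp.
    - intros s Hs; repeat split; try apply Hf; [apply Lf|apply Hv; lra]. }
  intros t Ht; unfold picard_v at 1 2.
  match goal with |- Rabs (_ - ?a - (_ - ?b)) <= _ =>
    replace (eta - a - (eta - b)) with (- (a - b)) by ring end.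
  rewrite Rabs_Ropp.
  assert (He := exp_pos ((l1 + l2) * t)).
  apply Rle_trans with (D / 2 / 2 * exp ((l1 + l2) * t)); [|nra].
  apply (HC2 (l1 + l2) (fun t => g (picard_u v1 t)) (fun t => g (picard_u v2 t))
    (picard_u v1) (picard_u v2)); try easy; try lra.
  - now apply cont_comp, picard_u_cont.
  - now apply cont_comp, picard_u_cont.
  - intros s Hs; repeat split; try apply Hg; [apply Lg|apply Hu; lra].
Qed.

Lemma picard_iter_nonpos k r : r <= 0 -> picard_iter k r = eta.
Proof.
  intros Hr; destruct k; [easy|]. simpl; unfold picard_v.
  rewrite drop_nonpos by easy; ring.
Qed.

Lemma picard_bound T : 0 <= T -> exists lam D, 0 < lam /\ 0 <= D /\
  forall k j t, 0 <= t <= T ->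
    Rabs (picard_iter (k + j) t - picard_iter k t) <= D * (/ 2) ^ k * exp (lam * t).
Proof.
  intros HT; destruct (picard_step T HT) as [lam [Hlam Hstep]].
  (* The first increment is a [drop], hence nondecreasing, and its value at T bounds it on
     [0, T]. *)
  set (D0 := Rabs (eta - picard_iter 1 T)).
  exists lam, (2 * D0); split; [easy|]. assert (HD0 : 0 <= D0) by apply Rabs_pos.
  split; [lra|].
  assert (H2 : forall k, 0 < (/ 2) ^ k) by (intros k; apply pow_lt; lra).
  assert (Hone : forall k t, 0 <= t <= T ->
    Rabs (picard_iter (S k) t - picard_iter k t) <= D0 * (/ 2) ^ k * exp (lam * t)).
  { induction k as [|k IH]; intros t Ht.
    - assert (He : 1 <= exp (lam * t)) by (apply exp_ge_1; nra).
      rewrite pow_O, Rmult_1_r. apply Rle_trans with D0; [|nra].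
      unfold D0; simpl; unfold picard_v.
      match goal with |- Rabs (eta - drop _ _ ?h _ - _) <= _ =>
        assert (ch : cont h) by (apply cont_comp; [easy|];
          apply picard_u_cont; intros x; apply continuous_const);
        assert (A1 := drop_nondecr n q h 0 t Hq ch (proj1 Ht));
        assert (A2 := drop_nondecr n q h t T Hq ch (proj2 Ht));
        rewrite drop_0 in A1 end.
      rewrite Rabs_minus_sym, !Rabs_pos_eq; lra.
    - assert (H := Hstep (picard_iter (S k)) (picard_iter k) (D0 * (/ 2) ^ k)
        (picard_iter_cont (S k)) (picard_iter_cont k)).
      specialize (H2 k). simpl pow.
      replace (D0 * (/ 2 * (/ 2) ^ k)) with (D0 * (/ 2) ^ k / 2) by field.
      apply H; [nra|easy|easy]. }
  intros k j t Ht. assert (He := exp_pos (lam * t)).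
  (* The telescoped difference of powers is kept in the bound, since it is what makes the induction
     on j close. *)
  assert (Hj : Rabs (picard_iter (k + j) t - picard_iter k t)
    <= 2 * D0 * ((/ 2) ^ k - (/ 2) ^ (k + j)) * exp (lam * t)).
  { induction j as [|j IH].
    - rewrite Nat.add_0_r, Rminus_diag, Rabs_R0; lra.
    - replace (k + S j)%nat with (S (k + j)) by lia.
      assert (H := Hone (k + j)%nat t Ht).
      replace (picard_iter (S (k + j)) t - picard_iter k t)
        with ((picard_iter (S (k + j)) t - picard_iter (k + j) t)
              + (picard_iter (k + j) t - picard_iter k t)) by ring.
      eapply Rle_trans; [apply Rabs_triang|].
      eapply Rle_trans; [apply Rplus_le_compat; [apply H|apply IH]|].
      simpl pow. right; field. }
  eapply Rle_trans; [apply Hj|]. assert (H3 := H2 (k + j)%nat).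
  apply Rmult_le_compat_r; [lra|]. nra.
Qed.

Definition picard_lim (t : R) : R := real (Lim_seq (fun k => picard_iter k t)).

Lemma picard_lim_spec t : is_lim_seq (fun k => picard_iter k t) (picard_lim t).
Proof.
  apply Lim_seq_correct', ex_lim_seq_cauchy_corr.
  assert (HT : 0 <= Rmax 0 t) by apply Rmax_l.
  destruct (picard_bound (Rmax 0 t) HT) as [lam [D [Hlam [HD Hb]]]].
  assert (Hle : forall k j, Rabs (picard_iter (k + j) t - picard_iter k t)
    <= D * exp (lam * t) * (/ 2) ^ k).
  { intros k j; destruct (Rle_dec 0 t) as [Ht|Ht].
    - assert (H := Hb k j t (conj Ht (Rmax_r 0 t))); lra.
    - rewrite !picard_iter_nonpos by lra. rewrite Rminus_diag, Rabs_R0.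
      apply Rmult_le_pos; [apply Rmult_le_pos; [easy|apply Rlt_le, exp_pos]|].
      apply pow_le; lra. }
  intros e. destruct (half_pow_small (e / 2) (D * exp (lam * t))) as [k Hk].
  { assert (H := cond_pos e); lra. }
  { apply Rmult_le_pos; [easy|apply Rlt_le, exp_pos]. }
  exists k; intros a b Ha Hbb.
  assert (A1 := Hle k (a - k)%nat); assert (A2 := Hle k (b - k)%nat).
  replace (k + (a - k))%nat with a in A1 by lia.
  replace (k + (b - k))%nat with b in A2 by lia.
  replace (picard_iter a t - picard_iter b t)
    with ((picard_iter a t - picard_iter k t) + - (picard_iter b t - picard_iter k t)) by ring.
  eapply Rle_lt_trans; [apply Rabs_triang|]. rewrite Rabs_Ropp. lra.
Qed.

(** Since g is bounded, all iterates after the first share a Lipschitz constant on each half-line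
    bounded above, and it passes to the pointwise limit. *)
Lemma picard_lim_cont : cont picard_lim.
Proof.
  apply cont_lipschitz; intros T HT.
  exists (abs_pow (C * T / INR (S n)) (1 / (q - 1))); intros x y Hx Hy.
  assert (H : is_lim_seq (fun k => picard_iter k x - picard_iter k y)
    (picard_lim x - picard_lim y)).
  { apply is_lim_seq_minus'; apply picard_lim_spec. }
  rewrite <- (Rminus_0_r (picard_lim x - picard_lim y)).
  apply (is_lim_seq_Rabs_le _ _ _ _ H).
  exists 1%nat; intros [|k] Hk; [lia|]. simpl; unfold picard_v.
  rewrite Rminus_0_r.
  match goal with |- Rabs (_ - ?a - (_ - ?b)) <= _ =>
    replace (eta - a - (eta - b)) with (- (a - b)) by ring end.
  rewrite Rabs_Ropp; apply drop_lipschitz; try easy.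
  - apply cont_comp; [easy|apply picard_u_cont, picard_iter_cont].
  - lra.
  - intros t _; assert (H' := Hg (picard_u (picard_iter k) t)); lra.
Qed.

Lemma picard_lim_fixpoint r : picard_lim r = picard_v (picard_u picard_lim) r.
Proof.
  destruct (Rle_dec 0 r) as [Hr|Hr].
  2: { unfold picard_v; rewrite drop_nonpos by lra.
       assert (H := picard_lim_spec r).
       apply (is_lim_seq_ext _ (fun _ => eta)) in H.
       - apply is_lim_seq_unique in H. rewrite Lim_seq_const in H.
         injection H; lra.
       - intros k; apply picard_iter_nonpos; lra. }
  destruct (picard_bound r Hr) as [lam0 [D [Hlam0 [HD Hb]]]].
  destruct (picard_step r Hr) as [lam [Hlam Hstep]].
  assert (HE : 0 <= D * exp (lam0 * r)) by (apply Rmult_le_pos; [easy|apply Rlt_le, exp_pos]).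
  (* The weights [lam0] and [lam] come from separate existentials and need not agree. The error is
     therefore first bounded by a constant on [0, r], which is then put under the weight of
     [Hstep]. *)
  assert (Hlim : forall k t, 0 <= t <= r ->
    Rabs (picard_lim t - picard_iter k t) <= D * exp (lam0 * r) * (/ 2) ^ k).
  { intros k t Ht. apply (is_lim_seq_Rabs_le _ _ _ _ (picard_lim_spec t)).
    exists k; intros j Hj. replace j with (k + (j - k))%nat by lia.
    eapply Rle_trans; [now apply Hb|].
    assert (He : exp (lam0 * t) <= exp (lam0 * r)).
    { destruct (proj2 Ht) as [Hlt| ->]; [|lra].
      apply Rlt_le, exp_increasing, Rmult_lt_compat_l; easy. }
    assert (H2 : 0 < (/ 2) ^ k) by (apply pow_lt; lra).
    replace (D * exp (lam0 * r) * (/ 2) ^ k) with (D * (/ 2) ^ k * exp (lam0 * r)) by ring.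
    apply Rmult_le_compat_l; [|easy]. nra. }
  assert (Hfix : forall k, Rabs (picard_iter (S k) r - picard_v (picard_u picard_lim) r)
    <= D * exp (lam0 * r) * exp (lam * r) * (/ 2) ^ k).
  { intros k. assert (H2 : 0 < (/ 2) ^ k) by (apply pow_lt; lra).
    assert (He := exp_pos (lam * r)).
    simpl picard_iter. eapply Rle_trans.
    - apply (Hstep (picard_iter k) picard_lim (D * exp (lam0 * r) * (/ 2) ^ k)).
      + apply picard_iter_cont.
      + apply picard_lim_cont.
      + nra.
      + intros t Ht; rewrite Rabs_minus_sym. specialize (Hlim k t Ht).
        assert (He1 : 1 <= exp (lam * t)) by (apply exp_ge_1; nra).
        assert (0 <= D * exp (lam0 * r) * (/ 2) ^ k) by nra. nra.
      + lra.
    - assert (0 <= D * exp (lam0 * r) * (/ 2) ^ k * exp (lam * r)) by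
        (apply Rmult_le_pos; nra). lra. }
  apply Rminus_diag_uniq.
  destruct (Req_dec (picard_lim r - picard_v (picard_u picard_lim) r) 0) as [H0|H0]; [easy|].
  exfalso. apply Rabs_pos_lt in H0.
  set (E := D * exp (lam0 * r)) in *.
  assert (HE2 : 0 <= E * exp (lam * r)) by (apply Rmult_le_pos; [easy|apply Rlt_le, exp_pos]).
  destruct (half_pow_small (Rabs (picard_lim r - picard_v (picard_u picard_lim) r))
    (E + E * exp (lam * r))) as [k Hk]; [easy|lra|].
  assert (A1 := Hlim (S k) r ltac:(lra)); assert (A2 := Hfix k).
  assert (A3 := Rabs_triang (picard_lim r - picard_iter (S k) r)
    (picard_iter (S k) r - picard_v (picard_u picard_lim) r)).
  replace (picard_lim r - picard_iter (S k) r
    + (picard_iter (S k) r - picard_v (picard_u picard_lim) r))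
    with (picard_lim r - picard_v (picard_u picard_lim) r) in A3 by ring.
  assert (H2 : 0 < (/ 2) ^ k) by (apply pow_lt; lra).
  simpl pow in A1. nra.
Qed.

End Picard.

(** * Shooting for the truncated system *)

(** The cut at M makes the powers globally bounded and Lipschitz, as the Picard iteration requires.
    It is inactive along the solutions of interest, which decrease from initial values at most M. *)
Definition trunc (eps M x : R) : R := Rmax eps (Rmin x M).

Definition trunc_pow (eps M a x : R) : R := abs_pow (trunc eps M x) a.

Lemma trunc_range eps M x : eps <= M -> eps <= trunc eps M x <= M.
Proof.
  intros H; unfold trunc; split; [apply Rmax_l|].
  apply Rmax_lub; [easy|apply Rmin_r].
Qed.

Lemma trunc_id eps M x : eps <= x <= M -> trunc eps M x = x.
Proof. intros H; unfold trunc; rewrite Rmin_left, Rmax_right; lra. Qed.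

Lemma trunc_lipschitz eps M x y : Rabs (trunc eps M x - trunc eps M y) <= Rabs (x - y).
Proof.
  assert (Hmin : Rabs (Rmin x M - Rmin y M) <= Rabs (x - y)).
  { unfold Rmin; destruct (Rle_dec x M), (Rle_dec y M);
      unfold Rabs; repeat destruct Rcase_abs; lra. }
  eapply Rle_trans; [|apply Hmin]. unfold trunc.
  generalize (Rmin x M), (Rmin y M); intros a b. unfold Rmax.
  destruct (Rle_dec eps a), (Rle_dec eps b); unfold Rabs; repeat destruct Rcase_abs; lra.
Qed.

Lemma trunc_pow_range eps M a x : 0 < a -> 0 < eps <= M ->
  abs_pow eps a <= trunc_pow eps M a x <= abs_pow M a.
Proof.
  intros Ha H; assert (H' := trunc_range eps M x (proj2 H)).
  unfold trunc_pow; split; apply abs_pow_le; lra.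
Qed.

Lemma trunc_pow_lipschitz eps M a : 0 < eps <= M -> exists L, 0 <= L /\
  forall x y, Rabs (trunc_pow eps M a x - trunc_pow eps M a y) <= L * Rabs (x - y).
Proof.
  intros H; destruct (abs_pow_lipschitz a eps M) as [L [HL HLip]]; try easy.
  exists L; split; [easy|]; intros x y.
  eapply Rle_trans; [apply HLip; now apply trunc_range|].
  apply Rmult_le_compat_l; [easy|apply trunc_lipschitz].
Qed.

Lemma trunc_pow_cont eps M a : 0 < eps <= M -> cont (trunc_pow eps M a).
Proof.
  intros H; destruct (trunc_pow_lipschitz eps M a H) as [L [HL HLip]].
  apply cont_lipschitz; intros T _; exists L; auto.
Qed.

Lemma drop_lower n m (h : R -> R) c a b : 1 < m -> cont h -> 0 <= c -> 0 <= a <= b ->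
  (forall t, 0 <= t <= b -> c <= h t) ->
  abs_pow (c * a / INR (S n)) (1 / (m - 1)) * (b - a) <= drop n m h b - drop n m h a.
Proof.
  intros Hm ch Hc Hab Hh. assert (HN := INR_S_gt0 n). set (e := 1 / (m - 1)).
  assert (He : 0 < e) by (apply Rdiv_lt_0_compat; lra).
  set (K := abs_pow _ _).
  replace (K * (b - a)) with ((fun t => K * t) b - (fun t => K * t) a) by ring.
  apply (derive_le_compare (fun t => K * t) (drop n m h) (fun _ => K) (slope n m h));
    [lra| | |].
  - intros; auto_derive; [easy|ring].
  - intros; now apply is_derive_drop.
  - intros t Ht. eapply Rle_trans; [|apply (slope_lower n m h c); try easy; try lra].
    + apply abs_pow_le; [now apply Rlt_le|]. split.
      * apply Rmult_le_pos; [nra|apply Rlt_le, Rinv_0_lt_compat; lra].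
      * apply Rmult_le_compat_r; [apply Rlt_le, Rinv_0_lt_compat; lra|nra].
    + intros s Hs; apply Hh; lra.
Qed.

Lemma drop_incr n m (h : R -> R) c a b : 1 < m -> cont h -> 0 < c -> 0 <= a < b ->
  (forall t, 0 <= t <= b -> c <= h t) -> drop n m h a < drop n m h b.
Proof.
  intros Hm ch Hc Hab Hh. assert (HN := INR_S_gt0 n).
  assert (H1 := drop_nondecr n m h a ((a + b) / 2) Hm ch ltac:(lra)).
  assert (H2 := drop_lower n m h c ((a + b) / 2) b Hm ch ltac:(lra) ltac:(lra) Hh).
  assert (0 < abs_pow (c * ((a + b) / 2) / INR (S n)) (1 / (m - 1)) * (b - (a + b) / 2)); [|lra].
  apply Rmult_lt_0_compat; [|lra]. apply abs_pow_gt0, Rdiv_lt_0_compat; nra.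
Qed.

Lemma drop_upper n m (h : R -> R) C b : 1 < m -> cont h -> 0 <= b -> 0 <= C ->
  (forall t, 0 <= t <= b -> 0 <= h t <= C) ->
  0 <= drop n m h b <= abs_pow (C * b / INR (S n)) (1 / (m - 1)) * b.
Proof.
  intros Hm ch Hb HC Hh.
  assert (H1 := drop_nondecr n m h 0 b Hm ch Hb).
  assert (H2 := drop_lipschitz n m h C b b 0 Hm ch Hb HC Hh ltac:(lra) Hb).
  rewrite drop_0 in *. rewrite !Rminus_0_r, !Rabs_pos_eq in H2 by lra. lra.
Qed.

Lemma abs_pow_1_base a : abs_pow 1 a = 1.
Proof.
  rewrite abs_pow_pos by lra. unfold Rpower; rewrite ln_1, Rmult_0_r; apply exp_0.
Qed.

Lemma abs_pow_small a y : 0 < a -> 0 < y ->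
  exists x0, 0 < x0 /\ forall x, 0 <= x <= x0 -> abs_pow x a <= y.
Proof.
  intros Ha Hy; exists (Rpower y (1 / a)); split; [apply Rpower_gt0|].
  intros x Hx. apply Rle_trans with (abs_pow (Rpower y (1 / a)) a).
  - apply abs_pow_le; lra.
  - rewrite abs_pow_pos, Rpower_mult by apply Rpower_gt0.
    replace (1 / a * a) with 1 by (field; lra). rewrite Rpower_1; lra.
Qed.

Lemma abs_pow_large a y : 0 < a -> 0 < y ->
  exists x0, 0 < x0 /\ forall x, x0 <= x -> y <= abs_pow x a.
Proof.
  intros Ha Hy; exists (Rpower y (1 / a)); split; [apply Rpower_gt0|].
  intros x Hx. assert (H := Rpower_gt0 y (1 / a)).
  apply Rle_trans with (abs_pow (Rpower y (1 / a)) a).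
  - rewrite abs_pow_pos, Rpower_mult by apply Rpower_gt0.
    replace (1 / a * a) with 1 by (field; lra). rewrite Rpower_1; lra.
  - apply abs_pow_le; lra.
Qed.

Section Truncated.

Variables (n : nat) (p q delta mu eps M : R).
Hypotheses (Hp : 1 < p) (Hq : 1 < q) (Hd : 0 < delta) (Hm : 0 < mu).
Hypotheses (Heps : 0 < eps < 1) (HM : 1 <= M).

Let f := trunc_pow eps M delta.
Let g := trunc_pow eps M mu.
Let V eta := picard_lim n p q 1 eta f g.
Let U eta := picard_u n p 1 f (V eta).

Lemma trunc_bounds : exists c C L, 0 < c <= C /\ 0 <= L /\
  (forall x, c <= f x <= C) /\ (forall x, c <= g x <= C) /\
  (forall x y, Rabs (f x - f y) <= L * Rabs (x - y)) /\
  (forall x y, Rabs (g x - g y) <= L * Rabs (x - y)).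
Proof.
  assert (HeM : 0 < eps <= M) by lra.
  destruct (trunc_pow_lipschitz eps M delta HeM) as [L1 [HL1 Lip1]].
  destruct (trunc_pow_lipschitz eps M mu HeM) as [L2 [HL2 Lip2]].
  assert (P1 := abs_pow_gt0 eps delta (proj1 HeM)).
  assert (P2 := abs_pow_gt0 eps mu (proj1 HeM)).
  assert (Q1 := abs_pow_gt0 M delta ltac:(lra)).
  assert (Q2 := abs_pow_gt0 M mu ltac:(lra)).
  exists (Rmin (abs_pow eps delta) (abs_pow eps mu)), (abs_pow M delta + abs_pow M mu), (L1 + L2).
  assert (A1 := Rmin_l (abs_pow eps delta) (abs_pow eps mu)).
  assert (A2 := Rmin_r (abs_pow eps delta) (abs_pow eps mu)).
  assert (R1 := fun x => trunc_pow_range eps M delta x Hd HeM).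
  assert (R2 := fun x => trunc_pow_range eps M mu x Hm HeM).
  split; [|split; [lra|split; [|split; [|split]]]].
  - split; [now apply Rmin_pos|]. specialize (R1 0); lra.
  - intros x; specialize (R1 x); unfold f; lra.
  - intros x; specialize (R2 x); unfold g; lra.
  - intros x y; specialize (Lip1 x y); assert (H := Rabs_pos (x - y)); unfold f; nra.
  - intros x y; specialize (Lip2 x y); assert (H := Rabs_pos (x - y)); unfold g; nra.
Qed.

Lemma trunc_f_cont : cont f.
Proof. apply trunc_pow_cont; lra. Qed.

Lemma trunc_g_cont : cont g.
Proof. apply trunc_pow_cont; lra. Qed.

Lemma trunc_solution eta : cont (U eta) /\ cont (V eta) /\
  forall r, U eta r = 1 - drop n p (fun t => f (V eta t)) r /\
            V eta r = eta - drop n q (fun t => g (U eta t)) r.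
Proof.
  destruct trunc_bounds as [c [C [L [Hc [HL [Bf [Bg [Lf Lg]]]]]]]].
  assert (cV : cont (V eta)) by exact (picard_lim_cont n p q c C L 1 eta f g Hp Hq Hc HL
    trunc_f_cont trunc_g_cont Bf Bg Lf Lg).
  split; [|split; [exact cV|]].
  - exact (picard_u_cont n p 1 f Hp trunc_f_cont (V eta) cV).
  - intros r; split; [reflexivity|].
    exact (picard_lim_fixpoint n p q c C L 1 eta f g Hp Hq Hc HL
      trunc_f_cont trunc_g_cont Bf Bg Lf Lg r).
Qed.

Lemma trunc_stability T : 0 <= T -> exists K, 0 <= K /\ forall eta1 eta2 r, 0 <= r <= T ->
  Rabs (U eta1 r - U eta2 r) <= K * Rabs (eta1 - eta2) /\
  Rabs (V eta1 r - V eta2 r) <= K * Rabs (eta1 - eta2).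
Proof.
  intros HT. destruct trunc_bounds as [c [C [L [Hc [HL [Bf [Bg [Lf Lg]]]]]]]].
  destruct (stability n p q c C L T Hp Hq Hc HL HT) as [K [HK HS]].
  exists K; split; [easy|]; intros eta1 eta2 r Hr.
  destruct (trunc_solution eta1) as [cU1 [cV1 E1]].
  destruct (trunc_solution eta2) as [cU2 [cV2 E2]].
  apply (HS (fun t => f (V eta1 t)) (fun t => f (V eta2 t))
    (fun t => g (U eta1 t)) (fun t => g (U eta2 t)) _ _ _ _ 1 eta1 eta2 r);
    try (apply cont_comp; try assumption; first [apply trunc_f_cont|apply trunc_g_cont]);
    try assumption.
  - intros t _; split; [apply E1|apply E2].
  - intros t _; split; [apply E1|apply E2].
  - intros t _; split; [apply Bf|split; [apply Bf|apply Lf]].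
  - intros t _; split; [apply Bg|split; [apply Bg|apply Lg]].
Qed.

Lemma trunc_U_decr eta s t : 0 <= s < t -> U eta t < U eta s.
Proof.
  intros Hst. destruct trunc_bounds as [c [C [L [Hc [HL [Bf [Bg [Lf Lg]]]]]]]].
  destruct (trunc_solution eta) as [cU [cV E]].
  rewrite (proj1 (E s)), (proj1 (E t)).
  assert (H := drop_incr n p (fun t => f (V eta t)) c s t Hp
    (cont_comp f (V eta) trunc_f_cont cV) ltac:(lra) Hst ltac:(intros; apply Bf)). lra.
Qed.

Lemma trunc_V_decr eta s t : 0 <= s < t -> V eta t < V eta s.
Proof.
  intros Hst. destruct trunc_bounds as [c [C [L [Hc [HL [Bf [Bg [Lf Lg]]]]]]]].
  destruct (trunc_solution eta) as [cU [cV E]].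
  rewrite (proj2 (E s)), (proj2 (E t)).
  assert (H := drop_incr n q (fun t => g (U eta t)) c s t Hq
    (cont_comp g (U eta) trunc_g_cont cU) ltac:(lra) Hst ltac:(intros; apply Bg)). lra.
Qed.

Lemma trunc_U_0 eta : U eta 0 = 1.
Proof. destruct (trunc_solution eta) as [_ [_ E]]; rewrite (proj1 (E 0)), drop_0; ring. Qed.

Lemma trunc_V_0 eta : V eta 0 = eta.
Proof. destruct (trunc_solution eta) as [_ [_ E]]; rewrite (proj2 (E 0)), drop_0; ring. Qed.

Lemma trunc_U_hits eta : exists T, 0 < T /\ U eta T = eps.
Proof.
  destruct trunc_bounds as [c [C [L [Hc [HL [Bf [Bg [Lf Lg]]]]]]]].
  destruct (trunc_solution eta) as [cU [cV E]]. assert (HN := INR_S_gt0 n).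
  set (sg := abs_pow (c * 1 / INR (S n)) (1 / (p - 1))).
  assert (Hsg : 0 < sg) by (apply abs_pow_gt0, Rdiv_lt_0_compat; lra).
  (* The lower bound for the slope degenerates at the origin, so the descent is measured from radius
     1 on, where the slope is at least [sg]; over a length 1 / sg it amounts to 1 and brings U down
     to 0 or below. *)
  set (b := 1 + 1 / sg). assert (Hb : 0 < 1 / sg) by (apply Rdiv_lt_0_compat; lra).
  assert (cF := cont_comp f (V eta) trunc_f_cont cV).
  assert (H := drop_lower n p (fun t => f (V eta t)) c 1 b Hp cF ltac:(lra)
    ltac:(unfold b; lra) ltac:(intros; apply Bf)). fold sg in H.
  assert (H1 := drop_nondecr n p (fun t => f (V eta t)) 0 1 Hp cF ltac:(lra)).
  rewrite drop_0 in H1.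
  assert (H2 : sg * (b - 1) = 1) by (unfold b; field; lra).
  assert (HUb : U eta b <= 0) by (rewrite (proj1 (E b)); lra).
  assert (HU0 := trunc_U_0 eta).
  destruct (IVT_gen (U eta) 0 b eps) as [T [HT HUT]].
  - intros x; apply continuity_pt_filterlim, cU.
  - rewrite Rmin_right, Rmax_left; lra.
  - exists T; split; [|easy]. rewrite Rmin_left in HT by (unfold b; lra).
    destruct (Req_dec T 0) as [->|]; lra.
Qed.

Lemma trunc_hitting_time : exists T : R -> R, forall eta, 0 < T eta /\ U eta (T eta) = eps.
Proof.
  exists (fun eta => proj1_sig (constructive_indefinite_description _ (trunc_U_hits eta))).
  intros eta; destruct (constructive_indefinite_description _ (trunc_U_hits eta)); easy.
Qed.

(** As U eta decreases strictly, eps lies strictly between its values at T eta - e and T eta + e (or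
    at 0 and T eta + e). By stability this persists for nearby initial values, so the hitting radius
    is continuous; the hitting value of V then inherits continuity from stability and from that of V
    eta. *)
Lemma trunc_hitting_value_cont (T : R -> R) :
  (forall eta, 0 < T eta /\ U eta (T eta) = eps) -> cont (fun eta => V eta (T eta)).
Proof.
  intros HT eta.
  assert (Hloc : forall e, 0 < e -> exists d, 0 < d /\ forall eta', Rabs (eta' - eta) < d ->
    Rabs (T eta' - T eta) < e).
  { intros e He. destruct (HT eta) as [HT0 HTe].
    destruct (trunc_stability (T eta + e) ltac:(lra)) as [K [HK HS]].
    assert (Hr : U eta (T eta + e) < eps) by (rewrite <- HTe; apply trunc_U_decr; lra).
    set (s := Rmax 0 (T eta - e)).
    assert (Hs : 0 <= s < T eta) by (unfold s; split; [apply Rmax_l|apply Rmax_lub_lt; lra]).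
    assert (Hs' : T eta - e <= s) by apply Rmax_r.
    assert (Hl : eps < U eta s) by (rewrite <- HTe; apply trunc_U_decr; lra).
    set (gap := Rmin (eps - U eta (T eta + e)) (U eta s - eps)).
    assert (Hgap : 0 < gap) by (apply Rmin_pos; lra).
    assert (G1 : gap <= eps - U eta (T eta + e)) by apply Rmin_l.
    assert (G2 : gap <= U eta s - eps) by apply Rmin_r.
    exists (gap / (K + 1)); split; [apply Rdiv_lt_0_compat; lra|].
    intros eta' Hd'. apply (Rlt_div_r _ gap (K + 1)) in Hd'; [|lra].
    assert (Hpos := Rabs_pos (eta' - eta)).
    destruct (HS eta' eta (T eta + e)) as [B1 _]; [lra|].
    destruct (HS eta' eta s) as [B2 _]; [lra|].
    apply Rabs_le_between in B1. apply Rabs_le_between in B2.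
    destruct (HT eta') as [HT0' HTe'].
    assert (C1 : T eta' < T eta + e).
    { destruct (Rlt_dec (T eta') (T eta + e)) as [H|H]; [easy|exfalso].
      destruct (Req_dec (T eta') (T eta + e)) as [Heq|Hne].
      - rewrite Heq in HTe'; lra.
      - assert (H' := trunc_U_decr eta' (T eta + e) (T eta') ltac:(lra)); lra. }
    assert (C2 : s < T eta').
    { destruct (Rlt_dec s (T eta')) as [H|H]; [easy|exfalso].
      destruct (Req_dec (T eta') s) as [Heq|Hne].
      - rewrite Heq in HTe'; lra.
      - assert (H' := trunc_U_decr eta' (T eta') s ltac:(lra)); lra. }
    apply Rabs_def1; lra. }
  destruct (trunc_solution eta) as [cU [cV E]].
  destruct (HT eta) as [HT0 HTe].
  apply continuity_pt_filterlim. intros e He. 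
  assert (HcV := cV (T eta)). apply continuity_pt_filterlim in HcV.
  destruct (HcV (e / 2)) as [d1 [Hd1 HV]]; [lra|].
  destruct (Hloc (Rmin 1 d1)) as [d2 [Hd2 HT2]]; [apply Rmin_pos; lra|].
  destruct (trunc_stability (T eta + 1) ltac:(lra)) as [K [HK HS]].
  exists (Rmin d2 (e / (2 * (K + 1)))); split.
  { apply Rmin_pos; [easy|]. apply Rdiv_lt_0_compat; lra. }
  intros eta' [_ Hd']. simpl in Hd' |- *. unfold R_dist in *.
  assert (D1 := Rmin_l d2 (e / (2 * (K + 1)))). assert (D2 := Rmin_r d2 (e / (2 * (K + 1)))).
  assert (D3 : Rabs (eta' - eta) < e / (2 * (K + 1))) by lra.
  apply (Rlt_div_r _ e (2 * (K + 1))) in D3; [|lra].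
  assert (HTT := HT2 eta' ltac:(lra)).
  assert (M1 := Rmin_l 1 d1). assert (M2 := Rmin_r 1 d1).
  destruct (HT eta') as [HT0' _].
  assert (Hnear : Rabs (T eta' - T eta) < 1) by lra. apply Rabs_def2 in Hnear.
  destruct (HS eta' eta (T eta')) as [_ B]; [lra|].
  assert (HVn : Rabs (V eta (T eta') - V eta (T eta)) < e / 2).
  { destruct (Req_dec (T eta') (T eta)) as [Heq|Hne].
    - rewrite Heq, Rminus_diag, Rabs_R0; lra.
    - apply HV; split; [split; [exact I|lra]|]. simpl; unfold R_dist; lra. }
  replace (V eta' (T eta') - V eta (T eta))
    with ((V eta' (T eta') - V eta (T eta')) + (V eta (T eta') - V eta (T eta))) by ring.
  eapply Rle_lt_trans; [apply Rabs_triang|].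
  assert (Hpos := Rabs_pos (eta' - eta)). nra.
Qed.

(** From eta0 the function v reaches eps before u does, from eta1 not before u. The value of v at
    the radius where u = eps thus goes from at most eps to at least eps, and takes the value eps in
    between. *)
Lemma trunc_shooting eta0 eta1 : eta0 <= eta1 <= M ->
  (exists s, 0 < s /\ eps < U eta0 s /\ V eta0 s <= eps) ->
  (exists s, 0 < s /\ U eta1 s < eps /\ eps <= V eta1 s) ->
  exists eta T, eta0 <= eta <= eta1 /\ 0 < T /\ U eta T = eps /\ V eta T = eps /\
    forall t, 0 <= t <= T -> eps <= U eta t <= M /\ eps <= V eta t <= M.
Proof.
  intros He [s0 [Hs0 [HU0 HV0]]] [s1 [Hs1 [HU1 HV1]]].
  destruct trunc_hitting_time as [T HT].
  assert (G0 : V eta0 (T eta0) <= eps).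
  { destruct (HT eta0) as [HT0 HTe].
    destruct (Rlt_dec s0 (T eta0)) as [H|H].
    - assert (H' := trunc_V_decr eta0 s0 (T eta0) ltac:(lra)); lra.
    - exfalso. destruct (Req_dec (T eta0) s0) as [Heq|Hne]; [rewrite Heq in HTe; lra|].
      assert (H' := trunc_U_decr eta0 (T eta0) s0 ltac:(lra)); lra. }
  assert (G1 : eps <= V eta1 (T eta1)).
  { destruct (HT eta1) as [HT0 HTe].
    destruct (Rlt_dec (T eta1) s1) as [H|H].
    - assert (H' := trunc_V_decr eta1 (T eta1) s1 ltac:(lra)); lra.
    - exfalso. destruct (Req_dec (T eta1) s1) as [Heq|Hne]; [rewrite Heq in HTe; lra|].
      assert (H' := trunc_U_decr eta1 s1 (T eta1) ltac:(lra)); lra. }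
  destruct (IVT_gen (fun eta => V eta (T eta)) eta0 eta1 eps) as [eta [Heta HV]].
  - intros x; apply continuity_pt_filterlim. now apply (trunc_hitting_value_cont T).
  - split; [eapply Rle_trans; [apply Rmin_l|easy]|eapply Rle_trans; [apply G1|apply Rmax_r]].
  - rewrite Rmin_left, Rmax_right in Heta by lra. destruct (HT eta) as [HT0 HTe].
    exists eta, (T eta). repeat split; try easy; try lra;
      destruct (Req_dec t (T eta)) as [->|Ht]; try lra;
      destruct (Req_dec t 0) as [->|Ht0];
      rewrite ?trunc_U_0, ?trunc_V_0; try lra.
    + assert (H' := trunc_U_decr eta t (T eta) ltac:(lra)); lra.
    + assert (H' := trunc_U_decr eta 0 t ltac:(lra)); rewrite trunc_U_0 in H'; lra.
    + assert (H' := trunc_V_decr eta 0 (T eta) ltac:(lra)); rewrite trunc_V_0 in H'; lra.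
    + assert (H' := trunc_V_decr eta t (T eta) ltac:(lra)); lra.
    + assert (H' := trunc_V_decr eta 0 t ltac:(lra)); rewrite trunc_V_0 in H'; lra.
Qed.

(** For small eta the source of u is small, so u >= 1/2 on [0, 1]. The source of v is then at least
    (1/2)^mu, and the descent of v over [1/2, 1] alone exceeds the whole initial value eta. *)
Lemma trunc_low eta : eps <= eta <= M -> eps < 1 / 2 ->
  abs_pow (abs_pow eta delta * 1 / INR (S n)) (1 / (p - 1)) <= 1 / 2 ->
  eta <= abs_pow (abs_pow (1 / 2) mu * (1 / 2) / INR (S n)) (1 / (q - 1)) * (1 - 1 / 2) ->
  eps < U eta 1 /\ V eta 1 <= eps.
Proof.
  intros He Hh H1 H2. destruct (trunc_solution eta) as [cU [cV E]].
  assert (HVle : forall t, 0 <= t -> V eta t <= eta).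
  { intros t Ht; destruct (Req_dec t 0) as [->|Ht0]; [rewrite trunc_V_0; lra|].
    assert (H := trunc_V_decr eta 0 t ltac:(lra)); rewrite trunc_V_0 in H; lra. }
  assert (cF := cont_comp f (V eta) trunc_f_cont cV).
  assert (cG := cont_comp g (U eta) trunc_g_cont cU).
  assert (HU1 : 1 / 2 <= U eta 1).
  { rewrite (proj1 (E 1)).
    assert (H := drop_upper n p (fun t => f (V eta t)) (abs_pow eta delta) 1 Hp cF
      ltac:(lra) (abs_pow_ge0 _ _)).
    destruct H as [_ H]; [|lra].
    intros t Ht; split; [apply abs_pow_ge0|]. unfold f, trunc_pow.
    assert (HR := trunc_range eps M (V eta t) ltac:(lra)).
    apply abs_pow_le; [lra|split; [lra|]]. unfold trunc.
    apply Rmax_lub; [lra|]. eapply Rle_trans; [apply Rmin_l|apply HVle; lra]. }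
  split; [lra|].
  rewrite (proj2 (E 1)).
  assert (H := drop_lower n q (fun t => g (U eta t)) (abs_pow (1 / 2) mu) (1 / 2) 1 Hq cG
    (abs_pow_ge0 _ _) ltac:(lra)).
  assert (Hn := drop_nondecr n q (fun t => g (U eta t)) 0 (1 / 2) Hq cG ltac:(lra)).
  rewrite drop_0 in Hn.
  specialize (H ltac:(intros t Ht; unfold g, trunc_pow; apply abs_pow_le; [lra|];
    split; [lra|]; unfold trunc; eapply Rle_trans; [|apply Rmax_r];
    apply Rmin_glb; [|lra]; destruct (Req_dec t 1) as [->|Ht1]; [easy|];
    assert (H' := trunc_U_decr eta t 1 ltac:(lra)); lra)).
  lra.
Qed.

(** The source of v is at most 1 because u <= 1, so for large eta v stays above eta / 2 on [0, 1].
    The slope of u on [1/2, 1] is then at least 2, which brings u from at most 1 to 0 or below. *)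
Lemma trunc_high eta : 2 <= eta <= M ->
  2 * abs_pow (1 * 1 / INR (S n)) (1 / (q - 1)) <= eta ->
  2 <= abs_pow (abs_pow (eta / 2) delta * (1 / 2) / INR (S n)) (1 / (p - 1)) ->
  U eta 1 < eps /\ eps <= V eta 1.
Proof.
  intros He H1 H2. destruct (trunc_solution eta) as [cU [cV E]].
  assert (HUle : forall t, 0 <= t -> U eta t <= 1).
  { intros t Ht; destruct (Req_dec t 0) as [->|Ht0]; [rewrite trunc_U_0; lra|].
    assert (H := trunc_U_decr eta 0 t ltac:(lra)); rewrite trunc_U_0 in H; lra. }
  assert (cF := cont_comp f (V eta) trunc_f_cont cV).
  assert (cG := cont_comp g (U eta) trunc_g_cont cU).
  assert (HV1 : eta / 2 <= V eta 1).
  { rewrite (proj2 (E 1)).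
    assert (H := drop_upper n q (fun t => g (U eta t)) 1 1 Hq cG ltac:(lra) ltac:(lra)).
    destruct H as [_ H]; [|lra].
    intros t Ht; split; [apply abs_pow_ge0|]. unfold g, trunc_pow.
    assert (HR := trunc_range eps M (U eta t) ltac:(lra)).
    rewrite <- (abs_pow_1_base mu).
    apply abs_pow_le; [lra|split; [lra|]]. unfold trunc.
    apply Rmax_lub; [lra|]. eapply Rle_trans; [apply Rmin_l|apply HUle; lra]. }
  split; [|lra].
  rewrite (proj1 (E 1)).
  assert (H := drop_lower n p (fun t => f (V eta t)) (abs_pow (eta / 2) delta) (1 / 2) 1 Hp cF
    (abs_pow_ge0 _ _) ltac:(lra)).
  assert (Hn := drop_nondecr n p (fun t => f (V eta t)) 0 (1 / 2) Hp cF ltac:(lra)).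
  rewrite drop_0 in Hn.
  specialize (H ltac:(intros t Ht; unfold f, trunc_pow; apply abs_pow_le; [lra|];
    split; [lra|]; unfold trunc; eapply Rle_trans; [|apply Rmax_r];
    apply Rmin_glb; [|lra]; destruct (Req_dec t 1) as [->|Ht1]; [easy|];
    assert (H' := trunc_V_decr eta t 1 ltac:(lra)); lra)).
  lra.
Qed.

End Truncated.

(* That eta0 and eta1 do not depend on eps is what the passage eps -> 0 needs. *)
Lemma shooting n p q delta mu : 1 < p -> 1 < q -> 0 < delta -> 0 < mu ->
  exists eta0 eta1, 0 < eta0 /\ 1 <= eta1 /\ forall eps, 0 < eps < eta0 -> eps < 1 / 2 ->
  exists eta T (u v : R -> R), eta0 <= eta <= eta1 /\ 0 < T /\ cont u /\ cont v /\
    u T = eps /\ v T = eps /\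
    forall t, 0 <= t <= T -> eps <= u t <= eta1 /\ eps <= v t <= eta1 /\
      u t = 1 - drop n p (fun s => abs_pow (v s) delta) t /\
      v t = eta - drop n q (fun s => abs_pow (u s) mu) t.
Proof.
  intros Hp Hq Hd Hm. assert (HN := INR_S_gt0 n).
  assert (Hep : 0 < 1 / (p - 1)) by (apply Rdiv_lt_0_compat; lra).
  assert (Heq : 0 < 1 / (q - 1)) by (apply Rdiv_lt_0_compat; lra).
  (* Here x1, x2 and c meet the two smallness conditions of [trunc_low]; y1, y2 and d meet the two
     largeness conditions of [trunc_high]. None of them involves eps. *)
  destruct (abs_pow_small (1 / (p - 1)) (1 / 2)) as [x1 [Hx1 L1]]; [easy|lra|].
  destruct (abs_pow_small delta (x1 * INR (S n))) as [x2 [Hx2 L2]]; [easy|nra|].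
  set (c := abs_pow (abs_pow (1 / 2) mu * (1 / 2) / INR (S n)) (1 / (q - 1)) * (1 - 1 / 2)).
  assert (Hc : 0 < c).
  { apply Rmult_lt_0_compat; [|lra]. apply abs_pow_gt0, Rdiv_lt_0_compat; [|easy].
    apply Rmult_lt_0_compat; [apply abs_pow_gt0|]; lra. }
  destruct (abs_pow_large (1 / (p - 1)) 2) as [y1 [Hy1 U1]]; [easy|lra|].
  destruct (abs_pow_large delta (2 * (y1 * INR (S n)))) as [y2 [Hy2 U2]]; [easy|nra|].
  set (eta0 := Rmin 1 (Rmin x2 c)).
  set (d := 2 * abs_pow (1 * 1 / INR (S n)) (1 / (q - 1))).
  assert (Hd0 : 0 <= d).
  { unfold d; assert (H := abs_pow_ge0 (1 * 1 / INR (S n)) (1 / (q - 1))); lra. }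
  set (eta1 := 2 + d + 2 * y2).
  assert (E0 : 0 < eta0) by (repeat apply Rmin_pos; lra).
  assert (E1 : eta0 <= 1) by apply Rmin_l.
  assert (E2 : eta0 <= x2) by (eapply Rle_trans; [apply Rmin_r|apply Rmin_l]).
  assert (E3 : eta0 <= c) by (eapply Rle_trans; [apply Rmin_r|apply Rmin_r]).
  assert (E4 : 2 <= eta1) by (unfold eta1; lra).
  exists eta0, eta1; split; [easy|split; [lra|]].
  intros eps Heps Heps2.
  assert (Heps1 : 0 < eps < 1) by lra. assert (HM : 1 <= eta1) by lra.
  destruct (trunc_shooting n p q delta mu eps eta1 Hp Hq Hd Hm Heps1 HM eta0 eta1)
    as [eta [T [Heta [HT [HuT [HvT Hb]]]]]].
  - lra.
  - exists 1; split; [lra|].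
    apply (trunc_low n p q delta mu eps eta1 Hp Hq Hd Hm Heps1 HM eta0); try lra.
    + apply L1. assert (Hp0 := abs_pow_ge0 eta0 delta). split.
      * apply Rmult_le_pos; [lra|apply Rlt_le, Rinv_0_lt_compat; lra].
      * apply Rle_div_l; [easy|]. rewrite Rmult_1_r. apply L2; lra.
    + exact E3.
  - exists 1; split; [lra|].
    apply (trunc_high n p q delta mu eps eta1 Hp Hq Hd Hm Heps1 HM eta1); try lra.
    + unfold eta1, d; lra.
    + apply U1. apply Rle_div_r; [easy|].
      assert (H := U2 (eta1 / 2) ltac:(unfold eta1; lra)). lra.
  - destruct (trunc_solution n p q delta mu eps eta1 Hp Hq Hd Hm Heps1 HM eta) as [cU [cV E]].
    exists eta, T. do 2 eexists. split; [exact Heta|]. split; [exact HT|].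
    split; [exact cU|]. split; [exact cV|]. split; [exact HuT|]. split; [exact HvT|].
    intros t Ht. destruct (Hb t Ht) as [B1 B2]. split; [exact B1|]. split; [exact B2|].
    destruct (E t) as [Et1 Et2]. split.
    + rewrite Et1 at 1. f_equal. apply drop_ext; [lra|]. intros s Hs.
      unfold trunc_pow; rewrite trunc_id; [reflexivity|apply Hb; lra].
    + rewrite Et2 at 1. f_equal. apply drop_ext; [lra|]. intros s Hs.
      unfold trunc_pow; rewrite trunc_id; [reflexivity|apply Hb; lra].
Qed.

(** * Nonexistence of ground states *)

(* (B r)^(1 - 1/(q-1)) is |v'|^(q-2), and (A r)^(1 - 1/(p-1)) is |u'|^(p-2). *)
Definition pohozaev (nu p q delta mu k : R) (A B u v : R -> R) (r : R) : R :=
  Rpower r k *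
  (A r * B r
   + Rpower (B r) (1 - 1 / (q - 1)) * v r
     * (Rpower (v r) delta - (nu + 1) * A r / r) / (delta + 1)
   + Rpower (A r) (1 - 1 / (p - 1)) * u r
     * (Rpower (u r) mu - (nu + 1) * B r / r) / (mu + 1)).

(** Since v' times B^(1 - 1/(q-1)) is -B, differentiating v and v^delta in the first correction
    yields -B v^delta plus a multiple of A B / r, and -B v^delta cancels against (A B)'; the second
    correction removes A u^mu in the same way. Differentiating A / r, the power of B and r^k only
    reproduces the gap (nu + 1) A / r - v^delta with a factor affine in r u^mu / B. *)
Lemma pohozaev_derive nu p q delta mu k (A B u v : R -> R) r :
  1 < p -> 1 < q -> 0 < delta -> 0 < mu ->
  0 < r -> 0 < A r -> 0 < B r -> 0 < u r -> 0 < v r ->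
  is_derive A r (Rpower (v r) delta - nu * A r / r) ->
  is_derive B r (Rpower (u r) mu - nu * B r / r) ->
  is_derive u r (- Rpower (A r) (1 / (p - 1))) ->
  is_derive v r (- Rpower (B r) (1 / (q - 1))) ->
  is_derive (pohozaev nu p q delta mu k A B u v) r
    (Rpower r k / r *
     (A r * B r * (k - 2 * nu + (nu + 1) * (1 / (delta + 1) + 1 / (mu + 1)))
      + Rpower (B r) (1 - 1 / (q - 1)) * v r
        * ((nu + 1) * A r / r - Rpower (v r) delta) / (delta + 1)
        * (nu + 1 - k - (1 - 1 / (q - 1)) * (r * Rpower (u r) mu / B r - nu))
      + Rpower (A r) (1 - 1 / (p - 1)) * u r
        * ((nu + 1) * B r / r - Rpower (u r) mu) / (mu + 1)
        * (nu + 1 - k - (1 - 1 / (p - 1)) * (r * Rpower (v r) delta / A r - nu)))).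
Proof.
  intros Hp Hq Hd Hm Hr HA HB Hu Hv DA DB Du Dv.
  (* These two relations eliminate one power of A and one of B; the identity to prove is rational in
     the remaining quantities. *)
  assert (Ea : Rpower (A r) (1 / (p - 1)) * Rpower (A r) (1 - 1 / (p - 1)) = A r).
  { rewrite <- Rpower_plus.
    replace (1 / (p - 1) + (1 - 1 / (p - 1))) with 1 by ring. now apply Rpower_1. }
  assert (Eb : Rpower (B r) (1 / (q - 1)) * Rpower (B r) (1 - 1 / (q - 1)) = B r).
  { rewrite <- Rpower_plus.
    replace (1 / (q - 1) + (1 - 1 / (q - 1))) with 1 by ring. now apply Rpower_1. }
  unfold pohozaev, Rpower in *.
  auto_derive.
  - repeat split; try easy; try (eexists; eassumption); lra.
  - change (Derive (fun x => A x) r) with (Derive A r).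
    change (Derive (fun x => B x) r) with (Derive B r).
    change (Derive (fun x => u x) r) with (Derive u r).
    change (Derive (fun x => v x) r) with (Derive v r).
    rewrite (is_derive_unique _ _ _ DA), (is_derive_unique _ _ _ DB),
      (is_derive_unique _ _ _ Du), (is_derive_unique _ _ _ Dv).
    set (ea := exp (1 / (p - 1) * ln (A r))) in *.
    set (eb := exp (1 / (q - 1) * ln (B r))) in *.
    set (ka := 1 - 1 / (p - 1)) in *. set (kb := 1 - 1 / (q - 1)) in *.
    set (fa := exp (ka * ln (A r))) in *. set (fb := exp (kb * ln (B r))) in *.
    set (U := exp (mu * ln (u r))) in *. set (V := exp (delta * ln (v r))) in *.
    set (X := exp (k * ln r)) in *.
    assert (Hfa : fa <> 0) by (apply Rgt_not_eq, exp_pos).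
    assert (Hfb : fb <> 0) by (apply Rgt_not_eq, exp_pos).
    assert (Ea' : ea = A r / fa) by (rewrite <- Ea; field; easy).
    assert (Eb' : eb = B r / fb) by (rewrite <- Eb; field; easy).
    rewrite Ea', Eb'. clearbody ka kb fa fb U V X.
    field; repeat split; lra.
Qed.

Lemma Rpower_between k c x C : 0 < c <= x -> x <= C ->
  Rpower x k <= Rpower c k + Rpower C k.
Proof.
  intros Hc HC. assert (H1 := Rpower_gt0 c k). assert (H2 := Rpower_gt0 C k).
  destruct (Rle_dec 0 k) as [Hk|Hk].
  - assert (Rpower x k <= Rpower C k) by (apply Rle_Rpower_l; lra); lra.
  - assert (Rpower x k <= Rpower c k); [|lra].
    replace k with (- (- k)) by ring. rewrite !(Rpower_Ropp _ (- k)).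
    apply Rinv_le_contravar; [apply Rpower_gt0|apply Rle_Rpower_l; lra].
Qed.

Lemma flux_pos n (h : R -> R) r : cont h -> 0 < r ->
  (forall t, 0 <= t <= r -> 0 < h t) -> 0 < flux n h r.
Proof.
  intros Hh Hr Hpos.
  destruct (continuity_ab_min h 0 r) as [t0 [Hmin Ht0]]; [lra| |].
  { intros t _; apply continuity_pt_filterlim, Hh. }
  apply Rlt_le_trans with (h t0 * r / INR (S n)).
  - assert (HN := INR_S_gt0 n). apply Rdiv_lt_0_compat; [|easy].
    specialize (Hpos t0 Ht0); nra.
  - apply flux_lower; [easy|lra|easy].
Qed.

(* At the origin (n+1) A / r - v^delta and v(0) - v(r) are both of order r B^(1/(q-1)),
   so this correction term of the Pohozaev function is of order r^2 for every q > 1. *)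
Lemma pohozaev_corner n q delta c C eta (v g : R -> R) :
  1 < q -> 0 < delta -> 0 < c -> cont v -> cont g ->
  (forall t, 0 <= t <= 1 -> v t = eta - drop n q g t) ->
  (forall t, 0 <= t <= 1 -> 0 < v t) ->
  (forall t, 0 <= t <= 1 -> c <= g t <= C) ->
  exists K, 0 <= K /\ forall r, 0 < r <= 1 ->
    Rpower (flux n g r) (1 - 1 / (q - 1)) * v r *
      ((INR n + 1) * flux n (fun t => abs_pow (v t) delta) r / r - Rpower (v r) delta)
    <= K * (r * r).
Proof.
  intros Hq Hd Hc cv cg Heq Hpos Hg. assert (HN := INR_S_gt0 n).
  set (e := 1 / (q - 1)). set (ka := 1 - e).
  assert (He : 0 < e) by (apply Rdiv_lt_0_compat; lra).
  assert (HcC : c <= C) by (specialize (Hg 0); lra).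
  assert (Hdec : forall s t, 0 <= s <= t -> t <= 1 -> v t <= v s).
  { intros s t Hst Ht; rewrite !Heq by lra.
    assert (H := drop_nondecr n q g s t Hq cg ltac:(lra)); lra. }
  assert (Hv1 := Hpos 1 ltac:(lra)).
  destruct (abs_pow_lipschitz delta (v 1) (v 0)) as [L [HL HLip]];
    [easy|apply Hdec; lra|].
  set (cn := c / INR (S n)). set (Cn := C / INR (S n)).
  assert (Hcn : 0 < cn) by (apply Rdiv_lt_0_compat; lra).
  assert (HCn : cn <= Cn).
  { apply Rmult_le_compat_r; [apply Rlt_le, Rinv_0_lt_compat; lra|easy]. }
  set (M := Rpower cn ka + Rpower Cn ka).
  assert (HM : 0 < M) by (apply Rplus_lt_0_compat; apply Rpower_gt0).
  assert (HRC := Rpower_gt0 Cn e).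
  assert (Hv0 := Hpos 0 ltac:(lra)).
  exists (M * v 0 * (L * Rpower Cn e)); split.
  { repeat apply Rmult_le_pos; lra. }
  intros r [Hr Hr1].
  assert (Hf1 : cn * r <= flux n g r).
  { replace (cn * r) with (c * r / INR (S n)) by (unfold cn; field; lra).
    apply flux_lower; [easy|lra|]. intros; apply Hg; lra. }
  assert (Hf2 : flux n g r <= Cn * r).
  { replace (Cn * r) with (C * r / INR (S n)) by (unfold Cn; field; lra).
    apply flux_upper; [easy|lra|]. intros; apply Hg; lra. }
  assert (HP1 : Rpower (flux n g r) ka <= M * Rpower r ka).
  { eapply Rle_trans; [apply (Rpower_between ka (cn * r) _ (Cn * r)); nra|].
    rewrite <- !Rpower_mult_distr by lra. unfold M; lra. }
  assert (Hdrop : v 0 - v r <= Rpower Cn e * (Rpower r e * r)).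
  { rewrite !Heq by lra; rewrite drop_0.
    assert (H : drop n q g r - drop n q g 0
      <= (fun t => Rpower (Cn * r) e * t) r - (fun t => Rpower (Cn * r) e * t) 0).
    { apply (derive_le_compare (drop n q g) (fun t => Rpower (Cn * r) e * t)
        (slope n q g) (fun _ => Rpower (Cn * r) e)); [lra| | |].
      - intros; now apply is_derive_drop.
      - intros; auto_derive; [easy|ring].
      - intros t Ht. rewrite <- abs_pow_pos by nra.
        eapply Rle_trans; [apply (slope_upper n q g C); try easy; try lra|].
        + intros s Hs; specialize (Hg s); lra.
        + fold e. apply abs_pow_le; [lra|]. split.
          * apply Rmult_le_pos; [nra|apply Rlt_le, Rinv_0_lt_compat; lra].
          * replace (C * t / INR (S n)) with (Cn * t) by (unfold Cn; field; lra). nra. }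
    cbv beta in H. rewrite drop_0 in H. rewrite <- Rpower_mult_distr in H by lra. lra. }
  set (h := fun t => abs_pow (v t) delta) in *.
  assert (ch : cont h).
  { apply (cont_comp (fun t => abs_pow t delta) v); [|easy].
    intros x; now apply abs_pow_continuous. }
  assert (Hh : (INR n + 1) * flux n h r / r <= h 0).
  { apply Rle_div_l; [easy|]. rewrite <- S_INR.
    assert (H : flux n h r <= h 0 * r / INR (S n)).
    { apply flux_upper; [easy|lra|]. intros t Ht; unfold h.
      apply abs_pow_le; [lra|]. split; [apply Rlt_le, Hpos; lra|apply Hdec; lra]. }
    apply (Rmult_le_compat_l (INR (S n))) in H; [|lra].
    replace (INR (S n) * (h 0 * r / INR (S n))) with (h 0 * r) in H by (field; lra). easy. }
  assert (Hh2 : h 0 - Rpower (v r) delta <= L * (v 0 - v r)).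
  { rewrite <- abs_pow_pos by (apply Hpos; lra).
    assert (Hvr : v 1 <= v r <= v 0) by (split; apply Hdec; lra).
    assert (Hv01 : v 1 <= v 0) by lra.
    assert (H := HLip (v 0) (v r) ltac:(lra) Hvr).
    rewrite (Rabs_pos_eq (v 0 - v r)) in H by lra.
    eapply Rle_trans; [apply Rle_abs|apply H]. }
  assert (Hvr : 0 < v r <= v 0) by (split; [apply Hpos|apply Hdec]; lra).
  assert (HPr := Rpower_gt0 r e). assert (HPk := Rpower_gt0 r ka).
  assert (HPf := Rpower_gt0 (flux n g r) ka).
  assert (Hdiff : (INR n + 1) * flux n h r / r - Rpower (v r) delta
     <= L * Rpower Cn e * (Rpower r e * r)).
  { assert (L * (v 0 - v r) <= L * (Rpower Cn e * (Rpower r e * r))) by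
      (apply Rmult_le_compat_l; lra). lra. }
  assert (Hpr : Rpower r ka * Rpower r e = r).
  { rewrite <- Rpower_plus. replace (ka + e) with 1 by (unfold ka; ring).
    now apply Rpower_1. }
  assert (HLC : 0 <= L * Rpower Cn e) by nra.
  assert (0 < Rpower r e * r) by nra.
  apply Rle_trans with (M * Rpower r ka * v 0 * (L * Rpower Cn e * (Rpower r e * r))).
  - apply Rle_trans with (Rpower (flux n g r) ka * v r * (L * Rpower Cn e * (Rpower r e * r))).
    + apply Rmult_le_compat_l; [nra|easy].
    + apply Rmult_le_compat_r; [apply Rmult_le_pos; lra|].
      apply Rmult_le_compat; lra.
  - right. replace (M * Rpower r ka * v 0 * (L * Rpower Cn e * (Rpower r e * r)))
      with (M * v 0 * (L * Rpower Cn e) * ((Rpower r ka * Rpower r e) * r)) by ring.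
    rewrite Hpr; ring.
Qed.

Lemma flux_mono_mass n (h : R -> R) r s : cont h -> (forall t, 0 <= t -> 0 <= h t) ->
  0 < r <= s -> flux n h r * r ^ n <= flux n h s * s ^ n.
Proof.
  intros Hh Hpos Hrs.
  assert (0 < r ^ n) by (apply pow_lt; lra). assert (0 < s ^ n) by (apply pow_lt; lra).
  rewrite !flux_mass by lra.
  replace (mass n h r / r ^ n * r ^ n) with (mass n h r) by (field; lra).
  replace (mass n h s / s ^ n * s ^ n) with (mass n h s) by (field; lra).
  apply (derive_nonneg_le _ (fun t => t ^ n * h t)); [lra| |].
  - intros; now apply is_derive_mass.
  - intros x Hx; apply Rmult_le_pos; [apply pow_le; lra|apply Hpos; lra].
Qed.

(* u(r) - u(2r) already controls |u'(r)|, since r^n |u'|^(p-1) increases. *)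
Lemma ln_flux_upper n p (h u : R -> R) xi r : 1 < p -> cont h ->
  (forall t, 0 <= t -> 0 < h t) -> (forall t, 0 <= t -> 0 < u t) ->
  (forall t, 0 <= t -> u t = xi - drop n p h t) -> 0 < r ->
  ln (flux n h r) <= (p - 1) * (ln (u r) - ln r) + INR n * ln 2.
Proof.
  intros Hp ch Hh Hu Heq Hr.
  assert (HA : 0 < flux n h r) by (apply flux_pos; [easy|easy|intros; apply Hh; lra]).
  set (e := 1 / (p - 1)). assert (He : 0 < e) by (apply Rdiv_lt_0_compat; lra).
  assert (H2n : 0 < 2 ^ n) by (apply pow_lt; lra).
  set (c := flux n h r / 2 ^ n).
  assert (Hc : 0 < c) by (apply Rdiv_lt_0_compat; lra).
  assert (H : (fun t => Rpower c e * t) (2 * r) - (fun t => Rpower c e * t) r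
     <= drop n p h (2 * r) - drop n p h r).
  { apply (derive_le_compare (fun t => Rpower c e * t) (drop n p h)
      (fun _ => Rpower c e) (slope n p h)); [lra| | |].
    - intros; auto_derive; [easy|ring].
    - intros; now apply is_derive_drop.
    - intros s Hs. unfold slope; fold e. rewrite <- abs_pow_pos by easy.
      apply abs_pow_le; [lra|]. split; [lra|].
      assert (H := flux_mono_mass n h r s ch ltac:(intros; now apply Rlt_le, Hh) ltac:(lra)).
      assert (Hsr : s ^ n <= (2 * r) ^ n) by (apply pow_incr; lra).
      rewrite Rpow_mult_distr in Hsr.
      assert (Hrn : 0 < r ^ n) by (apply pow_lt; lra).
      assert (Hfs : 0 < flux n h s) by (apply flux_pos; [easy|lra|intros; apply Hh; lra]).
      apply (Rle_div_l (flux n h r)); [easy|].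
      apply Rmult_le_reg_r with (r ^ n); [easy|]. nra. }
  cbv beta in H.
  assert (Hu2 := Hu (2 * r) ltac:(lra)). rewrite Heq in Hu2 by lra.
  assert (Hur := Heq r ltac:(lra)).
  assert (HP := Rpower_gt0 c e).
  assert (Hle : Rpower c e * r <= u r) by lra.
  apply ln_le in Hle; [|nra]. rewrite ln_mult in Hle by lra.
  unfold Rpower in Hle; rewrite ln_exp in Hle.
  unfold c, Rdiv in Hle. rewrite ln_mult, ln_Rinv, ln_pow in Hle;
    try easy; try lra; try (apply Rinv_0_lt_compat; easy).
  assert (Hx : (p - 1) * (e * (ln (flux n h r) + - (INR n * ln 2)))
    = ln (flux n h r) - INR n * ln 2) by (unfold e; field; lra).
  assert ((p - 1) * (e * (ln (flux n h r) + - (INR n * ln 2)))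
    <= (p - 1) * (ln (u r) - ln r)) by (apply Rmult_le_compat_l; lra).
  lra.
Qed.

(** * The Pohozaev argument for a positive solution on the whole half-line *)

Section GroundState.

Variables (n : nat) (p q delta mu k xi eta : R) (u v : R -> R).
Hypotheses (Hp : 1 < p) (Hq : 1 < q) (Hd : 0 < delta) (Hm : 0 < mu).
Hypotheses (cu : cont u) (cv : cont v).
Hypothesis Hu : forall r, 0 <= r -> 0 < u r.
Hypothesis Hv : forall r, 0 <= r -> 0 < v r.
Hypothesis Eu : forall r, 0 <= r -> u r = xi - drop n p (fun t => abs_pow (v t) delta) r.
Hypothesis Ev : forall r, 0 <= r -> v r = eta - drop n q (fun t => abs_pow (u t) mu) r.

Let F := fun t => abs_pow (v t) delta.
Let G := fun t => abs_pow (u t) mu.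
Let A := flux n F.
Let B := flux n G.
Let Phi := pohozaev (INR n) p q delta mu k A B u v.

Lemma ground_cont_F : cont F.
Proof.
  apply (cont_comp (fun t => abs_pow t delta) v); [|easy].
  intros x; now apply abs_pow_continuous.
Qed.

Lemma ground_cont_G : cont G.
Proof.
  apply (cont_comp (fun t => abs_pow t mu) u); [|easy].
  intros x; now apply abs_pow_continuous.
Qed.

Lemma ground_F r : 0 <= r -> F r = Rpower (v r) delta.
Proof. intros Hr; apply abs_pow_pos; now apply Hv. Qed.

Lemma ground_G r : 0 <= r -> G r = Rpower (u r) mu.
Proof. intros Hr; apply abs_pow_pos; now apply Hu. Qed.

Lemma ground_A r : 0 < r -> 0 < A r.
Proof.
  intros Hr; apply flux_pos; [apply ground_cont_F|easy|].
  intros t Ht; rewrite ground_F by lra; apply Rpower_gt0.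
Qed.

Lemma ground_B r : 0 < r -> 0 < B r.
Proof.
  intros Hr; apply flux_pos; [apply ground_cont_G|easy|].
  intros t Ht; rewrite ground_G by lra; apply Rpower_gt0.
Qed.

Lemma ground_u_decr s t : 0 <= s <= t -> u t <= u s.
Proof.
  intros H; rewrite !Eu by lra.
  assert (H' := drop_nondecr n p F s t Hp ground_cont_F ltac:(lra)); fold F; lra.
Qed.

Lemma ground_v_decr s t : 0 <= s <= t -> v t <= v s.
Proof.
  intros H; rewrite !Ev by lra.
  assert (H' := drop_nondecr n q G s t Hq ground_cont_G ltac:(lra)); fold G; lra.
Qed.

(** The mean of the decreasing function v^delta over the ball is at least its boundary value. This
    fixes the sign of the first correction in Phi and puts r v^delta / A in [0, n + 1]. *)
Lemma ground_A_lower r : 0 < r -> r * Rpower (v r) delta <= (INR n + 1) * A r.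
Proof.
  intros Hr; rewrite <- ground_F, <- S_INR by lra. assert (HN := INR_S_gt0 n).
  assert (H : F r * r / INR (S n) <= A r).
  { apply flux_lower; [apply ground_cont_F|lra|]. intros t Ht; unfold F.
    apply abs_pow_le; [lra|]. split; [apply Rlt_le, Hv; lra|apply ground_v_decr; lra]. }
  apply (Rmult_le_compat_l (INR (S n))) in H; [|lra].
  replace (INR (S n) * (F r * r / INR (S n))) with (r * F r) in H by (field; lra). easy.
Qed.

Lemma ground_B_lower r : 0 < r -> r * Rpower (u r) mu <= (INR n + 1) * B r.
Proof.
  intros Hr; rewrite <- ground_G, <- S_INR by lra. assert (HN := INR_S_gt0 n).
  assert (H : G r * r / INR (S n) <= B r).
  { apply flux_lower; [apply ground_cont_G|lra|]. intros t Ht; unfold G.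
    apply abs_pow_le; [lra|]. split; [apply Rlt_le, Hu; lra|apply ground_u_decr; lra]. }
  apply (Rmult_le_compat_l (INR (S n))) in H; [|lra].
  replace (INR (S n) * (G r * r / INR (S n))) with (r * G r) in H by (field; lra). easy.
Qed.

Lemma is_derive_minus_drop m (h w : R -> R) a r : 1 < m -> cont h ->
  (forall t, 0 <= t -> w t = a - drop n m h t) -> 0 < r ->
  is_derive w r (- abs_pow (flux n h r) (1 / (m - 1))).
Proof.
  intros Hm' ch Heq Hr.
  apply (is_derive_ext_loc (fun t => a - drop n m h t)).
  - exists (mkposreal r Hr); intros y Hy.
    unfold ball in Hy; simpl in Hy; unfold AbsRing_ball, abs, minus, plus, opp in Hy.
    simpl in Hy. apply Rabs_def2 in Hy. symmetry; apply Heq; lra.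
  - replace (- abs_pow (flux n h r) (1 / (m - 1))) with (0 - slope n m h r)
      by (unfold slope; ring).
    apply (is_derive_minus (fun _ => a) (drop n m h)); [apply (is_derive_const a r)|].
    now apply is_derive_drop.
Qed.

Hypothesis Hkp : k + (1 - 1 / (p - 1)) <= INR n + 1.
Hypothesis Hkq : k + (1 - 1 / (q - 1)) <= INR n + 1.
Hypothesis Hkp' : k <= INR n + 1 + (1 - 1 / (p - 1)) * INR n.
Hypothesis Hkq' : k <= INR n + 1 + (1 - 1 / (q - 1)) * INR n.
Hypothesis Hsub : 0 < k - 2 * INR n + (INR n + 1) * (1 / (delta + 1) + 1 / (mu + 1)).
Hypothesis Hk2 : 0 < k + 2.
Hypothesis Hcrit : 0 < delta * mu - (p - 1) * (q - 1).
(** Divided by delta mu - (p-1)(q-1), this reads k < (p-1)(alpha + 1) + (q-1)(beta + 1), where the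
    right side is the decay exponent of A B. *)
Hypothesis Hdecay : (delta * mu - (p - 1) * (q - 1)) * k <
  (p - 1) * (delta * mu - (p - 1) * (q - 1) + p * (q - 1) + q * delta)
  + (q - 1) * (delta * mu - (p - 1) * (q - 1) + q * (p - 1) + p * mu).

(** The expression is affine in W, and the two bounds on k are its nonnegativity at W = N + 1 and at
    W = 0. It is used with N = n, one less than the space dimension. *)
Lemma affine_nonneg N W ka : 0 <= W <= N + 1 -> k + ka <= N + 1 ->
  k <= N + 1 + ka * N -> 0 <= N + 1 - k - ka * (W - N).
Proof.
  intros HW H1 H2. destruct (Rle_dec 0 ka); nra.
Qed.

Lemma pohozaev_increasing r s : 0 < r < s -> Phi r < Phi s.
Proof.
  intros Hrs; unfold Phi.
  eapply (derive_pos_lt (pohozaev (INR n) p q delta mu k A B u v)); [apply Hrs| |].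
  - intros x Hx; assert (Hx0 : 0 < x) by lra.
    apply pohozaev_derive; try easy.
    + now apply ground_A.
    + now apply ground_B.
    + apply Hu; lra.
    + apply Hv; lra.
    + rewrite <- ground_F by lra. apply is_derive_flux; [apply ground_cont_F|easy].
    + rewrite <- ground_G by lra. apply is_derive_flux; [apply ground_cont_G|easy].
    + rewrite <- abs_pow_pos by now apply ground_A.
      apply (is_derive_minus_drop p F u xi); [easy|apply ground_cont_F|apply Eu|easy].
    + rewrite <- abs_pow_pos by now apply ground_B.
      apply (is_derive_minus_drop q G v eta); [easy|apply ground_cont_G|apply Ev|easy].
  - intros x Hx; cbv beta; assert (Hx0 : 0 < x) by lra.
    assert (HA := ground_A x Hx0). assert (HB := ground_B x Hx0).
    assert (LA := ground_A_lower x Hx0). assert (LB := ground_B_lower x Hx0).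
    assert (Hux := Hu x ltac:(lra)). assert (Hvx := Hv x ltac:(lra)).
    assert (HU := Rpower_gt0 (u x) mu). assert (HV := Rpower_gt0 (v x) delta).
    set (U := Rpower (u x) mu) in *. set (V := Rpower (v x) delta) in *.
    apply Rmult_lt_0_compat.
    { apply Rdiv_lt_0_compat; [apply Rpower_gt0|easy]. }
    assert (HZ : 0 <= x * V / A x <= INR n + 1).
    { split; [apply Rlt_le, Rdiv_lt_0_compat; nra|]. apply (Rle_div_l (x * V)); lra. }
    assert (HW : 0 <= x * U / B x <= INR n + 1).
    { split; [apply Rlt_le, Rdiv_lt_0_compat; nra|]. apply (Rle_div_l (x * U)); lra. }
    assert (SA : 0 <= (INR n + 1) * A x / x - V).
    { assert (V <= (INR n + 1) * A x / x); [|lra]. apply (Rle_div_r V); lra. }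
    assert (SB : 0 <= (INR n + 1) * B x / x - U).
    { assert (U <= (INR n + 1) * B x / x); [|lra]. apply (Rle_div_r U); lra. }
    assert (T1 := affine_nonneg _ _ _ HW Hkq Hkq').
    assert (T2 := affine_nonneg _ _ _ HZ Hkp Hkp').
    assert (R1 := Rpower_gt0 (B x) (1 - 1 / (q - 1))).
    assert (R2 := Rpower_gt0 (A x) (1 - 1 / (p - 1))).
    assert (I1 : 0 < / (delta + 1)) by (apply Rinv_0_lt_compat; lra).
    assert (I2 : 0 < / (mu + 1)) by (apply Rinv_0_lt_compat; lra).
    rewrite Rplus_assoc. apply Rplus_lt_le_0_compat.
    + apply Rmult_lt_0_compat; [nra|easy].
    + apply Rplus_le_le_0_compat; apply Rmult_le_pos; try easy;
        apply Rmult_le_pos; try lra; apply Rmult_le_pos; try easy;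
        apply Rmult_le_pos; lra.
Qed.

(** Each correction is at least a negative multiple of r^2 by [pohozaev_corner], and A B is
    positive. With k + 2 > 0 the bound tends to 0 at the origin, so the increasing Phi cannot be
    negative anywhere. *)
Lemma pohozaev_lower : exists K, 0 <= K /\ forall r, 0 < r <= 1 ->
  - (K * Rpower r (k + 2)) <= Phi r.
Proof.
  assert (HG1 := Hu 1 ltac:(lra)). assert (HF1 := Hv 1 ltac:(lra)).
  destruct (pohozaev_corner n q delta (G 1) (G 0) eta v G) as [K1 [HK1 B1]]; try easy.
  { rewrite ground_G by lra; apply Rpower_gt0. }
  { apply ground_cont_G. }
  { intros; apply Ev; lra. }
  { intros; apply Hv; lra. }
  { intros t Ht; unfold G; split; apply abs_pow_le; try lra; split;
      try (apply ground_u_decr; lra); apply Rlt_le, Hu; lra. }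
  destruct (pohozaev_corner n p mu (F 1) (F 0) xi u F) as [K2 [HK2 B2]]; try easy.
  { rewrite ground_F by lra; apply Rpower_gt0. }
  { apply ground_cont_F. }
  { intros; apply Eu; lra. }
  { intros; apply Hu; lra. }
  { intros t Ht; unfold F; split; apply abs_pow_le; try lra; split;
      try (apply ground_v_decr; lra); apply Rlt_le, Hv; lra. }
  exists (K1 / (delta + 1) + K2 / (mu + 1)).
  assert (I1 : 0 < / (delta + 1)) by (apply Rinv_0_lt_compat; lra).
  assert (I2 : 0 < / (mu + 1)) by (apply Rinv_0_lt_compat; lra).
  split; [unfold Rdiv; nra|].
  intros r Hr; specialize (B1 r Hr); specialize (B2 r Hr). fold F in B1. fold G in B2.
  fold A in B1, B2. fold B in B1, B2.
  assert (Hr0 : 0 < r) by lra.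
  assert (HA := ground_A r Hr0). assert (HB := ground_B r Hr0).
  assert (HR := Rpower_gt0 r k).
  rewrite Rpower_plus. replace (Rpower r 2) with (r * r).
  2: { change 2 with (INR 2). rewrite Rpower_pow by easy. simpl; ring. }
  unfold Phi, pohozaev.
  set (X1 := Rpower (B r) (1 - 1 / (q - 1)) * v r) in *.
  set (X2 := Rpower (A r) (1 - 1 / (p - 1)) * u r) in *.
  set (a1 := (INR n + 1) * A r / r) in *. set (b1 := (INR n + 1) * B r / r) in *.
  apply (Rmult_le_compat_r (/ (delta + 1))) in B1; [|lra].
  apply (Rmult_le_compat_r (/ (mu + 1))) in B2; [|lra].
  replace (- ((K1 / (delta + 1) + K2 / (mu + 1)) * (Rpower r k * (r * r))))
    with (Rpower r k * (- (K1 * (r * r) * / (delta + 1)) - K2 * (r * r) * / (mu + 1)))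
    by (unfold Rdiv; ring).
  apply Rmult_le_compat_l; [lra|]. assert (0 < A r * B r) by nra. unfold Rdiv. lra.
Qed.

Lemma pohozaev_pos : 0 < Phi 1.
Proof.
  (* The limit at the origin yields only a weak inequality at 1/2; the increase from 1/2 to 1 makes
     it strict. *)
  apply Rle_lt_trans with (Phi (/ 2)); [|apply pohozaev_increasing; lra].
  destruct (Rle_dec 0 (Phi (/ 2))) as [H|H]; [easy|exfalso].
  destruct pohozaev_lower as [K [HK HL]].
  set (y := - Phi (/ 2) / (K + 1)).
  assert (Hy : 0 < y) by (apply Rdiv_lt_0_compat; lra).
  set (r := Rmin (/ 4) (Rpower y (1 / (k + 2)))).
  assert (Hr : 0 < r) by (apply Rmin_pos; [lra|apply Rpower_gt0]).
  assert (Hr4 : r <= / 4) by apply Rmin_l.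
  assert (H1 := HL r ltac:(lra)).
  assert (H2 := pohozaev_increasing r (/ 2) ltac:(lra)).
  assert (H3 : Rpower r (k + 2) <= y).
  { apply Rle_trans with (Rpower (Rpower y (1 / (k + 2))) (k + 2)).
    - apply Rle_Rpower_l; [lra|]. split; [easy|apply Rmin_r].
    - rewrite Rpower_mult. replace (1 / (k + 2) * (k + 2)) with 1 by (field; lra).
      rewrite Rpower_1; lra. }
  assert (H4 : (K + 1) * y = - Phi (/ 2)) by (unfold y; field; lra).
  assert (H5 := Rpower_gt0 r (k + 2)). nra.
Qed.

Lemma pohozaev_upper r : 0 < r -> Phi r <= Rpower r k * (A r * B r).
Proof.
  intros Hr. assert (HR := Rpower_gt0 r k).
  assert (LA := ground_A_lower r Hr). assert (LB := ground_B_lower r Hr).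
  assert (Hux := Hu r ltac:(lra)). assert (Hvx := Hv r ltac:(lra)).
  assert (R1 := Rpower_gt0 (B r) (1 - 1 / (q - 1))).
  assert (R2 := Rpower_gt0 (A r) (1 - 1 / (p - 1))).
  assert (I1 : 0 < / (delta + 1)) by (apply Rinv_0_lt_compat; lra).
  assert (I2 : 0 < / (mu + 1)) by (apply Rinv_0_lt_compat; lra).
  assert (SA : Rpower (v r) delta <= (INR n + 1) * A r / r) by (apply (Rle_div_r _ _ r Hr); lra).
  assert (SB : Rpower (u r) mu <= (INR n + 1) * B r / r) by (apply (Rle_div_r _ _ r Hr); lra).
  unfold Phi, pohozaev. apply Rmult_le_compat_l; [lra|].
  set (X1 := Rpower (B r) (1 - 1 / (q - 1)) * v r) in *.
  set (X2 := Rpower (A r) (1 - 1 / (p - 1)) * u r) in *.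
  assert (HX1 : 0 < X1) by (apply Rmult_lt_0_compat; easy).
  assert (HX2 : 0 < X2) by (apply Rmult_lt_0_compat; easy).
  assert (T1 : X1 * (Rpower (v r) delta - (INR n + 1) * A r / r) * / (delta + 1) <= 0).
  { assert (X1 * (Rpower (v r) delta - (INR n + 1) * A r / r) <= 0) by nra. nra. }
  assert (T2 : X2 * (Rpower (u r) mu - (INR n + 1) * B r / r) * / (mu + 1) <= 0).
  { assert (X2 * (Rpower (u r) mu - (INR n + 1) * B r / r) <= 0) by nra. nra. }
  unfold Rdiv at 1 3. unfold Rdiv in T1, T2 |- *. lra.
Qed.

(** In logarithms all bounds at a radius r = exp l are linear in l, ln u and ln v. Eliminating the
    last two from 0 < Phi 1 <= r^k A B leaves E l <= Cst with E > 0 independent of l, false for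
    large l. *)
Lemma ground_solution_absurd : False.
Proof.
  assert (HPhi := pohozaev_pos). set (phi := ln (Phi 1)).
  set (Del := delta * mu - (p - 1) * (q - 1)) in *.
  set (c := INR n * ln 2). set (c' := ln (INR n + 1)).
  assert (HN : 0 < INR n + 1) by (rewrite <- S_INR; apply INR_S_gt0).
  set (E := (p - 1) * (Del + p * (q - 1) + q * delta)
            + (q - 1) * (Del + q * (p - 1) + p * mu) - Del * k).
  assert (HE : 0 < E) by (unfold E; lra).
  (* The sum of all constants of the final inequality [Hfin], collected beforehand because the
     radius has to be chosen from it. *)
  set (Cst := Del * (2 * c) + (p - 1) * ((c + c') * (q - 1 + delta))
              + (q - 1) * ((c + c') * (p - 1 + mu)) - Del * phi).
  set (l := (Rabs Cst + 1) / E).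
  assert (Hl : 0 < l).
  { apply Rdiv_lt_0_compat; [|easy]. assert (H := Rabs_pos Cst); lra. }
  set (r := exp l). assert (Hr : 0 < r) by apply exp_pos.
  assert (Hlr : ln r = l) by apply ln_exp.
  assert (Hr1 : 1 < r) by (unfold r; rewrite <- exp_0; now apply exp_increasing).
  assert (HA := ground_A r Hr). assert (HB := ground_B r Hr).
  assert (Hux := Hu r ltac:(lra)). assert (Hvx := Hv r ltac:(lra)).
  assert (UA : ln (A r) <= (p - 1) * (ln (u r) - l) + c).
  { rewrite <- Hlr. apply (ln_flux_upper n p F u xi r); try easy.
    - apply ground_cont_F.
    - intros t Ht; rewrite ground_F by easy; apply Rpower_gt0. }
  assert (UB : ln (B r) <= (q - 1) * (ln (v r) - l) + c).
  { rewrite <- Hlr. apply (ln_flux_upper n q G v eta r); try easy.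
    - apply ground_cont_G.
    - intros t Ht; rewrite ground_G by easy; apply Rpower_gt0. }
  assert (HU := Rpower_gt0 (u r) mu). assert (HV := Rpower_gt0 (v r) delta).
  assert (LA : l + delta * ln (v r) <= c' + ln (A r)).
  { rewrite <- Hlr. unfold c'. rewrite <- ln_mult by easy.
    assert (H := ground_A_lower r Hr). apply ln_le in H; [|nra].
    rewrite ln_mult in H by easy. unfold Rpower in H; rewrite ln_exp in H. easy. }
  assert (LB : l + mu * ln (u r) <= c' + ln (B r)).
  { rewrite <- Hlr. unfold c'. rewrite <- ln_mult by easy.
    assert (H := ground_B_lower r Hr). apply ln_le in H; [|nra].
    rewrite ln_mult in H by easy. unfold Rpower in H; rewrite ln_exp in H. easy. }
  assert (Hphi : phi <= k * l + ln (A r) + ln (B r)).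
  { assert (H : Phi 1 <= Rpower r k * (A r * B r)).
    { eapply Rle_trans; [apply Rlt_le, (pohozaev_increasing 1 r); lra|].
      now apply pohozaev_upper. }
    apply ln_le in H; [|easy]. rewrite !ln_mult in H; try easy.
    - unfold Rpower in H; rewrite ln_exp, Hlr in H. unfold phi; lra.
    - apply Rpower_gt0.
    - now apply Rmult_lt_0_compat. }
  set (x := ln (u r)) in *. set (y := ln (v r)) in *.
  assert (V1 : delta * y <= (p - 1) * x - p * l + (c + c')) by lra.
  assert (V2 : mu * x <= (q - 1) * y - q * l + (c + c')) by lra.
  (* The combination (q - 1) [V1] + delta [V2] eliminates y. As Del > 0, this is the decay u =
     O(r^(-alpha)); [V4] is the same for v. *)
  assert (V3 : Del * x <= - (p * (q - 1) + q * delta) * l + (c + c') * (q - 1 + delta)).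
  { assert (W1 := Rmult_le_compat_l (q - 1) _ _ ltac:(lra) V1).
    assert (W2 := Rmult_le_compat_l delta _ _ ltac:(lra) V2).
    unfold Del; lra. }
  assert (V4 : Del * y <= - (q * (p - 1) + p * mu) * l + (c + c') * (p - 1 + mu)).
  { assert (W1 := Rmult_le_compat_l (p - 1) _ _ ltac:(lra) V2).
    assert (W2 := Rmult_le_compat_l mu _ _ ltac:(lra) V1).
    unfold Del; lra. }
  assert (V5 : phi <= k * l + (p - 1) * (x - l) + (q - 1) * (y - l) + 2 * c) by lra.
  assert (W0 := Rmult_le_compat_l Del _ _ ltac:(lra) V5).
  assert (W1 := Rmult_le_compat_l (p - 1) _ _ ltac:(lra) V3).
  assert (W2 := Rmult_le_compat_l (q - 1) _ _ ltac:(lra) V4).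
  assert (Hfin : E * l <= Cst) by (unfold E, Cst; lra).
  assert (HEl : E * l = Rabs Cst + 1) by (unfold l; field; lra).
  assert (H := Rle_abs Cst). lra.
Qed.

End GroundState.

(** * Exponents *)

(** The quotient equals t / (t + b) with t = (a - m) / (m - 1), which decreases in m. *)
Lemma hyperbola_term_decr a b m m' : 0 < b -> 1 < m <= m' -> m' < a ->
  (a - m') / ((a - m') + (m' - 1) * b) <= (a - m) / ((a - m) + (m - 1) * b).
Proof.
  intros Hb Hm Ha.
  assert (D1 : 0 < (a - m') + (m' - 1) * b) by nra.
  assert (D2 : 0 < (a - m) + (m - 1) * b) by nra.
  apply (Rmult_le_reg_r ((a - m') + (m' - 1) * b)); [easy|].
  apply (Rmult_le_reg_r ((a - m) + (m - 1) * b)); [easy|].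
  replace ((a - m') / ((a - m') + (m' - 1) * b) * ((a - m') + (m' - 1) * b)
    * ((a - m) + (m - 1) * b)) with ((a - m') * ((a - m) + (m - 1) * b)) by (field; lra).
  replace ((a - m) / ((a - m) + (m - 1) * b) * ((a - m') + (m' - 1) * b)
    * ((a - m) + (m - 1) * b)) with ((a - m) * ((a - m') + (m' - 1) * b)) by (field; lra).
  assert (0 <= b * ((m' - m) * (a - 1))) by (apply Rmult_le_pos; [lra|nra]).
  nra.
Qed.

Lemma Rdiv_le_cross a b c d : 0 < b -> 0 < d -> a * d <= c * b -> a / b <= c / d.
Proof.
  intros Hb Hd H. apply (Rmult_le_reg_r b); [easy|]. apply (Rmult_le_reg_r d); [easy|].
  replace (a / b * b * d) with (a * d) by (field; lra).
  replace (c / d * b * d) with (c * b) by (field; lra). easy.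
Qed.

(** After p and q are lowered to m, the inequality m - 1 <= 1 bounds both denominators below by (m -
    1)(X + Y - m). The point is a bound that depends on X + Y alone. *)
Lemma hyperbola_sum_le m p q X Y : 1 < m <= 2 -> m <= p -> m <= q -> p < X -> q < Y ->
  (Y - q) / ((Y - q) + (q - 1) * X) + (X - p) / ((X - p) + (p - 1) * Y)
  <= (X + Y - 2 * m) / ((m - 1) * (X + Y - m)).
Proof.
  intros Hm Hp Hq HX HY.
  assert (T1 := hyperbola_term_decr Y X m q ltac:(lra) ltac:(lra) HY).
  assert (T2 := hyperbola_term_decr X Y m p ltac:(lra) ltac:(lra) HX).
  assert (D : 0 < (m - 1) * (X + Y - m)) by nra.
  assert (T3 : (Y - m) / ((Y - m) + (m - 1) * X) <= (Y - m) / ((m - 1) * (X + Y - m))).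
  { apply Rmult_le_compat_l; [lra|]. apply Rinv_le_contravar; [easy|nra]. }
  assert (T4 : (X - m) / ((X - m) + (m - 1) * Y) <= (X - m) / ((m - 1) * (X + Y - m))).
  { apply Rmult_le_compat_l; [lra|]. apply Rinv_le_contravar; [easy|nra]. }
  replace ((X + Y - 2 * m) / ((m - 1) * (X + Y - m)))
    with ((Y - m) / ((m - 1) * (X + Y - m)) + (X - m) / ((m - 1) * (X + Y - m)))
    by (field; nra).
  lra.
Qed.

(* With alpha, beta the exponents of the scaling invariance, X = delta beta and
   Y = mu alpha; the conclusion says k + 2 < X + Y. *)
Lemma decay_exponent m nu p q delta mu k :
  1 < m <= 2 -> m <= p -> m <= q -> 0 < delta -> 0 < mu -> 1 <= nu ->
  0 < delta * mu - (p - 1) * (q - 1) ->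
  m < k + 2 ->
  (k + 2 - 2 * m) * (nu + 1) <= (2 * nu - k) * ((m - 1) * (k + 2 - m)) ->
  (2 * nu - k) / (nu + 1) < 1 / (delta + 1) + 1 / (mu + 1) ->
  (delta * mu - (p - 1) * (q - 1)) * k <
  (p - 1) * (delta * mu - (p - 1) * (q - 1) + p * (q - 1) + q * delta)
  + (q - 1) * (delta * mu - (p - 1) * (q - 1) + q * (p - 1) + p * mu).
Proof.
  intros Hm Hp Hq Hd Hmu Hnu HD Hk Hle Hs.
  set (Del := delta * mu - (p - 1) * (q - 1)) in *.
  set (X := delta * (q * (p - 1) + p * mu) / Del).
  set (Y := mu * (p * (q - 1) + q * delta) / Del).
  assert (EX : X = (p - 1) * (p * (q - 1) + q * delta) / Del + p)
    by (unfold X; unfold Del in *; field; lra).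
  assert (EY : Y = (q - 1) * (q * (p - 1) + p * mu) / Del + q)
    by (unfold Y; unfold Del in *; field; lra).
  assert (HX : p < X).
  { rewrite EX. assert (0 < (p - 1) * (p * (q - 1) + q * delta) / Del); [|lra].
    apply Rdiv_lt_0_compat; [|easy]. apply Rmult_lt_0_compat; [lra|].
    assert (0 < p * (q - 1)) by nra. assert (0 < q * delta) by nra. lra. }
  assert (HY : q < Y).
  { rewrite EY. assert (0 < (q - 1) * (q * (p - 1) + p * mu) / Del); [|lra].
    apply Rdiv_lt_0_compat; [|easy]. apply Rmult_lt_0_compat; [lra|].
    assert (0 < q * (p - 1)) by nra. assert (0 < p * mu) by nra. lra. }
  (* By the scaling relations Y - q = (q - 1) beta, while X = delta beta, so the quotient is beta /
     (beta + delta beta). *)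
  assert (S1 : 1 / (delta + 1) = (Y - q) / ((Y - q) + (q - 1) * X)).
  { assert (0 < q * (p - 1)) by nra. assert (0 < p * mu) by nra.
    rewrite EY; unfold X.
    replace ((q - 1) * (q * (p - 1) + p * mu) / Del + q - q)
      with ((q - 1) * (q * (p - 1) + p * mu) / Del) by ring.
    field; repeat split; try lra.
    assert (0 < (q - 1) * (q * (p - 1) + p * mu)) by nra.
    assert (0 < (q - 1) * (delta * (q * (p - 1) + p * mu))) by
      (apply Rmult_lt_0_compat; [lra|nra]). lra. }
  assert (S2 : 1 / (mu + 1) = (X - p) / ((X - p) + (p - 1) * Y)).
  { assert (0 < p * (q - 1)) by nra. assert (0 < q * delta) by nra.
    rewrite EX; unfold Y.
    replace ((p - 1) * (p * (q - 1) + q * delta) / Del + p - p)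
      with ((p - 1) * (p * (q - 1) + q * delta) / Del) by ring.
    field; repeat split; try lra.
    assert (0 < (p - 1) * (p * (q - 1) + q * delta)) by nra.
    assert (0 < (p - 1) * (mu * (p * (q - 1) + q * delta))) by
      (apply Rmult_lt_0_compat; [lra|nra]). lra. }
  (* The bound of [hyperbola_sum_le] increases with X + Y. If X + Y were at most k + 2, its value at
     k + 2 would contradict the subcriticality inequality. *)
  assert (HS : k + 2 < X + Y).
  { destruct (Rlt_dec (k + 2) (X + Y)) as [H|H]; [easy|exfalso].
    assert (B := hyperbola_sum_le m p q X Y Hm Hp Hq HX HY).
    rewrite <- S1, <- S2 in B.
    assert (B2 : (X + Y - 2 * m) / ((m - 1) * (X + Y - m))
       <= (k + 2 - 2 * m) / ((m - 1) * (k + 2 - m))).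
    { apply Rdiv_le_cross; [nra|nra|].
      assert (0 <= (m - 1) * (m * (k + 2 - (X + Y)))) by
        (apply Rmult_le_pos; [lra|nra]). nra. }
    assert (B3 : (k + 2 - 2 * m) / ((m - 1) * (k + 2 - m)) <= (2 * nu - k) / (nu + 1)).
    { apply Rdiv_le_cross; [nra|lra|easy]. }
    lra. }
  assert (Hid : (p - 1) * (Del + p * (q - 1) + q * delta)
    + (q - 1) * (Del + q * (p - 1) + p * mu) = Del * (X + Y - 2)).
  { rewrite EX, EY; field; lra. }
  rewrite Hid. apply Rmult_lt_compat_l; lra.
Qed.

(* The first five conditions make the Pohozaev function increasing, the sixth makes it
   tend to 0 at the origin and the last one at infinity. *)
Definition pohozaev_exponent (nu p q delta mu k : R) : Prop :=
  k + (1 - 1 / (p - 1)) <= nu + 1 /\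
  k + (1 - 1 / (q - 1)) <= nu + 1 /\
  k <= nu + 1 + (1 - 1 / (p - 1)) * nu /\
  k <= nu + 1 + (1 - 1 / (q - 1)) * nu /\
  0 < k - 2 * nu + (nu + 1) * (1 / (delta + 1) + 1 / (mu + 1)) /\
  0 < k + 2 /\
  (delta * mu - (p - 1) * (q - 1)) * k <
    (p - 1) * (delta * mu - (p - 1) * (q - 1) + p * (q - 1) + q * delta)
    + (q - 1) * (delta * mu - (p - 1) * (q - 1) + q * (p - 1) + p * mu).

Lemma inv_pred_antitone a b : 1 < a <= b -> 1 / (b - 1) <= 1 / (a - 1).
Proof. intros H; apply Rdiv_le_cross; lra. Qed.

(** For p, q <= 2 the upper bounds k <= nu + 1 + (1 - 1/(m-1)) nu are the binding ones, worst at the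
    minimum m; the witness 2 nu + 1 - Q attains equality there. The lower bound on m says Q < nu +
    2, so k > nu - 1 >= 0 and m < k + 2. Since 2 nu - k = Q - 1, the hypothesis on the sum is
    exactly subcriticality for this k. *)
Lemma pohozaev_exponent_singular nu p q delta mu :
  1 <= nu -> 1 < p -> 1 < q -> 0 < delta -> 0 < mu ->
  0 < delta * mu - (p - 1) * (q - 1) ->
  2 * (nu + 1) / (nu + 2) < p <= 2 -> 2 * (nu + 1) / (nu + 2) < q <= 2 ->
  (nu + 1 - Rmin p q) / ((nu + 1) * (Rmin p q - 1)) < 1 / (delta + 1) + 1 / (mu + 1) ->
  exists k, pohozaev_exponent nu p q delta mu k.
Proof.
  intros Hnu Hp Hq Hd Hm HD Hp2 Hq2 Hs.
  set (m := Rmin p q) in *.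
  assert (Hmp : m <= p) by apply Rmin_l. assert (Hmq : m <= q) by apply Rmin_r.
  assert (Hm1 : 1 < m) by (unfold m; apply Rmin_glb_lt; easy).
  assert (Hm2 : 2 * (nu + 1) / (nu + 2) < m) by (unfold m; apply Rmin_glb_lt; easy).
  set (Q := nu / (m - 1)).
  assert (EQ : Q * (m - 1) = nu) by (unfold Q; field; lra).
  assert (HQ1 : nu <= Q) by nra.
  assert (HQ2 : Q < nu + 2).
  { assert (H : 2 * (nu + 1) < m * (nu + 2)).
    { apply (Rmult_lt_compat_r (nu + 2)) in Hm2; [|lra].
      replace (2 * (nu + 1) / (nu + 2) * (nu + 2)) with (2 * (nu + 1)) in Hm2 by (field; lra).
      easy. }
    apply Rmult_lt_reg_r with (m - 1); [lra|]. rewrite EQ. lra. }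
  assert (Ip := inv_pred_antitone m p ltac:(lra)).
  assert (Iq := inv_pred_antitone m q ltac:(lra)).
  assert (Jp := inv_pred_antitone p 2 ltac:(lra)).
  assert (Jq := inv_pred_antitone q 2 ltac:(lra)).
  replace (1 / (2 - 1)) with 1 in * by field.
  assert (EQ' : Q = 1 / (m - 1) * nu) by (unfold Q; field; lra).
  assert (Hs' : (Q - 1) / (nu + 1) < 1 / (delta + 1) + 1 / (mu + 1)).
  { replace ((Q - 1) / (nu + 1)) with ((nu + 1 - m) / ((nu + 1) * (m - 1)));
      [easy|unfold Q; field; lra]. }
  exists (2 * nu + 1 - Q).
  assert (Kp : 1 / (p - 1) * nu <= 1 / (m - 1) * nu) by (apply Rmult_le_compat_r; lra).
  assert (Kq : 1 / (q - 1) * nu <= 1 / (m - 1) * nu) by (apply Rmult_le_compat_r; lra).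
  assert (Lm : 1 <= 1 / (m - 1)) by lra.
  unfold pohozaev_exponent; repeat split; try lra.
  - apply (Rlt_div_l (Q - 1)) in Hs'; lra.
  - apply (decay_exponent m nu); try easy; try lra.
    + replace (2 * nu - (2 * nu + 1 - Q)) with (Q - 1) by ring.
      (* The difference of the two sides is m (m + Q - nu - 2), and (m - 1)(m + Q - nu - 2) = (nu +
         1 - m)(2 - m) >= 0. *)
      apply Rle_trans with ((nu + 1 - m) * (2 * nu + 3 - Q - m)).
      2: { right. replace (nu + 1 - m) with ((Q - 1) * (m - 1)) by lra. ring. }
      assert (H : nu + 2 - m - Q <= 0).
      { apply Rmult_le_reg_r with (m - 1); [lra|].
        assert (0 <= (nu + 1 - m) * (2 - m)) by (apply Rmult_le_pos; lra). lra. }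
      assert (0 <= - (nu + 2 - m - Q) * m) by nra. nra.
Qed.

(** For p, q >= 2 the bounds k <= nu + 1/(p-1) and k <= nu + 1/(q-1) are the binding ones, worst at
    the maximum m; the witness nu + 1/(m-1) attains equality there. *)
Lemma pohozaev_exponent_degenerate nu p q delta mu :
  1 <= nu -> 0 < delta -> 0 < mu ->
  0 < delta * mu - (p - 1) * (q - 1) ->
  2 <= p -> 2 <= q ->
  ((nu + 1) * (Rmax p q - 1) - Rmax p q) / ((nu + 1) * (Rmax p q - 1))
    < 1 / (delta + 1) + 1 / (mu + 1) ->
  exists k, pohozaev_exponent nu p q delta mu k.
Proof.
  intros Hnu Hd Hm HD Hp2 Hq2 Hs.
  set (m := Rmax p q) in *.
  assert (Hmp : p <= m) by apply Rmax_l. assert (Hmq : q <= m) by apply Rmax_r.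
  assert (Ip := inv_pred_antitone p m ltac:(lra)).
  assert (Iq := inv_pred_antitone q m ltac:(lra)).
  assert (Jp := inv_pred_antitone 2 p ltac:(lra)).
  assert (Jq := inv_pred_antitone 2 q ltac:(lra)).
  replace (1 / (2 - 1)) with 1 in * by field.
  assert (He0 : 0 < 1 / (m - 1)) by (apply Rdiv_lt_0_compat; lra).
  assert (Hs' : (nu - 1 / (m - 1)) / (nu + 1) < 1 / (delta + 1) + 1 / (mu + 1)).
  { replace ((nu - 1 / (m - 1)) / (nu + 1))
      with (((nu + 1) * (m - 1) - m) / ((nu + 1) * (m - 1))); [easy|field; lra]. }
  set (e := 1 / (m - 1)) in *.
  assert (Kp : 1 / (p - 1) * nu <= 1 * nu) by (apply Rmult_le_compat_r; lra).
  assert (Kq : 1 / (q - 1) * nu <= 1 * nu) by (apply Rmult_le_compat_r; lra).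
  exists (nu + e).
  unfold pohozaev_exponent; repeat split; try lra.
  - apply (Rlt_div_l (nu - e)) in Hs'; lra.
  (* [decay_exponent] takes a lower bound in (1, 2] for p and q, here 2, not the maximum m. Its
     numerical condition becomes (1 - e)(nu + e + 2) >= 0. *)
  - apply (decay_exponent 2 nu); try easy; try lra.
    nra.
Qed.

(** * Removing the truncation *)

Lemma choose_sequence {X : Type} (P : nat -> X -> Prop) :
  (forall k, exists x, P k x) -> exists f : nat -> X, forall k, P k (f k).
Proof.
  intros H. exists (fun k => proj1_sig (constructive_indefinite_description _ (H k))).
  intros k; apply proj2_sig.
Qed.

Lemma is_lim_seq_inv_S (a : R) : is_lim_seq (fun k => a / (INR k + 1)) 0.
Proof.
  apply is_lim_seq_ext with (fun k => a * / INR (S k)).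
  - intros k; rewrite S_INR; easy.
  - replace (Finite 0) with (Rbar_mult a 0) by (simpl; now rewrite Rmult_0_r).
    apply (is_lim_seq_scal_l (fun k => / INR (S k)) a 0).
    apply (is_lim_seq_incr_1 (fun k => / INR k)).
    apply (is_lim_seq_inv INR p_infty); [apply is_lim_seq_INR|easy].
Qed.

Lemma is_lim_seq_dominated (x : nat -> R) (l : R) (b : nat -> R) :
  (exists k0, forall k, (k0 <= k)%nat -> Rabs (x k - l) <= b k) -> is_lim_seq b 0 ->
  is_lim_seq x l.
Proof.
  intros [k0 Hle] Hb.
  assert (H : is_lim_seq (fun k => x k - l) 0).
  { apply is_lim_seq_abs_0.
    apply (is_lim_seq_le_le_loc (fun _ => 0) _ b); [|apply is_lim_seq_const|easy].
    exists k0; intros k Hk; split; [apply Rabs_pos|now apply Hle]. }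
  apply is_lim_seq_ext with (fun k => (x k - l) + l); [intros; ring|].
  replace (Finite l) with (Finite (0 + l)) by (f_equal; ring).
  apply is_lim_seq_plus'; [easy|apply is_lim_seq_const].
Qed.

(** The condition k <= phi k replaces strict monotonicity: it suffices to pass limits along phi and
    is preserved by composition. *)
Lemma bounded_subsequence (x : nat -> R) a b : (forall k, a <= x k <= b) ->
  exists phi : nat -> nat, (forall k, (k <= phi k)%nat) /\
    exists l : R, is_lim_seq (fun k => x (phi k)) l.
Proof.
  intros Hx.
  destruct (Bolzano_Weierstrass x (fun c => a <= c <= b)) as [l Hl]; [apply compact_P3|easy|].
  destruct (choose_sequence (fun k j => (k <= j)%nat /\ Rabs (x j - l) <= 1 / (INR k + 1)))
    as [phi Hphi].
  - intros k. assert (Hk : 0 < 1 / (INR k + 1)).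
    { apply Rdiv_lt_0_compat; [lra|assert (H := pos_INR k); lra]. }
    destruct (Hl (disc l (mkposreal _ Hk)) k) as [j [Hj Hd]].
    + exists (mkposreal _ Hk); now intros y Hy.
    + exists j; split; [easy|]. apply Rlt_le; exact Hd.
  - exists phi; split; [apply Hphi|]. exists l.
    apply (is_lim_seq_dominated _ _ (fun k => 1 / (INR k + 1))).
    + exists O; intros k _; apply Hphi.
    + apply is_lim_seq_inv_S.
Qed.

Lemma is_lim_seq_subseq_ge (x : nat -> R) (l : R) (phi : nat -> nat) :
  (forall k, (k <= phi k)%nat) -> is_lim_seq x l -> is_lim_seq (fun k => x (phi k)) l.
Proof.
  intros Hphi; apply is_lim_seq_subseq.
  intros P [N HN]; exists N; intros k Hk; apply HN. specialize (Hphi k); lia.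
Qed.

(** The source is bounded below only on [0, t0]. What it contributes there to r^n times the flux is
    never lost later, so the slope keeps a lower bound up to b even where h becomes small. *)
Lemma drop_lower_tail n m (h : R -> R) c t0 a b : 1 < m -> cont h -> 0 <= c ->
  0 < t0 <= a -> a <= b -> (forall t, 0 <= t -> 0 <= h t) ->
  (forall t, 0 <= t <= t0 -> c <= h t) ->
  abs_pow (c * t0 / INR (S n) * t0 ^ n / b ^ n) (1 / (m - 1)) * (b - a)
    <= drop n m h b - drop n m h a.
Proof.
  intros Hm ch Hc Ht0 Hab Hpos Hh. assert (HN := INR_S_gt0 n).
  assert (He : 0 < 1 / (m - 1)) by (apply Rdiv_lt_0_compat; lra).
  set (K := abs_pow _ _).
  replace (K * (b - a)) with ((fun t => K * t) b - (fun t => K * t) a) by ring.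
  apply (derive_le_compare (fun t => K * t) (drop n m h) (fun _ => K) (slope n m h));
    [lra| | |].
  - intros; auto_derive; [easy|ring].
  - intros; now apply is_derive_drop.
  - intros t Ht. unfold K, slope.
    assert (Hp0 : 0 < t0 ^ n) by (apply pow_lt; lra).
    assert (Hpt : 0 < t ^ n) by (apply pow_lt; lra).
    assert (Hpb : t ^ n <= b ^ n) by (apply pow_incr; lra).
    assert (H1 := flux_mono_mass n h t0 t ch Hpos ltac:(lra)).
    assert (H2 := flux_lower n h c t0 ch ltac:(lra) Hh).
    assert (H3 : 0 <= c * t0 / INR (S n)).
    { apply Rmult_le_pos; [nra|apply Rlt_le, Rinv_0_lt_compat; lra]. }
    assert (H4 : 0 <= c * t0 / INR (S n) * t0 ^ n) by nra.
    apply abs_pow_le; [lra|split].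
    + apply Rmult_le_pos; [easy|apply Rlt_le, Rinv_0_lt_compat; lra].
    + apply Rle_trans with (c * t0 / INR (S n) * t0 ^ n / t ^ n).
      * apply Rmult_le_compat_l; [easy|]. apply Rinv_le_contravar; lra.
      * apply Rle_div_l; [easy|]. nra.
Qed.

Lemma Rabs_diff_le_limit (x : nat -> R) (l y : R) (z : nat -> R) (w : R) :
  is_lim_seq x l -> is_lim_seq z w ->
  (exists k0, forall k, (k0 <= k)%nat -> Rabs (x k - y) <= z k) -> Rabs (l - y) <= w.
Proof.
  intros Hx Hz Hle.
  assert (H : is_lim_seq (fun k => Rabs (x k - y)) (Rabs (l - y))).
  { apply (is_lim_seq_abs (fun k => x k - y) (l - y)).
    apply is_lim_seq_minus'; [easy|apply is_lim_seq_const]. }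
  exact (is_lim_seq_le_loc _ _ (Rabs (l - y)) w Hle H Hz).
Qed.

Lemma is_lim_seq_between (x : nat -> R) (l a b : R) : is_lim_seq x l ->
  (exists k0, forall k, (k0 <= k)%nat -> a <= x k <= b) -> a <= l <= b.
Proof.
  intros Hx [k0 H]; split.
  - apply (is_lim_seq_le_loc (fun _ => a) x a l); [|apply is_lim_seq_const|easy].
    exists k0; intros; now apply H.
  - apply (is_lim_seq_le_loc x (fun _ => b) l b); [|easy|apply is_lim_seq_const].
    exists k0; intros; now apply H.
Qed.

(** * Convergence of the shooting solutions as eps tends to 0 *)

Section Limit.

Variables (n : nat) (p q delta mu eta0 eta1 : R).
Variables (ep et T : nat -> R) (u v : nat -> R -> R).
Hypotheses (Hp : 1 < p) (Hq : 1 < q) (Hd : 0 < delta) (Hm : 0 < mu).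
Hypotheses (H0 : 0 < eta0) (H1 : 1 <= eta1).
Hypothesis Hep : forall k, 0 < ep k /\ ep k < 1 / 2.
Hypothesis Hep0 : is_lim_seq ep 0.
Hypothesis Het : forall k, eta0 <= et k <= eta1.
Hypothesis HT : forall k, 0 < T k.
Hypothesis cu : forall k, cont (u k).
Hypothesis cv : forall k, cont (v k).
Hypothesis HuT : forall k, u k (T k) = ep k.
Hypothesis HvT : forall k, v k (T k) = ep k.
Hypothesis Hub : forall k t, 0 <= t <= T k -> ep k <= u k t <= eta1.
Hypothesis Hvb : forall k t, 0 <= t <= T k -> ep k <= v k t <= eta1.
Hypothesis Eu : forall k t, 0 <= t <= T k ->
  u k t = 1 - drop n p (fun s => abs_pow (v k s) delta) t.
Hypothesis Ev : forall k t, 0 <= t <= T k ->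
  v k t = et k - drop n q (fun s => abs_pow (u k s) mu) t.

Let F k := fun s => abs_pow (v k s) delta.
Let G k := fun s => abs_pow (u k s) mu.

Lemma limit_F_cont k : cont (F k).
Proof.
  apply (cont_comp (fun s => abs_pow s delta) (v k)); [|apply cv].
  intros x; now apply abs_pow_continuous.
Qed.

Lemma limit_G_cont k : cont (G k).
Proof.
  apply (cont_comp (fun s => abs_pow s mu) (u k)); [|apply cu].
  intros x; now apply abs_pow_continuous.
Qed.

Lemma limit_F_bound k t : 0 <= t <= T k -> 0 <= F k t <= abs_pow eta1 delta.
Proof.
  intros Ht; split; [apply abs_pow_ge0|]. apply abs_pow_le; [lra|].
  assert (A := Hvb k t Ht). assert (B := Hep k). lra.
Qed.

Lemma limit_G_bound k t : 0 <= t <= T k -> 0 <= G k t <= abs_pow eta1 mu.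
Proof.
  intros Ht; split; [apply abs_pow_ge0|]. apply abs_pow_le; [lra|].
  assert (A := Hub k t Ht). assert (B := Hep k). lra.
Qed.

(** The sources are bounded uniformly in k, so on a fixed interval u and v lose at most 1/2 and eta0
    / 2. As u equals [ep k] < 1/2 at T k, that interval ends before T k. *)
Lemma early_positivity : exists t0 c0, 0 < t0 /\ 0 < c0 /\ forall k, 2 * t0 < T k /\
  forall t, 0 <= t <= t0 -> c0 <= u k t /\ c0 <= v k t.
Proof.
  assert (HN := INR_S_gt0 n).
  set (Kp := abs_pow (abs_pow eta1 delta * 1 / INR (S n)) (1 / (p - 1))).
  set (Kq := abs_pow (abs_pow eta1 mu * 1 / INR (S n)) (1 / (q - 1))).
  assert (HKp : 0 <= Kp) by apply abs_pow_ge0. assert (HKq : 0 <= Kq) by apply abs_pow_ge0.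
  set (s := Rmin 1 (Rmin (1 / 2 / (Kp + 1)) (eta0 / 2 / (Kq + 1)))).
  assert (S1 : s <= 1) by apply Rmin_l.
  assert (S2 : s <= 1 / 2 / (Kp + 1)) by (eapply Rle_trans; [apply Rmin_r|apply Rmin_l]).
  assert (S3 : s <= eta0 / 2 / (Kq + 1)) by (eapply Rle_trans; [apply Rmin_r|apply Rmin_r]).
  assert (S0 : 0 < s).
  { repeat apply Rmin_pos; [lra| |]; apply Rdiv_lt_0_compat; lra. }
  apply (Rle_div_r _ (1 / 2)) in S2; [|lra]. apply (Rle_div_r _ (eta0 / 2)) in S3; [|lra].
  assert (Hdp : forall k t, 0 <= t <= s -> t <= T k -> drop n p (F k) t <= 1 / 2).
  { intros k t Ht HtT.
    assert (H := drop_lipschitz n p (F k) (abs_pow eta1 delta) t t 0 Hp (limit_F_cont k)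
      ltac:(lra) (abs_pow_ge0 _ _) ltac:(intros; apply limit_F_bound; lra) ltac:(lra) ltac:(lra)).
    rewrite drop_0, !Rminus_0_r, (Rabs_pos_eq t) in H by lra.
    apply Rle_trans with (Kp * t); [|nra].
    eapply Rle_trans; [apply Rle_abs|]. eapply Rle_trans; [apply H|].
    apply Rmult_le_compat_r; [lra|]. apply abs_pow_le.
    - apply Rlt_le, Rdiv_lt_0_compat; lra.
    - assert (Ha := abs_pow_ge0 eta1 delta). split.
      + apply Rmult_le_pos; [nra|apply Rlt_le, Rinv_0_lt_compat; lra].
      + apply Rmult_le_compat_r; [apply Rlt_le, Rinv_0_lt_compat; lra|nra]. }
  assert (Hdq : forall k t, 0 <= t <= s -> t <= T k -> drop n q (G k) t <= eta0 / 2).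
  { intros k t Ht HtT.
    assert (H := drop_lipschitz n q (G k) (abs_pow eta1 mu) t t 0 Hq (limit_G_cont k)
      ltac:(lra) (abs_pow_ge0 _ _) ltac:(intros; apply limit_G_bound; lra) ltac:(lra) ltac:(lra)).
    rewrite drop_0, !Rminus_0_r, (Rabs_pos_eq t) in H by lra.
    apply Rle_trans with (Kq * t); [|nra].
    eapply Rle_trans; [apply Rle_abs|]. eapply Rle_trans; [apply H|].
    apply Rmult_le_compat_r; [lra|]. apply abs_pow_le.
    - apply Rlt_le, Rdiv_lt_0_compat; lra.
    - assert (Ha := abs_pow_ge0 eta1 mu). split.
      + apply Rmult_le_pos; [nra|apply Rlt_le, Rinv_0_lt_compat; lra].
      + apply Rmult_le_compat_r; [apply Rlt_le, Rinv_0_lt_compat; lra|nra]. }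
  assert (HsT : forall k, s < T k).
  { intros k; destruct (Rlt_dec s (T k)) as [H|H]; [easy|exfalso].
    assert (HTk := HT k). assert (A := Eu k (T k) ltac:(lra)). rewrite HuT in A.
    assert (B := Hdp k (T k) ltac:(lra) ltac:(lra)). fold (F k) in A.
    assert (C := Hep k). lra. }
  exists (s / 2), (Rmin (1 / 2) (eta0 / 2)). split; [lra|]. split; [apply Rmin_pos; lra|].
  intros k; assert (Hsk := HsT k). split; [lra|]. intros t Ht; split.
  - eapply Rle_trans; [apply Rmin_l|]. rewrite Eu by lra. fold (F k).
    assert (B := Hdp k t ltac:(lra) ltac:(lra)). lra.
  - eapply Rle_trans; [apply Rmin_r|]. rewrite Ev by lra. fold (G k).
    assert (B := Hdq k t ltac:(lra) ltac:(lra)). assert (C := Het k). lra.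
Qed.

(** By [drop_lower_tail], u and v still fall by a definite amount between a and b. Being nonnegative
    at b <= T k, they are at least that amount on [0, a]. *)
Lemma interior_positivity r r' : 0 <= r < r' -> exists c, 0 < c /\
  forall k, r' <= T k -> forall t, 0 <= t <= r -> c <= u k t /\ c <= v k t.
Proof.
  intros Hr. assert (HN := INR_S_gt0 n).
  destruct early_positivity as [t0 [c0 [Ht0 [Hc0 HE]]]].
  (* Passing to maxima covers the case r < t0; b <= T k persists because 2 t0 < T k for every k. *)
  set (a := Rmax r t0). set (b := Rmax r' (2 * t0)).
  assert (Ha1 : r <= a) by apply Rmax_l. assert (Ha2 : t0 <= a) by apply Rmax_r.
  assert (Hb1 : r' <= b) by apply Rmax_l. assert (Hb2 : 2 * t0 <= b) by apply Rmax_r.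
  assert (Hab : a < b) by (apply Rmax_lub_lt; lra).
  assert (Hpb : 0 < b ^ n) by (apply pow_lt; lra).
  assert (Hp0 : 0 < t0 ^ n) by (apply pow_lt; lra).
  assert (Hcd : forall e, 0 < abs_pow c0 e * t0 / INR (S n) * t0 ^ n / b ^ n).
  { intros e. assert (Hx := abs_pow_gt0 c0 e Hc0).
    apply Rdiv_lt_0_compat; [|easy]. apply Rmult_lt_0_compat; [|easy].
    apply Rdiv_lt_0_compat; [nra|easy]. }
  set (K1 := abs_pow (abs_pow c0 delta * t0 / INR (S n) * t0 ^ n / b ^ n) (1 / (p - 1)) * (b - a)).
  set (K2 := abs_pow (abs_pow c0 mu * t0 / INR (S n) * t0 ^ n / b ^ n) (1 / (q - 1)) * (b - a)).
  assert (HK1 : 0 < K1) by (apply Rmult_lt_0_compat; [apply abs_pow_gt0, Hcd|lra]).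
  assert (HK2 : 0 < K2) by (apply Rmult_lt_0_compat; [apply abs_pow_gt0, Hcd|lra]).
  exists (Rmin K1 K2); split; [now apply Rmin_pos|].
  intros k HTk t Ht. destruct (HE k) as [HT2 Hc].
  assert (HbT : b <= T k) by (apply Rmax_lub; lra).
  assert (Hek := Hep k). split.
  - eapply Rle_trans; [apply Rmin_l|].
    assert (A := drop_lower_tail n p (F k) (abs_pow c0 delta) t0 a b Hp (limit_F_cont k)
      (abs_pow_ge0 _ _) ltac:(lra) ltac:(lra) ltac:(intros; apply abs_pow_ge0)
      ltac:(intros s Hs; apply abs_pow_le; [lra|]; destruct (Hc s Hs); lra)).
    fold K1 in A. assert (B := drop_nondecr n p (F k) t a Hp (limit_F_cont k) ltac:(lra)).
    assert (C := Hub k b ltac:(lra)). rewrite Eu in C by lra. rewrite Eu by lra.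
    fold (F k) in *. lra.
  - eapply Rle_trans; [apply Rmin_r|].
    assert (A := drop_lower_tail n q (G k) (abs_pow c0 mu) t0 a b Hq (limit_G_cont k)
      (abs_pow_ge0 _ _) ltac:(lra) ltac:(lra) ltac:(intros; apply abs_pow_ge0)
      ltac:(intros s Hs; apply abs_pow_le; [lra|]; destruct (Hc s Hs); lra)).
    fold K2 in A. assert (B := drop_nondecr n q (G k) t a Hq (limit_G_cont k) ltac:(lra)).
    assert (C := Hvb k b ltac:(lra)). rewrite Ev in C by lra. rewrite Ev by lra.
    fold (G k) in *. lra.
Qed.

Lemma limit_lipschitz X : 0 <= X -> exists K, 0 <= K /\ forall k x y,
  0 <= x <= X -> x <= T k -> 0 <= y <= X -> y <= T k ->
  Rabs (u k x - u k y) <= K * Rabs (x - y) /\ Rabs (v k x - v k y) <= K * Rabs (x - y).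
Proof.
  intros HX. assert (HN := INR_S_gt0 n).
  set (Kp := abs_pow (abs_pow eta1 delta * X / INR (S n)) (1 / (p - 1))).
  set (Kq := abs_pow (abs_pow eta1 mu * X / INR (S n)) (1 / (q - 1))).
  assert (HKp : 0 <= Kp) by apply abs_pow_ge0. assert (HKq : 0 <= Kq) by apply abs_pow_ge0.
  exists (Kp + Kq); split; [lra|]. intros k x y Hx HxT Hy HyT.
  assert (HTk := HT k). set (Z := Rmin X (T k)).
  assert (HZ : 0 <= Z) by (apply Rmin_glb; lra).
  assert (HZ1 : Z <= X) by apply Rmin_l. assert (HZ2 : Z <= T k) by apply Rmin_r.
  assert (HxZ : x <= Z) by (apply Rmin_glb; lra).
  assert (HyZ : y <= Z) by (apply Rmin_glb; lra).
  assert (Hpos := Rabs_pos (x - y)).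
  assert (Hmono : forall C e, 0 <= C -> 0 < e ->
    abs_pow (C * Z / INR (S n)) e <= abs_pow (C * X / INR (S n)) e).
  { intros C e HC He. apply abs_pow_le; [lra|]. split.
    - apply Rmult_le_pos; [nra|apply Rlt_le, Rinv_0_lt_compat; lra].
    - apply Rmult_le_compat_r; [apply Rlt_le, Rinv_0_lt_compat; lra|nra]. }
  split.
  - rewrite !Eu by lra. fold (F k).
    replace (1 - drop n p (F k) x - (1 - drop n p (F k) y))
      with (- (drop n p (F k) x - drop n p (F k) y)) by ring. rewrite Rabs_Ropp.
    eapply Rle_trans; [apply (drop_lipschitz n p (F k) (abs_pow eta1 delta) Z)|].
    all: try assumption; try apply limit_F_cont; try apply abs_pow_ge0.
    + intros t Ht; apply limit_F_bound; lra.
    + apply Rmult_le_compat_r; [easy|].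
      assert (B := Hmono (abs_pow eta1 delta) (1 / (p - 1)) (abs_pow_ge0 _ _)
        ltac:(apply Rdiv_lt_0_compat; lra)). fold Kp in B. lra.
  - rewrite !Ev by lra. fold (G k).
    replace (et k - drop n q (G k) x - (et k - drop n q (G k) y))
      with (- (drop n q (G k) x - drop n q (G k) y)) by ring. rewrite Rabs_Ropp.
    eapply Rle_trans; [apply (drop_lipschitz n q (G k) (abs_pow eta1 mu) Z)|].
    all: try assumption; try apply limit_G_cont; try apply abs_pow_ge0.
    + intros t Ht; apply limit_G_bound; lra.
    + apply Rmult_le_compat_r; [easy|].
      assert (B := Hmono (abs_pow eta1 mu) (1 / (q - 1)) (abs_pow_ge0 _ _)
        ltac:(apply Rdiv_lt_0_compat; lra)). fold Kq in B. lra.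
Qed.

(** On [0, r] the solutions stay above a common c, where the true powers are Lipschitz and
    [stability] applies. Convergence of the numbers [et] alone thus gives uniform convergence of u
    and v, with no compactness argument for functions. *)
Lemma interior_cauchy r r' : 0 <= r < r' -> exists K, 0 <= K /\
  forall j k, r' <= T j -> r' <= T k -> forall t, 0 <= t <= r ->
    Rabs (u j t - u k t) <= K * Rabs (et j - et k) /\
    Rabs (v j t - v k t) <= K * Rabs (et j - et k).
Proof.
  intros Hr. destruct (interior_positivity r r' Hr) as [c [Hc Hpos]].
  destruct (Rle_dec c eta1) as [Hc1|Hc1].
  (* If c > eta1, no index satisfies r' <= T j and the claim is vacuous. *)
  2: { exists 0; split; [lra|]. intros j k Hj _ t Ht. exfalso.
       assert (A := proj1 (Hpos j Hj t Ht)). assert (B := Hub j t ltac:(lra)). lra. }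
  destruct (abs_pow_lipschitz delta c eta1 Hc Hc1) as [L1 [HL1 Lip1]].
  destruct (abs_pow_lipschitz mu c eta1 Hc Hc1) as [L2 [HL2 Lip2]].
  assert (P1 := abs_pow_gt0 c delta Hc). assert (P2 := abs_pow_gt0 c mu Hc).
  assert (Q1 := abs_pow_gt0 eta1 delta ltac:(lra)).
  assert (Q2 := abs_pow_gt0 eta1 mu ltac:(lra)).
  set (c' := Rmin (abs_pow c delta) (abs_pow c mu)).
  set (C' := abs_pow eta1 delta + abs_pow eta1 mu).
  assert (A1 : c' <= abs_pow c delta) by apply Rmin_l.
  assert (A2 : c' <= abs_pow c mu) by apply Rmin_r.
  assert (Hc' : 0 < c') by now apply Rmin_pos.
  assert (M1 := abs_pow_le c eta1 delta ltac:(lra) ltac:(lra)).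
  assert (HcC : 0 < c' <= C') by (unfold C'; lra).
  destruct (stability n p q c' C' (L1 + L2) r Hp Hq HcC ltac:(lra) ltac:(lra)) as [K [HK HS]].
  exists K; split; [easy|]. intros j k Hj Hk t Ht.
  assert (HF : forall i s, r' <= T i -> 0 <= s <= t -> c <= v i s <= eta1 /\ c' <= F i s <= C').
  { intros i s Hi Hs. assert (B1 := proj2 (Hpos i Hi s ltac:(lra))).
    assert (B2 := Hvb i s ltac:(lra)).
    assert (B3 := abs_pow_le c (v i s) delta ltac:(lra) ltac:(lra)).
    assert (B4 := abs_pow_le (v i s) eta1 delta ltac:(lra) ltac:(lra)).
    unfold F, C'; lra. }
  assert (HG : forall i s, r' <= T i -> 0 <= s <= t -> c <= u i s <= eta1 /\ c' <= G i s <= C').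
  { intros i s Hi Hs. assert (B1 := proj1 (Hpos i Hi s ltac:(lra))).
    assert (B2 := Hub i s ltac:(lra)).
    assert (B3 := abs_pow_le c (u i s) mu ltac:(lra) ltac:(lra)).
    assert (B4 := abs_pow_le (u i s) eta1 mu ltac:(lra) ltac:(lra)).
    unfold G, C'; lra. }
  apply (HS (F j) (F k) (G j) (G k) _ _ _ _ 1 (et j) (et k) t);
    try apply limit_F_cont; try apply limit_G_cont; try apply cv; try lra.
  - intros s Hs; split; apply Eu; lra.
  - intros s Hs; split; apply Ev; lra.
  - intros s Hs. destruct (HF j s Hj Hs) as [B1 B2], (HF k s Hk Hs) as [B3 B4].
    split; [easy|split; [easy|]]. eapply Rle_trans; [now apply Lip1|].
    apply Rmult_le_compat_r; [apply Rabs_pos|lra].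
  - intros s Hs. destruct (HG j s Hj Hs) as [B1 B2], (HG k s Hk Hs) as [B3 B4].
    split; [easy|split; [easy|]]. eapply Rle_trans; [now apply Lip2|].
    apply Rmult_le_compat_r; [apply Rabs_pos|lra].
Qed.

Variable eta : R.
Hypothesis Heta : is_lim_seq et eta.

(** Nothing is assumed about u k and v k outside [0, T k]. Freezing them at their end values keeps
    the Lipschitz bounds uniform in k and gives limits defined on the whole line. *)
Definition clamp (k : nat) (r : R) : R := Rmax 0 (Rmin r (T k)).

Lemma clamp_range k r : 0 <= clamp k r <= T k.
Proof.
  unfold clamp; split; [apply Rmax_l|]. apply Rmax_lub; [apply Rlt_le, HT|apply Rmin_r].
Qed.

Lemma clamp_lipschitz k x y : Rabs (clamp k x - clamp k y) <= Rabs (x - y).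
Proof.
  unfold clamp. assert (H : Rabs (Rmin x (T k) - Rmin y (T k)) <= Rabs (x - y)).
  { unfold Rmin; destruct (Rle_dec x (T k)), (Rle_dec y (T k));
      unfold Rabs; repeat destruct Rcase_abs; lra. }
  eapply Rle_trans; [|apply H].
  generalize (Rmin x (T k)), (Rmin y (T k)); intros a b. unfold Rmax.
  destruct (Rle_dec 0 a), (Rle_dec 0 b); unfold Rabs; repeat destruct Rcase_abs; lra.
Qed.

Lemma clamp_id k r : 0 <= r <= T k -> clamp k r = r.
Proof. intros H; unfold clamp; rewrite Rmin_left, Rmax_right; lra. Qed.

Definition limit_u (r : R) : R := real (Lim_seq (fun k => u k (clamp k r))).
Definition limit_v (r : R) : R := real (Lim_seq (fun k => v k (clamp k r))).

(** Membership in the half-open limit of the intervals [0, T k), with the uniform gap up to r' that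
    [interior_positivity] requires. *)
Definition interior (r : R) : Prop :=
  0 <= r /\ exists r', r < r' /\ exists k0, forall k, (k0 <= k)%nat -> r' <= T k.

Lemma et_cauchy (e : posreal) : exists k0, forall j k, (k0 <= j)%nat -> (k0 <= k)%nat ->
  Rabs (et j - et k) < e.
Proof.
  assert (H : ex_finite_lim_seq et) by (now exists eta).
  apply ex_lim_seq_cauchy_corr in H. exact (H e).
Qed.

Lemma interior_limit r : interior r ->
  is_lim_seq (fun k => u k (clamp k r)) (limit_u r) /\
  is_lim_seq (fun k => v k (clamp k r)) (limit_v r).
Proof.
  intros [Hr [r' [Hr' [k0 Hk0]]]].
  destruct (interior_cauchy r r' ltac:(lra)) as [K [HK HC]].
  split; apply Lim_seq_correct', ex_lim_seq_cauchy_corr; intros e.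
  all: assert (He : 0 < e / (K + 1)) by (apply Rdiv_lt_0_compat; [apply cond_pos|lra]).
  all: destruct (et_cauchy (mkposreal _ He)) as [k1 Hk1]; simpl in Hk1.
  all: exists (max k0 k1); intros j k Hj Hk.
  all: assert (Tj := Hk0 j ltac:(lia)); assert (Tk := Hk0 k ltac:(lia)).
  all: rewrite !clamp_id by lra.
  all: specialize (Hk1 j k ltac:(lia) ltac:(lia)); apply (Rlt_div_r _ e (K + 1)) in Hk1; [|lra].
  all: assert (Hpos := Rabs_pos (et j - et k)).
  all: destruct (HC j k Tj Tk r ltac:(lra)); nra.
Qed.

Lemma interior_positive_limit r : interior r ->
  0 < limit_u r /\ 0 < limit_v r.
Proof.
  intros Hi. destruct (interior_limit r Hi) as [Lu Lv].
  destruct Hi as [Hr [r' [Hr' [k0 Hk0]]]].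
  destruct (interior_positivity r r' ltac:(lra)) as [c [Hc HP]].
  assert (Bu : c <= limit_u r <= eta1).
  { apply (is_lim_seq_between _ _ _ _ Lu). exists k0; intros k Hk.
    specialize (Hk0 k Hk). rewrite clamp_id by lra.
    split; [apply (HP k); lra|apply Hub; lra]. }
  assert (Bv : c <= limit_v r <= eta1).
  { apply (is_lim_seq_between _ _ _ _ Lv). exists k0; intros k Hk.
    specialize (Hk0 k Hk). rewrite clamp_id by lra.
    split; [apply (HP k); lra|apply Hvb; lra]. }
  lra.
Qed.

Lemma interior_le r t : interior r -> 0 <= t <= r -> interior t.
Proof.
  intros [Hr [r' [Hr' HI]]] Ht. split; [lra|]. exists r'; split; [lra|easy].
Qed.

Lemma interior_0 : interior 0.
Proof.
  destruct early_positivity as [t0 [c0 [Ht0 [Hc0 HE]]]].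
  split; [lra|]. exists (2 * t0); split; [lra|]. exists O; intros k _.
  apply Rlt_le, HE.
Qed.

Definition limits_exist : Prop := forall r,
  is_lim_seq (fun k => u k (clamp k r)) (limit_u r) /\
  is_lim_seq (fun k => v k (clamp k r)) (limit_v r).

Lemma limit_nonpos r : r < 0 ->
  is_lim_seq (fun k => u k (clamp k r)) (limit_u r) /\
  is_lim_seq (fun k => v k (clamp k r)) (limit_v r).
Proof.
  intros Hr.
  assert (Hc : forall k, clamp k r = clamp k 0).
  { intros k; assert (H := HT k). unfold clamp.
    rewrite !Rmin_left, !Rmax_left; lra. }
  destruct (interior_limit 0 interior_0) as [Lu Lv].
  split; apply Lim_seq_correct'.
  - exists (limit_u 0). apply is_lim_seq_ext with (fun k => u k (clamp k 0)); [|easy].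
    intros k; now rewrite Hc.
  - exists (limit_v 0). apply is_lim_seq_ext with (fun k => v k (clamp k 0)); [|easy].
    intros k; now rewrite Hc.
Qed.

(** The constants of [limit_lipschitz] do not depend on k, and [clamp] does not increase distances,
    so the local Lipschitz bounds survive the pointwise limit. *)
Lemma limit_cont : limits_exist -> cont limit_u /\ cont limit_v.
Proof.
  intros HL.
  assert (Hlip : forall X, 0 <= X -> exists K, forall x y, x <= X -> y <= X ->
    Rabs (limit_u x - limit_u y) <= K * Rabs (x - y) /\
    Rabs (limit_v x - limit_v y) <= K * Rabs (x - y)).
  { intros X HX. destruct (limit_lipschitz X HX) as [K [HK HLip]].
    exists K; intros x y Hx Hy.
    assert (Hcl : forall k z, z <= X -> 0 <= clamp k z <= X).
    { intros k z Hz; split; [apply clamp_range|]. unfold clamp.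
      apply Rmax_lub; [easy|]. eapply Rle_trans; [apply Rmin_l|easy]. }
    assert (Hk : forall k, Rabs (u k (clamp k x) - u k (clamp k y)) <= K * Rabs (x - y) /\
      Rabs (v k (clamp k x) - v k (clamp k y)) <= K * Rabs (x - y)).
    { intros k. destruct (HLip k (clamp k x) (clamp k y)) as [B1 B2];
        try apply clamp_range; try now apply Hcl.
      assert (B3 := clamp_lipschitz k x y).
      split; (eapply Rle_trans; [eassumption|]); now apply Rmult_le_compat_l. }
    destruct (HL x) as [Ux Vx], (HL y) as [Uy Vy]. split.
    - rewrite <- (Rminus_0_r (limit_u x - limit_u y)).
      apply (is_lim_seq_Rabs_le (fun k => u k (clamp k x) - u k (clamp k y))).
      + now apply is_lim_seq_minus'.
      + exists O; intros k _; rewrite Rminus_0_r; apply Hk.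
    - rewrite <- (Rminus_0_r (limit_v x - limit_v y)).
      apply (is_lim_seq_Rabs_le (fun k => v k (clamp k x) - v k (clamp k y))).
      + now apply is_lim_seq_minus'.
      + exists O; intros k _; rewrite Rminus_0_r; apply Hk. }
  split; apply cont_lipschitz; intros X HX; destruct (Hlip X HX) as [K HK];
    exists K; intros x y Hx Hy; now apply HK.
Qed.

Lemma limits_exist_infinite : (forall r, interior (Rabs r)) -> limits_exist.
Proof.
  intros Hall r. destruct (Rle_dec 0 r) as [Hr|Hr].
  - apply interior_limit. rewrite <- (Rabs_pos_eq r Hr). apply Hall.
  - apply limit_nonpos; lra.
Qed.

(** For r >= Tl the clamped radius is within |T k - Tl| of T k, where u k and v k equal [ep k]; the
    uniform Lipschitz bound does the rest. *)
Lemma limit_beyond (Tl r : R) : is_lim_seq T Tl -> Tl <= r ->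
  is_lim_seq (fun k => u k (clamp k r)) 0 /\ is_lim_seq (fun k => v k (clamp k r)) 0.
Proof.
  intros HTl Hr.
  assert (HTl0 : 0 <= Tl).
  { destruct (is_lim_seq_between (fun k => - T k) (- Tl) (- Tl - 1) 0) as [_ H]; [| |lra].
    - exact (proj1 (is_lim_seq_opp T Tl) HTl).
    - apply is_lim_seq_spec in HTl. destruct (HTl (mkposreal 1 Rlt_0_1)) as [k0 Hk0].
      exists k0; intros k Hk; specialize (Hk0 k Hk); simpl in Hk0.
      apply Rabs_def2 in Hk0. assert (H := HT k). lra. }
  destruct (limit_lipschitz (Tl + 1) ltac:(lra)) as [K [HK HLip]].
  assert (Hclose : exists k0, forall k, (k0 <= k)%nat ->
    Rabs (u k (clamp k r) - 0) <= ep k + K * Rabs (T k - Tl) /\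
    Rabs (v k (clamp k r) - 0) <= ep k + K * Rabs (T k - Tl)).
  { apply is_lim_seq_spec in HTl. destruct (HTl (mkposreal 1 Rlt_0_1)) as [k0 Hk0].
    exists k0; intros k Hk; specialize (Hk0 k Hk); simpl in Hk0. apply Rabs_def2 in Hk0.
    assert (Hcl := clamp_range k r). assert (HTk := HT k). assert (He := Hep k).
    destruct (HLip k (clamp k r) (T k)) as [B1 B2]; try lra.
    assert (B3 : Rabs (clamp k r - T k) <= Rabs (T k - Tl)).
    { unfold clamp, Rmax, Rmin. destruct (Rle_dec r (T k)) as [H|H].
      - destruct (Rle_dec 0 r); unfold Rabs; repeat destruct Rcase_abs; lra.
      - destruct (Rle_dec 0 (T k)); [|lra]. rewrite Rminus_diag, Rabs_R0. apply Rabs_pos. }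
    apply (Rmult_le_compat_l K) in B3; [|easy].
    rewrite !Rminus_0_r. rewrite HuT in B1. rewrite HvT in B2.
    assert (A1 := Rabs_triang (u k (clamp k r) - ep k) (ep k)).
    assert (A2 := Rabs_triang (v k (clamp k r) - ep k) (ep k)).
    rewrite (Rabs_pos_eq (ep k)) in A1, A2 by lra.
    replace (u k (clamp k r) - ep k + ep k) with (u k (clamp k r)) in A1 by ring.
    replace (v k (clamp k r) - ep k + ep k) with (v k (clamp k r)) in A2 by ring. lra. }
  assert (Hz : is_lim_seq (fun k => ep k + K * Rabs (T k - Tl)) 0).
  { replace (Finite 0) with (Finite (0 + K * 0)) by (f_equal; ring).
    apply is_lim_seq_plus'; [easy|].
    replace (Finite (K * 0)) with (Rbar_mult K 0) by easy. apply is_lim_seq_scal_l.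
    rewrite <- Rabs_R0. apply (is_lim_seq_abs (fun k => T k - Tl) 0).
    replace (Finite 0) with (Finite (Tl - Tl)) by (f_equal; ring).
    apply is_lim_seq_minus'; [easy|apply is_lim_seq_const]. }
  destruct Hclose as [k0 Hk0].
  split; refine (is_lim_seq_dominated _ _ _ _ Hz); exists k0; intros k Hk; now apply Hk0.
Qed.

Lemma interior_below (Tl r : R) : is_lim_seq T Tl -> 0 <= r < Tl -> interior r.
Proof.
  intros HTl Hr. split; [lra|]. exists ((r + Tl) / 2); split; [lra|].
  apply is_lim_seq_spec in HTl.
  assert (He : 0 < (Tl - r) / 2) by lra.
  destruct (HTl (mkposreal _ He)) as [k0 Hk0].
  exists k0; intros k Hk; specialize (Hk0 k Hk); simpl in Hk0.
  apply Rabs_def2 in Hk0; lra.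
Qed.

Lemma limits_exist_finite (Tl : R) : is_lim_seq T Tl -> limits_exist.
Proof.
  intros HTl r. destruct (Rle_dec Tl r) as [H|H].
  - destruct (limit_beyond Tl r HTl H) as [A B].
    split; apply Lim_seq_correct'; eexists; eassumption.
  - destruct (Rle_dec 0 r) as [Hr|Hr].
    + apply interior_limit, (interior_below Tl); [easy|lra].
    + apply limit_nonpos; lra.
Qed.

Lemma limit_end (Tl : R) : is_lim_seq T Tl -> limit_u Tl = 0 /\ limit_v Tl = 0.
Proof.
  intros HTl. destruct (limit_beyond Tl Tl HTl ltac:(lra)) as [A B].
  apply is_lim_seq_unique in A. apply is_lim_seq_unique in B.
  unfold limit_u, limit_v. now rewrite A, B.
Qed.

Hypothesis cul : cont limit_u.
Hypothesis cvl : cont limit_v.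

(** Passage to the limit under the integral, obtained from the Lipschitz estimate [drop_contraction]
    with weight lam = 1. *)
Lemma drop_pow_limit m a (w : nat -> R -> R) (wl : R -> R) r c C K k0 :
  1 < m -> 0 < a -> 0 < c <= C -> 0 <= K -> 0 <= r -> (forall k, cont (w k)) -> cont wl ->
  (forall k t, (k0 <= k)%nat -> 0 <= t <= r -> c <= w k t <= C) ->
  (forall t, 0 <= t <= r -> c <= wl t <= C) ->
  (forall k t, (k0 <= k)%nat -> 0 <= t <= r -> Rabs (w k t - wl t) <= K * Rabs (et k - eta)) ->
  is_lim_seq (fun k => drop n m (fun t => abs_pow (w k t) a) r)
    (drop n m (fun t => abs_pow (wl t) a) r).
Proof.
  intros Hm' Ha Hc HK Hr cw cwl Bw Bwl Hdist.
  destruct (abs_pow_lipschitz a c C (proj1 Hc) (proj2 Hc)) as [L [HL Lip]].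
  assert (P1 := abs_pow_gt0 c a (proj1 Hc)).
  assert (P2 := abs_pow_le c C a ltac:(lra) ltac:(lra)).
  destruct (drop_contraction n m (abs_pow c a) (abs_pow C a) r Hm' (conj P1 P2) Hr)
    as [M [HM HD]].
  assert (cpow : cont (fun t => abs_pow t a)) by (intros x; now apply abs_pow_continuous).
  apply (is_lim_seq_dominated _ _ (fun k => M / 1 * (L * (K * Rabs (et k - eta)) * exp (1 * r)))).
  - exists k0; intros k Hk.
    assert (Hpos := Rabs_pos (et k - eta)).
    assert (HKp : 0 <= K * Rabs (et k - eta)) by nra.
    apply (HD 1 (fun t => abs_pow (w k t) a) (fun t => abs_pow (wl t) a)
      (L * (K * Rabs (et k - eta))) r).
    + apply (cont_comp (fun t => abs_pow t a) (w k)); [easy|apply cw].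
    + now apply (cont_comp (fun t => abs_pow t a) wl).
    + lra.
    + nra.
    + lra.
    + intros t Ht. assert (B1 := Bw k t Hk Ht). assert (B2 := Bwl t Ht).
      repeat split; try (apply abs_pow_le; lra).
      eapply Rle_trans; [now apply Lip|].
      assert (B3 := Hdist k t Hk Ht).
      assert (He : 1 <= exp (1 * t)) by (apply exp_ge_1; lra).
      apply Rle_trans with (L * (K * Rabs (et k - eta))); [now apply Rmult_le_compat_l|].
      assert (0 <= L * (K * Rabs (et k - eta))) by nra. nra.
  - assert (E0 : is_lim_seq (fun k => Rabs (et k - eta)) 0).
    { rewrite <- Rabs_R0. apply (is_lim_seq_abs (fun k => et k - eta) 0).
      replace (Finite 0) with (Finite (eta - eta)) by (f_equal; ring).
      apply is_lim_seq_minus'; [easy|apply is_lim_seq_const]. }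
    apply is_lim_seq_ext with (fun k => (M / 1 * (L * K) * exp (1 * r)) * Rabs (et k - eta)).
    + intros; field.
    + replace (Finite 0) with (Rbar_mult (M / 1 * (L * K) * exp (1 * r)) 0)
        by (simpl; now rewrite Rmult_0_r).
      now apply is_lim_seq_scal_l.
Qed.

Lemma interior_equation r : interior r ->
  limit_u r = 1 - drop n p (fun s => abs_pow (limit_v s) delta) r /\
  limit_v r = eta - drop n q (fun s => abs_pow (limit_u s) mu) r.
Proof.
  intros Hi. destruct (interior_limit r Hi) as [Lu Lv].
  assert (Hi' := Hi). destruct Hi' as [Hr [r' [Hr' [k0 Hk0]]]].
  destruct (interior_positivity r r' ltac:(lra)) as [c [Hc HP]].
  destruct (interior_cauchy r r' ltac:(lra)) as [K [HK HC]].
  assert (HTk0 := Hk0 k0 (le_n _)).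
  assert (Hc1 : 0 < c <= eta1).
  { split; [easy|]. assert (A := proj1 (HP k0 HTk0 r ltac:(lra))).
    assert (B := Hub k0 r ltac:(lra)). lra. }
  assert (Bu : forall k t, (k0 <= k)%nat -> 0 <= t <= r -> c <= u k t <= eta1).
  { intros k t Hk Ht; specialize (Hk0 k Hk). split; [apply (HP k); lra|apply Hub; lra]. }
  assert (Bv : forall k t, (k0 <= k)%nat -> 0 <= t <= r -> c <= v k t <= eta1).
  { intros k t Hk Ht; specialize (Hk0 k Hk). split; [apply (HP k); lra|apply Hvb; lra]. }
  assert (LU : forall t, 0 <= t <= r -> is_lim_seq (fun k => u k t) (limit_u t)).
  { intros t Ht. destruct (interior_limit t (interior_le r t Hi Ht)) as [A _].
    apply (is_lim_seq_ext_loc _ (fun k => u k t)) in A; [easy|].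
    exists k0; intros k Hk; specialize (Hk0 k Hk). now rewrite clamp_id by lra. }
  assert (LV : forall t, 0 <= t <= r -> is_lim_seq (fun k => v k t) (limit_v t)).
  { intros t Ht. destruct (interior_limit t (interior_le r t Hi Ht)) as [_ A].
    apply (is_lim_seq_ext_loc _ (fun k => v k t)) in A; [easy|].
    exists k0; intros k Hk; specialize (Hk0 k Hk). now rewrite clamp_id by lra. }
  (* Letting j tend to infinity in [interior_cauchy] gives a distance to the limit that is uniform
     in t, as [drop_pow_limit] requires. *)
  assert (Ez : forall k, is_lim_seq (fun j => K * Rabs (et j - et k)) (K * Rabs (et k - eta))).
  { intros k. replace (Finite (K * Rabs (et k - eta))) with (Rbar_mult K (Rabs (eta - et k)))
      by (simpl; now rewrite Rabs_minus_sym).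
    apply is_lim_seq_scal_l. apply (is_lim_seq_abs (fun j => et j - et k) (eta - et k)).
    apply is_lim_seq_minus'; [easy|apply is_lim_seq_const]. }
  assert (DU : forall k t, (k0 <= k)%nat -> 0 <= t <= r ->
    Rabs (u k t - limit_u t) <= K * Rabs (et k - eta)).
  { intros k t Hk Ht. rewrite Rabs_minus_sym.
    apply (Rabs_diff_le_limit (fun j => u j t) _ _ _ _ (LU t Ht) (Ez k)).
    exists k0; intros j Hj. now apply HC; try apply Hk0. }
  assert (DV : forall k t, (k0 <= k)%nat -> 0 <= t <= r ->
    Rabs (v k t - limit_v t) <= K * Rabs (et k - eta)).
  { intros k t Hk Ht. rewrite Rabs_minus_sym.
    apply (Rabs_diff_le_limit (fun j => v j t) _ _ _ _ (LV t Ht) (Ez k)).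
    exists k0; intros j Hj. now apply HC; try apply Hk0. }
  assert (BU : forall t, 0 <= t <= r -> c <= limit_u t <= eta1).
  { intros t Ht. apply (is_lim_seq_between _ _ _ _ (LU t Ht)).
    exists k0; intros k Hk; now apply Bu. }
  assert (BV : forall t, 0 <= t <= r -> c <= limit_v t <= eta1).
  { intros t Ht. apply (is_lim_seq_between _ _ _ _ (LV t Ht)).
    exists k0; intros k Hk; now apply Bv. }
  assert (Hrr : 0 <= r <= r) by lra.
  assert (KU := drop_pow_limit p delta v limit_v r c eta1 K k0 Hp Hd Hc1 HK Hr cv cvl Bv BV DV).
  assert (KV := drop_pow_limit q mu u limit_u r c eta1 K k0 Hq Hm Hc1 HK Hr cu cul Bu BU DU).
  split.
  - assert (A : is_lim_seq (fun k => 1 - drop n p (fun t => abs_pow (v k t) delta) r)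
      (1 - drop n p (fun t => abs_pow (limit_v t) delta) r)).
    { apply is_lim_seq_minus'; [apply is_lim_seq_const|easy]. }
    assert (B := LU r Hrr).
    apply (is_lim_seq_ext_loc _ (fun k => 1 - drop n p (fun t => abs_pow (v k t) delta) r)) in B.
    + apply is_lim_seq_unique in A; apply is_lim_seq_unique in B.
      rewrite A in B; injection B; lra.
    + exists k0; intros k Hk. specialize (Hk0 k Hk). apply Eu; lra.
  - assert (A : is_lim_seq (fun k => et k - drop n q (fun t => abs_pow (u k t) mu) r)
      (eta - drop n q (fun t => abs_pow (limit_u t) mu) r)).
    { now apply is_lim_seq_minus'. }
    assert (B := LV r Hrr).
    apply (is_lim_seq_ext_loc _ (fun k => et k - drop n q (fun t => abs_pow (u k t) mu) r)) in B.
    + apply is_lim_seq_unique in A; apply is_lim_seq_unique in B.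
      rewrite A in B; injection B; lra.
    + exists k0; intros k Hk. specialize (Hk0 k Hk). apply Ev; lra.
Qed.

End Limit.

(** Carries the integral equations to the end radius, where u and v vanish and the interior
    estimates are no longer available. *)
Lemma continuous_zero_end (f : R -> R) a : cont f -> 0 < a ->
  (forall t, 0 <= t < a -> f t = 0) -> f a = 0.
Proof.
  intros cf Ha Hz. destruct (Req_dec (f a) 0) as [H|H]; [easy|exfalso].
  assert (Hc := cf a). apply continuity_pt_filterlim in Hc.
  destruct (Hc (Rabs (f a)) (Rabs_pos_lt _ H)) as [d [Hd HD]].
  set (t := Rmax 0 (a - d / 2)).
  assert (T1 : 0 <= t < a) by (unfold t; split; [apply Rmax_l|apply Rmax_lub_lt; lra]).
  assert (T2 : a - d / 2 <= t) by apply Rmax_r.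
  assert (B : Rabs (f t - f a) < Rabs (f a)).
  { apply HD. split; [split; [exact I|lra]|]. simpl; unfold R_dist.
    rewrite Rabs_minus_sym, Rabs_pos_eq; lra. }
  rewrite (Hz t T1) in B. rewrite Rminus_0_l, Rabs_Ropp in B. lra.
Qed.

Definition ground_state n p q delta mu : Prop :=
  exists eta (u v : R -> R), cont u /\ cont v /\ forall r, 0 <= r ->
    0 < u r /\ 0 < v r /\
    u r = 1 - drop n p (fun s => abs_pow (v s) delta) r /\
    v r = eta - drop n q (fun s => abs_pow (u s) mu) r.

Definition ball_solution n p q delta mu : Prop :=
  exists T eta (u v : R -> R), 0 < T /\ cont u /\ cont v /\ u T = 0 /\ v T = 0 /\
    (forall r, 0 <= r < T -> 0 < u r /\ 0 < v r) /\
    forall r, 0 <= r <= T ->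
      u r = 1 - drop n p (fun s => abs_pow (v s) delta) r /\
      v r = eta - drop n q (fun s => abs_pow (u s) mu) r.

Lemma ground_state_or_ball_solution n p q delta mu :
  1 < p -> 1 < q -> 0 < delta -> 0 < mu ->
  ground_state n p q delta mu \/ ball_solution n p q delta mu.
Proof.
  intros Hp Hq Hd Hm.
  destruct (shooting n p q delta mu Hp Hq Hd Hm) as [eta0 [eta1 [H0 [H1 Hsh]]]].
  set (e0 := Rmin eta0 (1 / 2) / 2).
  assert (He0 : 0 < e0) by (apply Rdiv_lt_0_compat; [apply Rmin_pos|]; lra).
  assert (He1 : e0 < eta0)
    by (unfold e0; assert (H := Rmin_l eta0 (1 / 2)); unfold e0 in He0; lra).
  assert (He2 : e0 < 1 / 2)
    by (unfold e0; assert (H := Rmin_r eta0 (1 / 2)); unfold e0 in He0; lra).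
  assert (Hepk : forall k, 0 < e0 / (INR k + 1) <= e0).
  { intros k; assert (Hk := pos_INR k). split; [apply Rdiv_lt_0_compat; lra|].
    apply Rle_div_l; [lra|nra]. }
  destruct (choose_sequence (fun k (x : R * R * (R -> R) * (R -> R)) =>
    let '(et, T, u, v) := x in
    eta0 <= et <= eta1 /\ 0 < T /\ cont u /\ cont v /\
    u T = e0 / (INR k + 1) /\ v T = e0 / (INR k + 1) /\
    forall t, 0 <= t <= T -> e0 / (INR k + 1) <= u t <= eta1 /\ e0 / (INR k + 1) <= v t <= eta1 /\
      u t = 1 - drop n p (fun s => abs_pow (v s) delta) t /\
      v t = et - drop n q (fun s => abs_pow (u s) mu) t)) as [X HX].
  { intros k. destruct (Hsh (e0 / (INR k + 1))) as [et [T [u [v HS]]]];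
      [assert (H := Hepk k); lra|assert (H := Hepk k); lra|].
    exists (et, T, u, v); exact HS. }
  set (et := fun k => fst (fst (fst (X k)))). set (T := fun k => snd (fst (fst (X k)))).
  set (u := fun k => snd (fst (X k))). set (v := fun k => snd (X k)).
  assert (HX' : forall k, eta0 <= et k <= eta1 /\ 0 < T k /\ cont (u k) /\ cont (v k) /\
    u k (T k) = e0 / (INR k + 1) /\ v k (T k) = e0 / (INR k + 1) /\
    forall t, 0 <= t <= T k -> e0 / (INR k + 1) <= u k t <= eta1 /\
      e0 / (INR k + 1) <= v k t <= eta1 /\
      u k t = 1 - drop n p (fun s => abs_pow (v k s) delta) t /\
      v k t = et k - drop n q (fun s => abs_pow (u k s) mu) t).
  { intros k; specialize (HX k). unfold et, T, u, v.
    destruct (X k) as [[[a b] c] d]; exact HX. }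
  clearbody et T u v. clear X HX.
  assert (Hpre : exists t0, 0 < t0 /\ forall k, t0 < T k).
  { destruct (early_positivity n p q delta mu eta0 eta1 (fun k => e0 / (INR k + 1)) et T u v)
      as [t0 [c0 [Ht0 [_ HE]]]]; try easy; try (intros; now apply HX').
    - intros k; assert (H := Hepk k); lra.
    - exists t0; split; [easy|]. intros k; assert (H := proj1 (HE k)). lra. }
  destruct Hpre as [t0 [Ht0 HTt0]].
  destruct (bounded_subsequence et eta0 eta1) as [phi1 [Hphi1 [eta Heta]]];
    [intros; apply HX'|].
  (* The reciprocals of the radii lie in the compact interval [0, 1 / t0], so one extraction serves
     both alternatives: y = 0 means radii tending to infinity, y > 0 radii tending to 1 / y. *)
  destruct (bounded_subsequence (fun k => / T (phi1 k)) 0 (/ t0)) as [phi2 [Hphi2 [y Hy]]].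
  { intros k. assert (H := HTt0 (phi1 k)).
    split; [apply Rlt_le, Rinv_0_lt_compat; lra|apply Rinv_le_contravar; lra]. }
  set (phi := fun k => phi1 (phi2 k)).
  assert (Hphi : forall k, (k <= phi k)%nat).
  { intros k; unfold phi. specialize (Hphi1 (phi2 k)); specialize (Hphi2 k); lia. }
  assert (Heta' : is_lim_seq (fun k => et (phi k)) eta)
    by exact (is_lim_seq_subseq_ge _ _ phi2 Hphi2 Heta).
  assert (Hep' : is_lim_seq (fun k => e0 / (INR (phi k) + 1)) 0)
    by exact (is_lim_seq_subseq_ge _ _ phi Hphi (is_lim_seq_inv_S e0)).
  assert (Hy' : is_lim_seq (fun k => / T (phi k)) y) by exact Hy.
  clear Hy Heta. clearbody phi.
  set (ep := fun k => e0 / (INR (phi k) + 1)) in *.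
  assert (Hepb : forall k, 0 < ep k /\ ep k < 1 / 2).
  { intros k; unfold ep; assert (H := Hepk (phi k)); lra. }
  set (et' := fun k => et (phi k)) in *. set (T' := fun k => T (phi k)) in *.
  set (u' := fun k => u (phi k)) in *. set (v' := fun k => v (phi k)) in *.
  assert (A1 : forall k, eta0 <= et' k <= eta1) by (intros; apply HX').
  assert (A2 : forall k, 0 < T' k) by (intros; apply HX').
  assert (A3 : forall k, cont (u' k)) by (intros; apply HX').
  assert (A4 : forall k, cont (v' k)) by (intros; apply HX').
  assert (A5 : forall k, u' k (T' k) = ep k) by (intros; apply HX').
  assert (A6 : forall k, v' k (T' k) = ep k) by (intros; apply HX').
  assert (A7 : forall k t, 0 <= t <= T' k -> ep k <= u' k t <= eta1)
    by (intros; now apply HX').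
  assert (A8 : forall k t, 0 <= t <= T' k -> ep k <= v' k t <= eta1)
    by (intros; now apply HX').
  assert (A9 : forall k t, 0 <= t <= T' k ->
    u' k t = 1 - drop n p (fun s => abs_pow (v' k s) delta) t) by (intros; now apply HX').
  assert (A10 : forall k t, 0 <= t <= T' k ->
    v' k t = et' k - drop n q (fun s => abs_pow (u' k s) mu) t) by (intros; now apply HX').
  clear HX'. set (ul := limit_u T' u'). set (vl := limit_v T' v').
  assert (Hcont : limits_exist T' u' v' -> cont ul /\ cont vl)
    by (apply (limit_cont n p q delta mu eta1 ep et'); assumption).
  assert (Hpos : forall r, interior T' r -> 0 < ul r /\ 0 < vl r).
  { intros r Hr.
    exact (interior_positive_limit n p q delta mu eta0 eta1 ep et' T' u' v' Hp Hq Hd Hm H0 H1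
      Hepb A1 A2 A3 A4 A5 A7 A8 A9 A10 eta Heta' r Hr). }
  assert (Heq : cont ul -> cont vl -> forall r, interior T' r ->
    ul r = 1 - drop n p (fun s => abs_pow (vl s) delta) r /\
    vl r = eta - drop n q (fun s => abs_pow (ul s) mu) r).
  { intros cul cvl. exact (interior_equation n p q delta mu eta0 eta1 ep et' T' u' v' Hp Hq Hd Hm
      H0 H1 Hepb A1 A2 A3 A4 A5 A7 A8 A9 A10 eta Heta' cul cvl). }
  assert (Hy0 : 0 <= y).
  { assert (H : - y <= 0); [|lra].
    destruct (is_lim_seq_between (fun k => - / T' k) (- y) (- / t0) 0) as [_ H]; [| |easy].
    - exact (proj1 (is_lim_seq_opp (fun k => / T' k) y) Hy').
    - exists O; intros k _. assert (B := HTt0 (phi k)). fold (T' k) in B.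
      assert (/ T' k <= / t0) by (apply Rinv_le_contravar; lra).
      assert (0 < / T' k) by (apply Rinv_0_lt_compat; lra). lra. }
  destruct (Req_dec y 0) as [->|Hyn].
  - left.
    assert (Hint : forall r, 0 <= r -> interior T' r).
    { intros r Hr; split; [easy|]. exists (r + 1); split; [lra|].
      assert (Hr1 : 0 < / (r + 1)) by (apply Rinv_0_lt_compat; lra).
      apply is_lim_seq_spec in Hy'. destruct (Hy' (mkposreal _ Hr1)) as [k0 Hk0].
      exists k0; intros k Hk; specialize (Hk0 k Hk); simpl in Hk0.
      fold (T' k) in Hk0. rewrite Rminus_0_r in Hk0.
      assert (B : 0 < / T' k) by (apply Rinv_0_lt_compat, A2).
      rewrite Rabs_pos_eq in Hk0 by lra.
      apply Rlt_le, Rinv_lt_cancel; [apply A2|easy]. }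
    destruct Hcont as [cul cvl].
    { apply (limits_exist_infinite n p q delta mu eta0 eta1 ep et') with (eta := eta);
        try assumption.
      intros r; apply Hint, Rabs_pos. }
    exists eta, ul, vl. split; [exact cul|]. split; [exact cvl|].
    intros r Hr. destruct (Hpos r (Hint r Hr)) as [B1 B2].
    destruct (Heq cul cvl r (Hint r Hr)) as [B3 B4]. repeat split; assumption.
  - right. set (Tl := / y).
    assert (HTl : is_lim_seq T' Tl).
    { apply is_lim_seq_ext with (fun k => / / T' k); [intros; apply Rinv_inv|].
      apply (is_lim_seq_inv (fun k => / T' k) y); [exact Hy'|].
      intros H; injection H; exact Hyn. }
    assert (HTl0 : 0 < Tl) by (apply Rinv_0_lt_compat; lra).
    assert (Hint : forall r, 0 <= r < Tl -> interior T' r)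
      by (intros r Hr; now apply (interior_below T' Tl)).
    destruct Hcont as [cul cvl].
    { apply (limits_exist_finite n p q delta mu eta0 eta1 ep et') with (eta := eta) (Tl := Tl);
        assumption. }
    destruct (limit_end n p q delta mu eta1 ep et' T' u' v' ) with (Tl := Tl) as [E1 E2];
      try assumption.
    exists Tl, eta, ul, vl. split; [easy|]. split; [exact cul|]. split; [exact cvl|].
    split; [exact E1|]. split; [exact E2|]. split.
    { intros r Hr; apply Hpos, Hint, Hr. }
    assert (cpow : forall a, 0 < a -> cont (fun t => abs_pow t a))
      by (intros a Ha x; now apply abs_pow_continuous).
    intros r Hr. destruct (Req_dec r Tl) as [->|Hr'].
    2: { apply (Heq cul cvl), Hint; lra. }
    split; apply Rminus_diag_uniq.
    + apply (continuous_zero_end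
        (fun r => ul r - (1 - drop n p (fun s => abs_pow (vl s) delta) r)) Tl); [|easy|].
      * intros x. apply (continuous_minus ul); [apply cul|].
        apply cont_minus_drop; [easy|].
        exact (cont_comp (fun t => abs_pow t delta) vl (cpow delta Hd) cvl).
      * intros t Ht; apply Rminus_diag_eq, (Heq cul cvl), Hint, Ht.
    + apply (continuous_zero_end
        (fun r => vl r - (eta - drop n q (fun s => abs_pow (ul s) mu) r)) Tl); [|easy|].
      * intros x. apply (continuous_minus vl); [apply cvl|].
        apply cont_minus_drop; [easy|].
        exact (cont_comp (fun t => abs_pow t mu) ul (cpow mu Hm) cul).
      * intros t Ht; apply Rminus_diag_eq, (Heq cul cvl), Hint, Ht.
Qed.

(** * Scaling to a given radius *)

(** The profiles below have two-sided derivatives even at the ends of the domain; the required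
    one-sided limits are restrictions of these. *)
Lemma C1_on_of_derive (D : R -> Prop) (f f' : R -> R) :
  (forall x, D x -> is_derive f x (f' x) /\ continuous f' x) -> C1_on D f f'.
Proof.
  intros H x Dx; destruct (H x Dx) as [Hd Hc]; split.
  - apply is_derive_Reals, derivable_pt_lim_D_in in Hd.
    apply (limit1_imp _ (D_x no_cond x)); [|exact Hd].
    intros y [_ Hy]; split; [exact I|exact Hy].
  - apply continuity_pt_filterlim in Hc.
    apply (limit1_imp _ (D_x no_cond x)); [|exact Hc].
    intros y [_ Hy]; split; [exact I|exact Hy].
Qed.

Lemma abs_pow_succ x a : 0 <= x -> abs_pow x (a - 1) * x = abs_pow x a.
Proof.
  intros Hx; destruct (Req_dec x 0) as [->|Hx0]; [rewrite !abs_pow_0; ring|].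
  rewrite !abs_pow_pos by lra. rewrite <- (Rpower_1 x) at 2 by lra.
  rewrite <- Rpower_plus; f_equal; ring.
Qed.

Lemma mflux_opp m x : 0 <= x -> mflux m (- x) = - abs_pow x (m - 1).
Proof.
  intros Hx; unfold mflux; rewrite abs_pow_even.
  rewrite <- (abs_pow_succ x (m - 1)) by easy. replace (m - 1 - 1) with (m - 2) by ring. ring.
Qed.

Section Profile.

Variables (n : nat) (m a c lam : R) (h : R -> R).
Hypotheses (Hm : 1 < m) (Hc : 0 < c) (Hlam : 0 < lam) (ch : cont h).
Hypothesis Hflux : forall s, 0 < s -> 0 < flux n h s.

Definition profile (r : R) : R := c * (a - drop n m h (lam * r)).
Definition profile' (r : R) : R := - (c * lam * slope n m h (lam * r)).
(** For m > 2 the power of the flux has a negative exponent and is unbounded near the origin, which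
    is why second derivatives are taken on (0, Rad] only. *)
Definition slope' (s : R) : R :=
  1 / (m - 1) * Rpower (flux n h s) (1 / (m - 1) - 1) * (h s - INR n * flux n h s / s).
Definition profile'' (r : R) : R := - (c * lam * lam * slope' (lam * r)).

Lemma is_derive_scaled (f : R -> R) df r : is_derive f (lam * r) df ->
  is_derive (fun r => f (lam * r)) r (lam * df).
Proof.
  intros Hf. apply (is_derive_comp f (fun r => lam * r)); [exact Hf|].
  auto_derive; [easy|ring].
Qed.

Lemma continuous_scaled (f : R -> R) r : continuous f (lam * r) ->
  continuous (fun r => f (lam * r)) r.
Proof.
  intros Hf. apply (continuous_comp (fun r => lam * r) f); [|exact Hf].
  apply (ex_derive_continuous (fun r : R => lam * r)); auto_derive; easy.
Qed.

Lemma is_derive_slope s : 0 < s -> is_derive (slope n m h) s (slope' s).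
Proof.
  intros Hs. assert (Hf := Hflux s Hs).
  apply (is_derive_ext_loc (fun t => Rpower (flux n h t) (1 / (m - 1)))).
  - exists (mkposreal s Hs); intros y Hy.
    unfold ball in Hy; simpl in Hy; unfold AbsRing_ball, abs, minus, plus, opp in Hy.
    simpl in Hy. apply Rabs_def2 in Hy.
    unfold slope; rewrite abs_pow_pos; [easy|apply Hflux; lra].
  - replace (slope' s) with (Rpower (flux n h s) (1 / (m - 1))
      * (1 / (m - 1) * (h s - INR n * flux n h s / s) / flux n h s)).
    + apply is_derive_Rpower_comp; [easy|now apply is_derive_flux].
    + unfold slope'.
      assert (E : Rpower (flux n h s) (1 / (m - 1) - 1)
        = Rpower (flux n h s) (1 / (m - 1)) / flux n h s).
      { unfold Rminus at 1; rewrite Rpower_plus, Rpower_Ropp, Rpower_1 by easy. easy. }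
      rewrite E. field; lra.
Qed.

Lemma slope'_continuous s : 0 < s -> continuous slope' s.
Proof.
  intros Hs. assert (Hf := Hflux s Hs). assert (Df := is_derive_flux n h s ch Hs).
  apply (continuous_mult
    (fun s => 1 / (m - 1) * Rpower (flux n h s) (1 / (m - 1) - 1))
    (fun s => h s - INR n * flux n h s / s)).
  - apply (continuous_mult (fun _ : R => 1 / (m - 1))
      (fun s => Rpower (flux n h s) (1 / (m - 1) - 1))); [apply continuous_const|].
    apply (ex_derive_continuous (fun s => Rpower (flux n h s) (1 / (m - 1) - 1))).
    eexists; now apply is_derive_Rpower_comp; [|exact Df].
  - apply (continuous_minus h (fun s => INR n * flux n h s / s)); [apply ch|].
    apply (ex_derive_continuous (fun s => INR n * flux n h s / s)).
    auto_derive; split; [eexists; exact Df|split; [lra|easy]].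
Qed.

Lemma profile_C1 Rad : C1_on (Icc 0 Rad) profile profile'.
Proof.
  apply C1_on_of_derive; intros r _; split.
  - assert (Hd := is_derive_scaled (drop n m h) _ r (is_derive_drop n m h (lam * r) Hm ch)).
    unfold profile.
    replace (profile' r) with (c * (0 - lam * slope n m h (lam * r))) by (unfold profile'; ring).
    apply (is_derive_scal (fun r => a - drop n m h (lam * r))).
    apply (is_derive_minus (fun _ => a) (fun r => drop n m h (lam * r))); [|exact Hd].
    apply (is_derive_const a r).
  - apply (continuous_opp (fun r => c * lam * slope n m h (lam * r))).
    apply (continuous_mult (fun _ : R => c * lam) (fun r => slope n m h (lam * r)));
      [apply continuous_const|].
    apply continuous_scaled. now apply slope_continuous.
Qed.

Lemma profile'_C1 Rad : C1_on (Ioc 0 Rad) profile' profile''.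
Proof.
  apply C1_on_of_derive; intros r [Hr _]; assert (Hs : 0 < lam * r) by nra; split.
  - assert (Hd := is_derive_scaled (slope n m h) _ r (is_derive_slope (lam * r) Hs)).
    replace (profile'' r) with (- (c * lam * (lam * slope' (lam * r))))
      by (unfold profile''; ring).
    apply (is_derive_opp (fun r => c * lam * slope n m h (lam * r))).
    now apply (is_derive_scal (fun r => slope n m h (lam * r))).
  - apply (continuous_opp (fun r => c * lam * lam * slope' (lam * r))).
    apply (continuous_mult (fun _ : R => c * lam * lam) (fun r => slope' (lam * r)));
      [apply continuous_const|].
    apply continuous_scaled. now apply slope'_continuous.
Qed.

Lemma profile'_0 : profile' 0 = 0.
Proof. unfold profile'; rewrite slope_nonpos by lra; ring. Qed.

Lemma flux_profile_ge0 s : 0 <= flux n h s.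
Proof.
  destruct (Rle_dec s 0); [rewrite flux_nonpos; lra|apply Rlt_le, Hflux; lra].
Qed.

Lemma profile_equation r : 0 < r ->
  derivable_pt_lim (fun s => - (s ^ n * mflux m (profile' s))) r
    (r ^ n * (Rpower (c * lam) (m - 1) * lam * h (lam * r))).
Proof.
  intros Hr; apply is_derive_Reals. assert (Hs : 0 < lam * r) by nra.
  set (K := Rpower (c * lam) (m - 1)).
  apply (is_derive_ext (fun s => K * (s ^ n * flux n h (lam * s)))).
  - intros s; unfold profile'.
    assert (Hsl : 0 <= slope n m h (lam * s)) by apply slope_ge0.
    rewrite mflux_opp by (apply Rmult_le_pos; nra).
    rewrite abs_pow_mult, (abs_pow_pos (c * lam)) by nra. fold K.
    unfold slope; rewrite abs_pow_abs_pow.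
    replace (1 / (m - 1) * (m - 1)) with 1 by (field; lra).
    rewrite abs_pow_1 by apply flux_profile_ge0. simpl; ring.
  - assert (Hd := is_derive_scaled (flux n h) _ r (is_derive_flux n h (lam * r) ch Hs)).
    assert (Hp : is_derive (fun s : R => s ^ n) r (INR n * r ^ pred n))
      by (auto_derive; [easy|ring]).
    replace (r ^ n * (K * lam * h (lam * r))) with
      (K * (INR n * r ^ pred n * flux n h (lam * r)
        + r ^ n * (lam * (h (lam * r) - INR n * flux n h (lam * r) / (lam * r))))).
    + apply (is_derive_scal (fun s => s ^ n * flux n h (lam * s))).
      apply (is_derive_mult (fun s => s ^ n) (fun s => flux n h (lam * s)));
        [exact Hp|exact Hd|exact Rmult_comm].
    + destruct n as [|n']; [simpl; field; lra|]. cbn [pred pow]. field; lra.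
Qed.

End Profile.

(** The flux has to be positive also at and beyond T, where the source may vanish, for [slope] to be
    C^1 up to the boundary; it is, because r^n times the flux never decreases. *)
Lemma flux_pos_of_initial n (h : R -> R) T s : cont h -> 0 < T ->
  (forall t, 0 <= t -> 0 <= h t) -> (forall t, 0 <= t < T -> 0 < h t) -> 0 < s ->
  0 < flux n h s.
Proof.
  intros ch HT Hpos HposT Hs. set (t := Rmin s (T / 2)).
  assert (T1 : t <= s) by apply Rmin_l. assert (T2 : t <= T / 2) by apply Rmin_r.
  assert (T0 : 0 < t) by (apply Rmin_pos; lra).
  assert (Ft : 0 < flux n h t) by (apply flux_pos; [easy|easy|intros; apply HposT; lra]).
  assert (H := flux_mono_mass n h t s ch Hpos ltac:(lra)).
  assert (P1 : 0 < t ^ n) by (apply pow_lt; lra).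
  assert (P2 : 0 < s ^ n) by (apply pow_lt; lra).
  destruct (Rlt_dec 0 (flux n h s)) as [?|Hn]; [easy|exfalso]. nra.
Qed.

Lemma regular_solution_of_ball_solution n p q delta mu Rad :
  1 < p -> 1 < q -> 0 < delta -> 0 < mu -> 0 < Rad ->
  0 < delta * mu - (p - 1) * (q - 1) ->
  ball_solution n p q delta mu ->
  exists u v, regular_solution (S n) Rad p q delta mu u v.
Proof.
  intros Hp Hq Hd Hm HR HD [T [eta [u [v [HT [cu [cv [uT [vT [Hpos Heq]]]]]]]]]].
  set (Del := delta * mu - (p - 1) * (q - 1)) in *.
  (* The system is invariant under u -> lam^al u(lam r), v -> lam^be v(lam r) when al and be solve
     the linear equations [Ea] and [Eb], whose determinant is Del up to sign. *)
  set (al := (p * (q - 1) + q * delta) / Del). set (be := (q * (p - 1) + p * mu) / Del).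
  assert (Ea : (al + 1) * (p - 1) + 1 = delta * be)
    by (unfold al, be; unfold Del in *; field; lra).
  assert (Eb : (be + 1) * (q - 1) + 1 = mu * al)
    by (unfold al, be; unfold Del in *; field; lra).
  set (lam := T / Rad). assert (Hlam : 0 < lam) by (apply Rdiv_lt_0_compat; lra).
  set (c1 := Rpower lam al). set (c2 := Rpower lam be).
  assert (Hc1 : 0 < c1) by apply Rpower_gt0. assert (Hc2 : 0 < c2) by apply Rpower_gt0.
  set (F := fun s => abs_pow (v s) delta). set (G := fun s => abs_pow (u s) mu).
  assert (cF : cont F).
  { apply (cont_comp (fun t => abs_pow t delta) v); [|easy].
    intros x; now apply abs_pow_continuous. }
  assert (cG : cont G).
  { apply (cont_comp (fun t => abs_pow t mu) u); [|easy].
    intros x; now apply abs_pow_continuous. }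
  assert (fF : forall s, 0 < s -> 0 < flux n F s).
  { intros s Hs; apply (flux_pos_of_initial n F T); try easy.
    - intros; apply abs_pow_ge0.
    - intros t Ht; apply abs_pow_gt0, Hpos, Ht. }
  assert (fG : forall s, 0 < s -> 0 < flux n G s).
  { intros s Hs; apply (flux_pos_of_initial n G T); try easy.
    - intros; apply abs_pow_ge0.
    - intros t Ht; apply abs_pow_gt0, Hpos, Ht. }
  assert (Hrange : forall r, 0 <= r <= Rad -> 0 <= lam * r <= T).
  { intros r Hr; split; [nra|]. replace T with (lam * Rad) by (unfold lam; field; lra).
    apply Rmult_le_compat_l; lra. }
  assert (HRad : lam * Rad = T) by (unfold lam; field; lra).
  assert (PU : forall r, 0 <= r <= Rad -> profile n p 1 c1 lam F r = c1 * u (lam * r)).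
  { intros r Hr; unfold profile. now rewrite (proj1 (Heq _ (Hrange r Hr))). }
  assert (PV : forall r, 0 <= r <= Rad -> profile n q eta c2 lam G r = c2 * v (lam * r)).
  { intros r Hr; unfold profile. now rewrite (proj2 (Heq _ (Hrange r Hr))). }
  assert (S1 : Rpower (c1 * lam) (p - 1) * lam = Rpower c2 delta).
  { unfold c1, c2. rewrite <- (Rpower_1 lam Hlam) at 2 3. rewrite <- Rpower_plus.
    rewrite !Rpower_mult, <- Rpower_plus. f_equal. rewrite (Rmult_comm be). exact Ea. }
  assert (S2 : Rpower (c2 * lam) (q - 1) * lam = Rpower c1 mu).
  { unfold c1, c2. rewrite <- (Rpower_1 lam Hlam) at 2 3. rewrite <- Rpower_plus.
    rewrite !Rpower_mult, <- Rpower_plus. f_equal. rewrite (Rmult_comm al). exact Eb. }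
  assert (Hlt : forall r, 0 <= r < Rad -> 0 <= lam * r < T).
  { intros r Hr; split; [nra|]. rewrite <- HRad. apply Rmult_lt_compat_l; lra. }
  exists (profile n p 1 c1 lam F), (profile n q eta c2 lam G).
  exists (profile' n p c1 lam F), (profile'' n p c1 lam F),
    (profile' n q c2 lam G), (profile'' n q c2 lam G).
  split; [now apply profile_C1|]. split; [now apply profile'_C1|].
  split; [now apply profile_C1|]. split; [now apply profile'_C1|].
  split; [|split; [|split; [apply profile'_0|split; [apply profile'_0|split; [|split]]]]].
  - intros r Hr. replace (S n - 1)%nat with n by lia.
    rewrite PV by lra. destruct (Hpos (lam * r)) as [Hur Hvr]; [apply Hlt; lra|].
    rewrite abs_pow_mult, (abs_pow_pos c2), <- S1 by lra.
    apply (profile_equation n p c1 lam F); try easy; lra.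
  - intros r Hr. replace (S n - 1)%nat with n by lia.
    rewrite PU by lra. destruct (Hpos (lam * r)) as [Hur Hvr]; [apply Hlt; lra|].
    rewrite abs_pow_mult, (abs_pow_pos c1), <- S2 by lra.
    apply (profile_equation n q c2 lam G); try easy; lra.
  - rewrite PU, HRad, uT by lra; ring.
  - rewrite PV, HRad, vT by lra; ring.
  - intros r Hr. rewrite PU, PV by lra.
    destruct (Hpos (lam * r)) as [Hur Hvr]; [now apply Hlt|].
    split; apply Rmult_lt_0_compat; easy.
Qed.

Lemma no_ground_state n p q delta mu k : 1 < p -> 1 < q -> 0 < delta -> 0 < mu ->
  0 < delta * mu - (p - 1) * (q - 1) ->
  pohozaev_exponent (INR n) p q delta mu k -> ~ ground_state n p q delta mu.
Proof.
  intros Hp Hq Hd Hm HD [K1 [K2 [K3 [K4 [K5 [K6 K7]]]]]] [eta [u [v [cu [cv H]]]]].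
  apply (ground_solution_absurd n p q delta mu k 1 eta u v); try easy;
    intros r Hr; now apply H.
Qed.

Lemma regular_solution_of_exponent n p q delta mu Rad :
  1 < p -> 1 < q -> 0 < delta -> 0 < mu -> 0 < Rad ->
  0 < delta * mu - (p - 1) * (q - 1) ->
  (exists k, pohozaev_exponent (INR n) p q delta mu k) ->
  exists u v, regular_solution (S n) Rad p q delta mu u v.
Proof.
  intros Hp Hq Hd Hm HR HD [k Hk].
  apply regular_solution_of_ball_solution; try easy.
  destruct (ground_state_or_ball_solution n p q delta mu) as [Hg|Hb]; try easy.
  now destruct (no_ground_state n p q delta mu k Hp Hq Hd Hm HD Hk).
Qed.

Theorem theorem1p5 :
  forall (N : nat) (Rad p q delta mu : R),
    (2 <= N)%nat -> 0 < Rad -> 1 < p -> 1 < q -> 0 < delta -> 0 < mu ->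
    delta * mu - (p - 1) * (q - 1) > 0 ->
    (2 * INR N / (INR N + 1) < p <= 2 ->
     2 * INR N / (INR N + 1) < q <= 2 ->
     1 / (delta + 1) + 1 / (mu + 1)
       > (INR N - Rmin p q) / (INR N * (Rmin p q - 1)) ->
     exists u v : R -> R, regular_solution N Rad p q delta mu u v)
    /\
    (2 <= p < INR N ->
     2 <= q < INR N ->
     1 / (delta + 1) + 1 / (mu + 1)
       > (INR N * (Rmax p q - 1) - Rmax p q) / (INR N * (Rmax p q - 1)) ->
     exists u v : R -> R, regular_solution N Rad p q delta mu u v).
Proof.
  intros [|n] Rad p q delta mu HN HR Hp Hq Hd Hm HD; [lia|].
  assert (Hn : 1 <= INR n) by (apply (le_INR 1); lia).
  rewrite S_INR. replace (INR n + 1 + 1) with (INR n + 2) by ring.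
  split; intros Hp2 Hq2 Hs; apply regular_solution_of_exponent; try easy.
  - now apply pohozaev_exponent_singular.
  - apply pohozaev_exponent_degenerate; try easy; lra.
Qed.
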